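(* Let $d\ge2$, let $k\ge\max\{d,3\}$ be an integer, let $K\subset\mathbb R^d$ be a nondegenerate $d$-simplex, and take the shape function space $$V^-(\operatorname{div}\operatorname{div};\mathbb S):=\mathbb P_k(K;\mathbb S)\oplus\boldsymbol x\boldsymbol x^{\intercal}\mathbb H_{k-1}(K).$$ Then the degrees of freedom $$\boldsymbol\tau(\delta)\quad\forall\,\delta\in\mathcal V(K),$$ $$(\boldsymbol n_i^{\intercal}\boldsymbol\tau\boldsymbol n_j,q)_F\quad\forall\,q\in\mathbb P_{k+r-d-1}(F),\ F\in\mathcal F^r(K),\ i,j=1,\dots,r,\ r=1,\dots,d-1,$$ $$(\Pi_F\boldsymbol\tau\boldsymbol n,\boldsymbol q)_F\quad\forall\,\boldsymbol q\in \mathrm{ND}_{k-2}(F),\ F\in\mathcal F^1(K),$$ $$(\boldsymbol n^{\intercal}\operatorname{div}\boldsymbol\tau+\operatorname{div}_F(\boldsymbol\tau\boldsymbol n),p)_F\quad\forall\,p\in\mathbb P_{k-1}(F),\ F\in\mathcal F^1(K),$$ $$(\boldsymbol\tau,\operatorname{def}\boldsymbol q)_K\quad\forall\,\boldsymbol q\in\mathbb P_{k-2}(K;\mathbb R^d),$$ $$(\boldsymbol\tau,\boldsymbol q)_K\quad\forall\,\boldsymbol q\in\ker(\cdot\boldsymbol x)\cap\mathbb P_{k-2}(K;\mathbb S)$$ are uni-solvent for $V^-(\operatorname{div}\operatorname{div};\mathbb S)$.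
   Context: Coordinates $\boldsymbol x$ on $\mathbb R^d$ are chosen with the origin in $K$. $\mathcal F^r(K)$ is the set of $(d-r)$-dimensional faces of $K$, and $\mathcal V(K)=\mathcal F^d(K)$ is the set of vertices. For $F\in\mathcal F^r(K)$ with $1\le r\le d-1$, $\boldsymbol n_1,\dots,\boldsymbol n_r$ (depending on $F$) are mutually orthogonal unit vectors spanning the orthogonal complement of the tangent space of $F$; for $r=1$ write $\boldsymbol n=\boldsymbol n_1$, $\Pi_F\boldsymbol v=(\boldsymbol I-\boldsymbol n\boldsymbol n^{\intercal})\boldsymbol v$, and $\operatorname{div}_F\boldsymbol v=\sum_{i=1}^{d-1}\boldsymbol t_i\cdot\partial_{\boldsymbol t_i}\boldsymbol v$ for an orthonormal basis $\boldsymbol t_1,\dots,\boldsymbol t_{d-1}$ of the tangent space of $F$ (surface divergence). $(\cdot,\cdot)_F$, $(\cdot,\cdot)_K$ are $L^2$ inner products. $\mathbb S$ (resp. $\mathbb K$) is the space of symmetric (resp. skew-symmetric) real matrices of the appropriate size ($d\times d$ on $K$). $\mathbb P_m(D)$ is the space of polynomials on $D$ of total degree $\le m$ ($\{0\}$ if $m<0$), $\mathbb H_m(D)$ is the space of homogeneous polynomials of degree $m$, and $\mathbb P_m(D;X)$, $\mathbb H_m(D;X)$ are the $X$-valued versions. For a simplex $D$ of dimension $s$ (a face being identified with a simplex in $\mathbb R^{s}$ through Cartesian coordinates $\boldsymbol x$ of its affine hull, tangential vectors being identified with $\mathbb R^s$), $\mathrm{ND}_m(D)=\mathbb P_m(D;\mathbb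 R^s)\oplus\mathbb H_m(D;\mathbb K)\boldsymbol x$ ($\{\boldsymbol 0\}$ if $m<0$). $\operatorname{div}$ of a matrix field is taken row-wise; $\operatorname{def}\boldsymbol q=\operatorname{sym}\nabla\boldsymbol q$ is the symmetric gradient. $\ker(\cdot\boldsymbol x)$ denotes matrix fields $\boldsymbol\tau$ with $\boldsymbol\tau\boldsymbol x=\boldsymbol 0$. Uni-solvent for a finite-dimensional space $V$ means: (a) the only $\boldsymbol\tau\in V$ for which all listed quantities vanish is $\boldsymbol\tau=\boldsymbol 0$; and (b) the number of degrees of freedom equals $\dim V$, where one counts $d(d+1)/2$ for each vertex value $\boldsymbol\tau(\delta)$, only pairs $i\le j$ in the families with $\boldsymbol n_i^{\intercal}\boldsymbol\tau\boldsymbol n_j$ (by symmetry), $\dim\{\operatorname{def}\boldsymbol q\}$ for the family tested against $\operatorname{def}\boldsymbol q$, and for every other family tested against $q$ in a space $Q$ the number $\dim Q$. (In a global finite element space, the degrees of freedom $(\Pi_F\boldsymbol\tau\boldsymbol n,\boldsymbol q)_F$ are treated as interior to $K$, i.e. not single-valued across elements; this does not affect uni-solvence.) *)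

(* Defs.v *)
(* MathComp / MathComp-Analysis; polynomials are {mpoly R[n]} of multinomials. *)
From HB Require Import structures.
From mathcomp Require Import all_boot all_order all_algebra.
From mathcomp Require Import all_classical all_reals all_analysis.
From mathcomp Require mpoly.
(* The notations of mpoly clash with those of MathComp-Analysis. *)
Export -(notations) mpoly.
Set Implicit Arguments.
Unset Strict Implicit.
Unset Printing Implicit Defensive.
Import Order.TTheory GRing.Theory Num.Theory.
Import numFieldNormedType.Exports.
Local Open Scope classical_set_scope.
Local Open Scope ring_scope.

Section Dimension.
Variables (R : realType) (L : nmodType) (sc : R -> L -> L).

Definition is_dim (W : set L) (m : nat) : Prop :=
  exists e : 'I_m -> L,
    (forall c : 'I_m -> R, \sum_i sc (c i) (e i) = 0 -> forall i, c i = 0) /\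
    W = [set x | exists c : 'I_m -> R, x = \sum_i sc (c i) (e i)].

(* 0 by convention if W is not a finite-dimensional subspace. *)
Definition fdim (W : set L) : nat := xget 0%N [set m | is_dim W m].

End Dimension.

Section Polynomials.
Variable R : realType.

Definition ev n (x : 'cV[R]_n) (p : mpoly n R) : R := meval (fun i => x i 0) p.

Definition ev_mx n a b (x : 'cV[R]_n) (A : 'M[mpoly n R]_(a, b)) : 'M[R]_(a, b) :=
  map_mx (ev x) A.

Definition cst_mx n a b (A : 'M[R]_(a, b)) : 'M[mpoly n R]_(a, b) :=
  map_mx (@mpolyC n R) A.

Definition scale_poly n (c : R) (p : mpoly n R) : mpoly n R := c *: p.

(* Matrices over mpoly n R seen as a vector space over R: the canonical *:
   has its scalars in mpoly n R. *)
Definition scale_mx n a b (c : R) (A : 'M[mpoly n R]_(a, b)) :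
  'M[mpoly n R]_(a, b) := mpolyC n c *: A.

Definition dim_poly n (W : set (mpoly n R)) : nat := fdim (@scale_poly n) W.
Definition dim_mx n a b (W : set 'M[mpoly n R]_(a, b)) : nat :=
  fdim (@scale_mx n a b) W.

(* P_m(D) and H_m(D) for D of dimension n
   (mmeasure mdeg p is deg p + 1, and 0 for p = 0). *)
Definition PP n m : set (mpoly n R) := [set p | (mmeasure mdeg p <= m.+1)%N].
Definition HH n m : set (mpoly n R) := [set p | p \is ishomog1 m mdeg].

Definition Pmx n m a b : set 'M[mpoly n R]_(a, b) :=
  [set A : 'M[mpoly n R]_(a, b) | forall i j, PP m (A i j)].

Definition PS n m : set 'M[mpoly n R]_n :=
  [set A | @Pmx n m n n A /\ A^T = A].

Definition HK n m : set 'M[mpoly n R]_n :=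
  [set A : 'M[mpoly n R]_n | (forall i j, HH m (A i j)) /\ A^T = - A].

Definition xvec n : 'cV[mpoly n R]_n := \col_i mpolyX R (mnm1 i).

Definition ND n m : set 'cV[mpoly n R]_n :=
  [set q | exists p W, [/\ @Pmx n m n 1 p, HK m W & q = p + W *m xvec n]].

Definition Vminus n k : set 'M[mpoly n R]_n :=
  [set tau | exists sigma q, [/\ PS k sigma, HH (k - 1) q &
     tau = sigma + q *: (xvec n *m (xvec n)^T)]].

Definition div_mx n (tau : 'M[mpoly n R]_n) : 'cV[mpoly n R]_n :=
  \col_i \sum_j mderiv j (tau i j).

Definition sym_grad n (q : 'cV[mpoly n R]_n) : 'M[mpoly n R]_n :=
  \matrix_(i, j) ((2^-1 : R) *: (mderiv j (q i 0) + mderiv i (q j 0))).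

Definition dir_deriv n (u : 'cV[R]_n) (p : mpoly n R) : mpoly n R :=
  \sum_j u j 0 *: mderiv j p.

(* Surface divergence; the columns of t are the orthonormal tangent vectors. *)
Definition div_surf n s (t : 'M[R]_(n, s)) (w : 'cV[mpoly n R]_n) : mpoly n R :=
  \sum_(i < s) \sum_(a < n) t a i *: dir_deriv (col i t) (w a 0).

Definition ker_x n : set 'M[mpoly n R]_n := [set tau | tau *m xvec n = 0].

End Polynomials.

Arguments PP {R} n m.
Arguments HH {R} n m.
Arguments Pmx {R} n m a b.
Arguments PS {R} n m.
Arguments HK {R} n m.
Arguments xvec {R} n.
Arguments ND {R} n m.
Arguments Vminus {R} n k.
Arguments ker_x {R} n.

Section Simplex.
Variable R : realType.

(* Lebesgue integral over {y in R^s | y_i >= 0, y_1 + ... + y_s <= c}, written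
   as an iterated one-dimensional Lebesgue integral. *)
Fixpoint simplex_int (s : nat) (c : R) : ('cV[R]_s -> R) -> R :=
  match s with
  | 0 => fun f => f 0
  | s'.+1 => fun f => \int[lebesgue_measure]_(t in `[0, c])
      simplex_int (c - t) (fun y : 'cV[R]_s' => f (col_mx (t%:M : 'cV_1) y))
  end.

Variables (d : nat) (v : 'I_d.+1 -> 'cV[R]_d).

Definition nondegenerate_simplex : Prop :=
  row_free (\matrix_(i < d) (v (lift ord0 i) - v ord0)^T).

Definition simplex : set 'cV[R]_d :=
  [set x | exists l : 'I_d.+1 -> R,
     [/\ forall i, 0 <= l i, \sum_i l i = 1 & x = \sum_i l i *: v i]].

(* A face is given by the set F of indices of its vertices. *)
Implicit Types F : {set 'I_d.+1}.

(* The faces of codimension r. *)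
Definition faces (r : nat) : {set {set 'I_d.+1}} :=
  [set F : {set 'I_d.+1} | (#|F| + r == d.+1)%N]%SET.

Definition face_vertex F (j : nat) : 'cV[R]_d := v (nth ord0 (enum F) j).

Definition face_edges F : 'M[R]_(d, #|F|.-1) :=
  \matrix_(i, j) (face_vertex F j.+1 - face_vertex F 0) i 0.

(* Integral over the face with respect to its surface measure: pull-back by the
   affine parametrization y |-> v_0 + E y of the face by the reference simplex,
   with the Jacobian sqrt(det(E^T E)); for F = setT this is the integral over
   the whole simplex. *)
Definition face_int F (f : 'cV[R]_d -> R) : R :=
  let E := face_edges F in
  Num.sqrt (\det (E^T *m E)) *
  simplex_int 1 (fun y => f (face_vertex F 0 + E *m y)).

(* The row space of this matrix is the tangent space of the face. *)
Definition tangent F : 'M[R]_d :=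
  (\sum_(i in F) \sum_(j in F) <<(v i - v j)^T>>)%MS.

(* o is the origin, and the columns of t are the axes, of Cartesian coordinates
   of the affine hull of the face; the columns of n are the normals n_1..n_r. *)
Record face_frame (r : nat) F (o : 'cV[R]_d) (t : 'M[R]_(d, d - r))
    (n : 'M[R]_(d, r)) : Prop := FaceFrame {
  frame_origin : forall i, i \in F -> ((o - v i)^T <= tangent F)%MS;
  frame_tangent_orthonormal : t^T *m t = 1%:M;
  frame_tangent_span : (t^T == tangent F)%MS;
  frame_normal_orthonormal : n^T *m n = 1%:M;
  frame_normal_span : (n^T == kermx (tangent F)^T)%MS
}.

End Simplex.

Definition face_coord (R : realType) d s (o : 'cV[R]_d) (t : 'M[R]_(d, s))
  (x : 'cV[R]_d) : 'cV[R]_s := t^T *m (x - o).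

Definition dot (R : realType) d (u w : 'cV[R]_d) : R := (u^T *m w) 0 0.

Definition mxdot (R : realType) d (A B : 'M[R]_d) : R :=
  \sum_i \sum_j A i j * B i j.

(* Each entry below corresponds to one family of degrees of freedom, in order. *)
Definition num_dofs (R : realType) (d k : nat) : nat :=
  (\sum_(delta < d.+1) (d * d.+1)./2
   + \sum_(1 <= r < d) \sum_(F in faces d r)
       #|[pred ij : 'I_r * 'I_r | (ij.1 <= ij.2)%N]|
       * dim_poly (PP (R := R) (d - r) (k + r - d.+1))
   + \sum_(F in faces d 1) dim_mx (ND (R := R) (d - 1) (k - 2))
   + \sum_(F in faces d 1) dim_poly (PP (R := R) (d - 1) (k - 1))
   + dim_mx [set A | exists2 q, Pmx (R := R) d (k - 2) d 1 q & A = sym_grad q]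
   + dim_mx (ker_x d `&` PS (R := R) d (k - 2)))%N.

(* Main.v *)
(* If all degrees of freedom of tau = sigma + x x^T q vanish, tau is peeled off
   from the vertices inwards. On a face F with normals a, b the component
   a^T tau b has degree at most k (x.b is constant on F), vanishes on the boundary
   of F by induction on dim F, hence is a multiple of the bubble of F, and the
   cofactor is itself an admissible test function. On a facet, w = tau n is then
   tangential with g_i.w = lambda_i p_i (g_i the gradient of the barycentric
   coordinate lambda_i); as P_{k-1}(F; R^{d-1}) = grad P_k(F) + ND_{k-2}(F),
   integration by parts gives first div_F w = 0, then w = 0; the next family gives
   n.div tau = 0. In K, integration by parts against grad(div div tau) gives
   div div tau = 0, whose part of degree k - 1 is a positive multiple of q, so
   q = 0; testing against b_i g_i, where g_i.div tau = lambda_i b_i, gives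
   div tau = 0. Finally P_{k-2}(K; S) is the sum of def P_{k-1} and of the tau with
   tau x = 0, so tau is orthogonal to it, and g_i^T tau g_j = lambda_i lambda_j p_ij
   is killed by the test function sym(p_ij g_i g_j^T).

   Dimensions come from rank-nullity: ND_m is the kernel of q |-> (x.q)_{m+2} on
   P_{m+1}, and def P_m + (ker(.x) in P_m(S)) is the kernel of
   tau |-> (tau x)_{m+1} on P_m(S), the index denoting a homogeneous part. The
   number of vertex and normal-normal degrees of freedom is a Vandermonde sum. *)
Require Import Defs.
From HB Require Import structures.
From mathcomp Require Import all_boot all_order all_algebra.
From mathcomp Require Import all_classical all_reals all_analysis.
From mathcomp Require Import ring lra zify.
From mathcomp Require polyrcf.
Import Order.TTheory GRing.Theory Num.Theory.
Import numFieldNormedType.Exports.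
Local Open Scope classical_set_scope.
Local Open Scope ring_scope.
Set Implicit Arguments.
Unset Strict Implicit.
Unset Printing Implicit Defensive.

(** The frames in the degrees of freedom are unrelated from one face to the next, whereas division
    by barycentric coordinates is an oblique matter. The argument therefore runs on the gradients
    g_i: those with i outside F are normal to F, and a frame appears only at the moment a degree of
    freedom is used. Integrals are reduced to polynomial algebra: their values on monomials give
    linearity and a divergence theorem, which has no boundary term because it is applied only to
    fields whose g_i-component contains the factor lambda_i. The one further analytic input is that
    a nonnegative polynomial with integral zero vanishes. The obstacle inside K is that the
    enrichment has degree k+1, one too many for the cofactors to be admissible test functions. It
    has to be removed before div tau or the components of tau are tested, and div div can do this:
    two derivatives leave degree k-1, whose gradient is just admissible. In the count, neither of
    the two interior families has its dimension computed; only their sum is. *)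

Notation msz := (mmeasure mdeg).
Notation "\X_ i" := (mpolyX _ (mnm1 i)) (at level 8, i at level 2, format "\X_ i").

(** * Integration over the reference simplex *)

Section Univariate.
Variable R : realType.
Implicit Types (P : {poly R}) (c : R).

Lemma poly_eq0_itv P c : 0 < c -> (forall x, 0 < x < c -> P.[x] = 0) -> P = 0.
Proof.
move=> c0 hP; apply/eqP; apply: contraT => P0.
(* The points c/2, c/3, ... are [size P] distinct points of the interval, more than a nonzero [P]
   has roots. *)
pose rs := [seq c / (i.+2)%:R | i <- iota 0 (size P)].
have := @max_poly_roots _ P rs P0; rewrite size_map size_iota ltnn; apply.
- apply/allP => _ /mapP[i _ ->]; apply/rootP/hP.
  rewrite divr_gt0 ?ltr0n //= ltr_pdivrMr ?ltr0n // ltr_pMr // ltr1n //.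
- rewrite map_inj_uniq ?iota_uniq // => i j /(mulfI (lt0r_neq0 c0)) /invr_inj.
  by move/eqP; rewrite eqr_nat => /eqP[].
Qed.

Lemma Rintegral_deriv_horner P c : 0 <= c ->
  \int[lebesgue_measure]_(t in `[0, c]) P^`().[t] = P.[c] - P.[0].
Proof.
rewrite le_eqVlt => /predU1P[<-|c0].
  by rewrite set_itv1 Rintegral_set1 subrr.
rewrite /Rintegral (@continuous_FTC2 _ _ (horner P)) //.
- exact/continuous_subspaceT/continuous_horner.
- split=> [x _||]; first exact: derivable_horner.
  + exact/cvg_at_right_filter/continuous_horner.
  + exact/cvg_at_left_filter/continuous_horner.
- by move=> x _; rewrite derivE.
Qed.

(** Positivity of the integral in one variable: [P] is a primitive of the integrand, and a
    nondecreasing [P] with equal end values is squeezed to a constant. *)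
Lemma deriv_eq0_ge0 P c : 0 < c -> (forall x, 0 <= x <= c -> 0 <= P^`().[x]) ->
  P.[c] = P.[0] -> P^`() = 0.
Proof.
move=> c0 hP Pc.
suff -> : P = (P.[0])%:P by rewrite derivC.
apply/eqP; rewrite -subr_eq0; apply/eqP/(poly_eq0_itv c0) => x /andP[x0 xc].
have [y /[!in_itv]/= /andP[y0 yx] ey] := polyrcf.poly_mvt P x0.
have [z /[!in_itv]/= /andP[zx zc] ez] := polyrcf.poly_mvt P xc.
have := hP y; have := hP z; rewrite !hornerE => hz hy.
have : 0 <= P.[x] - P.[0].
  by rewrite ey mulr_ge0 ?subr_ge0 ?(ltW x0)// hy // ltW //= ltW // (lt_trans yx).
have : 0 <= P.[c] - P.[x].
  rewrite ez mulr_ge0 ?subr_ge0 ?(ltW xc)// hz // (ltW zc) andbT.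
  by rewrite ltW // (lt_trans x0).
rewrite Pc; lra.
Qed.

(** Euler's beta integral, by induction on [b]: one integration by parts lowers [b] and raises [a].
    A polynomial primitive is kept, not only the value, so that primitives of sums can be formed
    before integrating. *)
Lemma beta_primitive (a b : nat) c :
  exists B : {poly R}, [/\ B^`() = 'X^a * (c%:P - 'X) ^+ b, B.[0] = 0 &
     B.[c] = (a`!%:R * b`!%:R) / (a + b).+1`!%:R * c ^+ (a + b).+1].
Proof.
elim: b a => [|b IH] a.
  exists (a.+1%:R^-1 *: 'X^(a.+1)); split.
  - rewrite derivZ derivXn expr0 mulr1 /= -[X in _ *: X]scaler_nat scalerA mulVf ?scale1r //.
  - by rewrite !hornerE expr0n mulr0.
  - rewrite addn0 factS natrM fact0 mulr1 hornerZ hornerXn.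
    by field; rewrite pnatr_eq0 gtn_eqF ?fact_gt0 //= nat1r pnatr_eq0.
have [B [B1 B2 B3]] := IH a.+1.
exists (a.+1%:R^-1 *: ('X^(a.+1) * (c%:P - 'X) ^+ b.+1 + b.+1%:R *: B)); split.
- rewrite derivZ derivD derivZ B1 derivM derivXn deriv_exp derivB derivC derivX.
  rewrite /= sub0r mulN1r mulNrn mulrN mulrnAr scaler_nat subrK mulrnAl.
  by rewrite -scalerMnr scalerMnl -mulr_natr mulVf ?pnatr_eq0 // scale1r.
- by rewrite !hornerE B2 expr0n mul0r mulr0 add0r mulr0.
- rewrite !hornerE subrr expr0n mulr0 add0r B3 addnS addSn (factS a) (factS b) (natrM _ a.+1) (natrM _ b.+1).
  have key (x y z u w D : R) : x != 0 -> x^-1 * (y * (x * z * u / D * w)) = z * (y * u) / D * w.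
    by move=> x0; rewrite -!mulrA [y * (x * _)]mulrCA mulKf // mulrCA.
  by apply: key; rewrite pnatr_eq0.
Qed.
End Univariate.

(* Dirichlet's formula for the integral of y^m over the unit simplex. *)
Definition dirichlet (R : realType) s (m : 'I_s -> nat) : R :=
  (\prod_i (m i)`!%:R) / (\sum_i m i + s)%N`!%:R.

Section SimplexIntegral.
Variable R : realType.

Lemma col_mx_simplexE s (t : R) (y : 'cV[R]_s) :
  (forall i, (col_mx (t%:M : 'cV_1) y) (lift ord0 i) 0 = y i 0) /\
  (col_mx (t%:M : 'cV_1) y) ord0 0 = t.
Proof.
split=> [i|].
  by rewrite (_ : lift _ _ = rshift 1 i) ?col_mxEd //; apply: val_inj.
rewrite -[RHS](_ : (t%:M : 'cV_1) 0 0 = t); last by rewrite mxE eqxx mulr1n.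
by rewrite -(col_mxEu (t%:M : 'cV_1) y); congr (col_mx _ _ _ _); apply: val_inj.
Qed.

Lemma simplex_int_ge0 s (c : R) (f : 'cV[R]_s -> R) : 0 <= c ->
  (forall y : 'cV[R]_s, (forall i, 0 <= y i 0) -> \sum_i y i 0 <= c -> 0 <= f y) ->
  0 <= simplex_int c f.
Proof.
elim: s c f => [|s IH] c f c0 hf /=.
  by apply: hf => [[]//|]; rewrite big_ord0.
apply: Rintegral_ge0 => t /=; rewrite in_itv /= => /andP[t0 tc].
apply: IH => [|y y0 yc]; first by rewrite subr_ge0.
have [E1 E0] := col_mx_simplexE t y.
apply: hf => [i|].
  by case: (unliftP ord0 i) => [j|] ->; rewrite ?E1 ?E0.
by rewrite big_ord_recl E0 (eq_bigr _ (fun i _ => E1 i)) -lerBrDl.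
Qed.

Lemma section_sumE s (t : R) (I : Type) (r : seq I) (a : I -> R)
    (m : I -> 'I_s.+1 -> nat) :
  (fun y : 'cV[R]_s =>
     \sum_(k <- r) a k * \prod_i (col_mx (t%:M : 'cV_1) y) i 0 ^+ m k i) =
  (fun y => \sum_(k <- r) (a k * t ^+ m k ord0) *
              \prod_i y i 0 ^+ m k (lift ord0 i)).
Proof.
apply/funext => y; apply: eq_bigr => k _.
have [E1 E0] := col_mx_simplexE t y.
rewrite big_ord_recl E0 mulrA; congr (_ * _).
by apply: eq_bigr => i _; rewrite E1.
Qed.

(** A sum of monomials is still one after its first coordinate is frozen, so the inner integral is a
    polynomial in t with a known primitive; additivity of the iterated Lebesgue integral is never
    invoked. The size [c] is general because the slices have size c - t. *)
Lemma simplex_int_sum s (c : R) (I : Type) (r : seq I) (a : I -> R)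
    (m : I -> 'I_s -> nat) : 0 <= c ->
  simplex_int c (fun y : 'cV[R]_s => \sum_(k <- r) a k * \prod_i y i 0 ^+ m k i) =
  \sum_(k <- r) a k * dirichlet R (m k) * c ^+ (\sum_i m k i + s)%N.
Proof.
elim: s c I r a m => [|s IH] c I r a m c0 /=.
  apply: eq_bigr => k _; rewrite /dirichlet !big_ord0 addn0 fact0.
  by rewrite expr0 divr1 !mulr1.
pose m' k i := m k (lift ord0 i); pose b k := (\sum_i m' k i + s)%N.
have dirE k : dirichlet R (m k) =
    dirichlet R (m' k) * ((m k ord0)`!%:R * (b k)`!%:R / (m k ord0 + b k).+1`!%:R).
  rewrite /dirichlet !big_ord_recl -/(b k) addnS -addnA.
  by field; rewrite !pnatr_eq0 !gtn_eqF ?fact_gt0.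
have bE k : (\sum_i m k i + s.+1)%N = (m k ord0 + b k).+1.
  by rewrite big_ord_recl addnS -addnA.
pose B k := projT1 (cid (beta_primitive (m k ord0) (b k) c)).
have BP k := projT2 (cid (beta_primitive (m k ord0) (b k) c)).
pose P := \sum_(k <- r) (a k * dirichlet R (m' k)) *: B k.
transitivity (\int[lebesgue_measure]_(t in `[0, c]) P^`().[t]).
  apply: eq_Rintegral => t; rewrite inE /= in_itv /= => /andP[t0 tc].
  rewrite section_sumE IH ?subr_ge0 // raddf_sum horner_sum.
  apply: eq_bigr => k _ /=; have [B1 _ _] := BP k.
  rewrite derivZ hornerZ B1 -/(b k).
  rewrite hornerM hornerXn horner_exp hornerD hornerN hornerC hornerX.
  by rewrite /dirichlet; ring.
rewrite Rintegral_deriv_horner // !horner_sum -sumrB; apply: eq_bigr => k _.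
by have [_ B2 B3] := BP k; rewrite !hornerZ B2 B3 mulr0 subr0 dirE bE; ring.
Qed.

(** Induction on the dimension: as a function of the first coordinate the inner integral is a
    nonnegative polynomial of integral zero, hence zero, and the hypothesis passes to every slice.
    The strict inequality in the conclusion keeps the sizes positive. *)
Lemma simplex_int_sum_eq0 s (c : R) (I : Type) (r : seq I) (a : I -> R)
    (m : I -> 'I_s -> nat)
    (f := fun y : 'cV[R]_s => \sum_(k <- r) a k * \prod_i y i 0 ^+ m k i) :
  (forall y : 'cV[R]_s, (forall i, 0 <= y i 0) -> \sum_i y i 0 <= c -> 0 <= f y) ->
  simplex_int c f = 0 ->
  forall y : 'cV[R]_s, (forall i, 0 <= y i 0) -> \sum_i y i 0 < c -> f y = 0.
Proof.
elim: s c I r a m @f => [|s IH] c I r a m f f0 If0 y y0 yc.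
  by rewrite -If0 /=; congr f; apply/matrixP => -[].
have c0 : 0 < c by apply: le_lt_trans yc; apply: sumr_ge0.
have antider (Q : {poly R}) : exists P : {poly R}, P^`() = Q.
  exists (\sum_(i < size Q) (Q`_i / i.+1%:R) *: 'X^(i.+1)).
  rewrite raddf_sum -[RHS]coefK poly_def; apply: eq_bigr => i _ /=.
  by rewrite derivZ derivXn /= -scalerMnr scalerMnl -mulr_natr divfK ?pnatr_eq0.
pose Q : {poly R} := \sum_(k <- r)
  (a k * dirichlet R (fun i => m k (lift ord0 i))) *:
  ('X^(m k ord0) * (c%:P - 'X) ^+ (\sum_i m k (lift ord0 i) + s)).
have [P PQ] := antider Q.
have PE t : 0 <= t <= c ->
    simplex_int (c - t) (fun y : 'cV_s => f (col_mx (t%:M : 'cV_1) y)) = P^`().[t].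
  move=> /andP[t0 tc]; rewrite /f section_sumE simplex_int_sum ?subr_ge0 //.
  rewrite PQ horner_sum; apply: eq_bigr => k _; rewrite hornerZ.
  rewrite hornerM hornerXn horner_exp hornerD hornerN hornerC hornerX.
  by rewrite /dirichlet; ring.
have f0' t : 0 <= t -> forall z : 'cV[R]_s, (forall i, 0 <= z i 0) ->
    \sum_i z i 0 <= c - t -> 0 <= f (col_mx (t%:M : 'cV_1) z).
  move=> t0 z z0 zc; have [E1 E0] := col_mx_simplexE t z; apply: f0 => [i|].
    by case: (unliftP ord0 i) => [j|] ->; rewrite ?E1 ?E0.
  by rewrite big_ord_recl E0 (eq_bigr _ (fun i _ => E1 i)) -lerBrDl.
have P0 : P^`() = 0.
  apply: (deriv_eq0_ge0 c0) => [x /andP[x0 xc]|].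
    rewrite -PE ?x0 //; apply: simplex_int_ge0; first by rewrite subr_ge0.
    exact: f0'.
  apply/eqP; rewrite -subr_eq0 -Rintegral_deriv_horner ?(ltW c0) //.
  rewrite -[X in _ == X]If0 /=; apply/eqP/eq_Rintegral => t; rewrite inE /= in_itv /= => /PE <-.
  by [].
pose t := y ord0 0; pose z : 'cV[R]_s := \col_i y (lift ord0 i) 0.
have yE : y = col_mx (t%:M : 'cV_1) z.
  have [E1 E0] := col_mx_simplexE t z.
  apply/matrixP => i j; rewrite ord1.
  by case: (unliftP ord0 i) => [k|] ->; rewrite ?E1 ?E0 // mxE.
have sy : \sum_i y i 0 = t + \sum_i z i 0.
  by rewrite big_ord_recl; congr (_ + _); apply: eq_bigr => i _; rewrite mxE.
have z0 i : 0 <= z i 0 by rewrite mxE.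
have t0 : 0 <= t := y0 ord0.
have tc : t <= c.
  by apply: ltW; apply: le_lt_trans yc; rewrite sy lerDl sumr_ge0.
have := PE t; rewrite t0 tc P0 horner0 => /(_ isT).
have fE w : f (col_mx (t%:M : 'cV_1) w) =
    \sum_(k <- r) (a k * t ^+ m k ord0) * \prod_i w i 0 ^+ m k (lift ord0 i).
  exact: (congr1 (@^~ w) (section_sumE t r a m)).
rewrite (funext fE) yE fE => If.
apply: (IH (c - t)) => //; last by rewrite ltrBrDl -sy.
by move=> w w0 wc; rewrite -fE; apply: f0'.
Qed.
End SimplexIntegral.

(** * Multivariate polynomials as functions *)

Section MpolyBasics.
Variable R : realType.
Implicit Types n s N : nat.

Lemma mpoly_alg_ind n (P : mpoly n R -> Prop) :
  (forall c, P (mpolyC n c)) -> (forall i, P (\X_i)) ->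
  (forall p q, P p -> P q -> P (p + q)) ->
  (forall p q, P p -> P q -> P (p * q)) -> forall p, P p.
Proof.
move=> PC PX PD PM p; rewrite [p]mpolyE.
have P0 : P 0 by rewrite -(mpolyC0 n R); apply: PC.
have P1 : P 1 by rewrite -(mpolyC1 n R); apply: PC.
elim/big_rec: _ => // m q _ Pq; apply: (PD) Pq.
rewrite -mul_mpolyC; apply: (PM); first exact: PC.
rewrite mpolyXE_id; elim/big_rec: _ => // i r _ Pr; apply: (PM) Pr.
by elim: (m i) => [|k IH]; rewrite ?expr0 // exprS; apply: (PM).
Qed.

Lemma mszP n (p : mpoly n R) N :
  (msz p <= N)%N <-> (forall m : multinom n, (N <= mdeg m)%N -> mcoeff m p = 0).
Proof.
split=> [pN m Nm|h].
  by apply/memN_msupp_eq0/mmeasure_mnm_ge; apply: leq_trans Nm.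
rewrite mmeasureE big_seq; elim/big_rec: _ => // m k mp kN.
rewrite geq_max kN andbT ltnNge; apply: contraL mp => /h /eqP.
by rewrite mcoeff_eq0.
Qed.

Lemma mszD n (p q : mpoly n R) N : (msz p <= N -> msz q <= N -> msz (p + q) <= N)%N.
Proof. by move=> pN qN; apply: leq_trans (mmeasureD_le _ _ _) _; rewrite geq_max pN. Qed.

Lemma mszB n (p q : mpoly n R) N : (msz p <= N -> msz q <= N -> msz (p - q) <= N)%N.
Proof. by move=> pN qN; apply: mszD; rewrite ?mmeasureN. Qed.

Lemma msz_sum n (I : Type) (r : seq I) (P : pred I) (F : I -> mpoly n R) N :
  (forall i, P i -> msz (F i) <= N)%N -> (msz (\sum_(i <- r | P i) F i) <= N)%N.
Proof.
move=> h; elim/big_rec: _ => [|i p Pi pN]; first by rewrite mmeasure0.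
by apply: mszD => //; apply: h.
Qed.

Lemma mszM n (p q : mpoly n R) a b :
  (msz p <= a.+1 -> msz q <= b -> msz (p * q) <= a + b)%N.
Proof.
move=> pa qb; have [->|p0] := eqVneq p 0; first by rewrite mul0r mmeasure0.
have [->|q0] := eqVneq q 0; first by rewrite mulr0 mmeasure0.
by rewrite msizeM // -subn1 leq_subLR add1n -addSn leq_add.
Qed.

Lemma mszZ n (c : R) (p : mpoly n R) N : (msz p <= N -> msz (c *: p) <= N)%N.
Proof. exact/leq_trans/mmeasureZ_le. Qed.

Lemma mszC n (c : R) : (msz (mpolyC n c) <= 1)%N.
Proof. by rewrite mmeasureC leq_b1. Qed.

Lemma mszXU n (i : 'I_n) : msz (\X_i : mpoly n R) = 2%N.
Proof. by rewrite msizeX mdeg1. Qed.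

Lemma msz_deriv n (p : mpoly n R) i N : (msz p <= N.+1 -> msz (mderiv i p) <= N)%N.
Proof.
move=> /mszP h; apply/mszP => m Nm; rewrite mcoeff_mderiv h ?mul0rn //.
by rewrite mdegD mdeg1 addn1.
Qed.

Lemma mszS n (p : mpoly n R) N : (msz p <= N -> msz p <= N.+1)%N.
Proof. by move=> /leq_trans; apply. Qed.

HB.instance Definition _ n (x : 'cV[R]_n) :=
  GRing.RMorphism.copy (@ev R n x) (meval (fun i => x i 0)).

Lemma evC n (x : 'cV[R]_n) c : ev x (mpolyC n c) = c.
Proof. exact: mevalC. Qed.

Lemma evX n (x : 'cV[R]_n) i : ev x (\X_i) = x i 0.
Proof. exact: mevalXU. Qed.

Lemma ev0 n (x : 'cV[R]_n) : ev x 0 = 0.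
Proof. exact: rmorph0. Qed.

Lemma ev1 n (x : 'cV[R]_n) : ev x 1 = 1.
Proof. exact: rmorph1. Qed.

Lemma evD n (x : 'cV[R]_n) p q : ev x (p + q) = ev x p + ev x q.
Proof. exact: rmorphD. Qed.

Lemma evB n (x : 'cV[R]_n) p q : ev x (p - q) = ev x p - ev x q.
Proof. exact: rmorphB. Qed.

Lemma evM n (x : 'cV[R]_n) p q : ev x (p * q) = ev x p * ev x q.
Proof. exact: rmorphM. Qed.

Lemma ev_sum n (x : 'cV[R]_n) (I : Type) (r : seq I) (P : pred I) (F : I -> mpoly n R) :
  ev x (\sum_(i <- r | P i) F i) = \sum_(i <- r | P i) ev x (F i).
Proof. exact: rmorph_sum. Qed.

Lemma ev_prod n (x : 'cV[R]_n) (I : Type) (r : seq I) (P : pred I) (F : I -> mpoly n R) :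
  ev x (\prod_(i <- r | P i) F i) = \prod_(i <- r | P i) ev x (F i).
Proof. exact: rmorph_prod. Qed.

Lemma evZ n (x : 'cV[R]_n) c p : ev x (c *: p) = c * ev x p.
Proof. exact: mevalZ. Qed.

Lemma mderivXU n (i j : 'I_n) : mderiv j (\X_i : mpoly n R) = (i == j)%:R.
Proof.
rewrite mderivX mnm1E; have [->|_] := eqVneq i j; last by rewrite scale0r.
rewrite scale1r -(mpolyX0 n R); congr mpolyX.
by apply/mnmP => l; rewrite mnmBE subnn mnm0E.
Qed.

(** One chain rule for all substitutions: restriction to a line and affine changes of variables are
    both instances of [mmap], with [D] a derivation of the target ring that kills constants. *)
Lemma deriv_mmap n (S : comNzRingType) (f : {rmorphism R -> S}) (h : 'I_n -> S)
    (D : S -> S) :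
  (forall a b, D (a + b) = D a + D b) ->
  (forall a b, D (a * b) = D a * b + a * D b) -> (forall c, D (f c) = 0) ->
  forall p, D (mmap f h p) = \sum_j mmap f h (mderiv j p) * D (h j).
Proof.
move=> DD DM DC; elim/mpoly_alg_ind => [c|i|p q IHp IHq|p q IHp IHq].
- by rewrite mmapC DC big1 // => j _; rewrite mderivC rmorph0 mul0r.
- rewrite mmapX mmap1U (bigD1 i) //= big1 => [|j ji].
    by rewrite mderivXU eqxx rmorph1 mul1r addr0.
  by rewrite mderivXU eq_sym (negbTE ji) rmorph0 mul0r.
- rewrite rmorphD DD IHp IHq -big_split; apply: eq_bigr => j _.
  by rewrite mderivD rmorphD mulrDl.
- rewrite rmorphM DM IHp IHq mulr_suml mulr_sumr -big_split.
  by apply: eq_bigr => j _; rewrite mderivM rmorphD !rmorphM /=; ring.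
Qed.

End MpolyBasics.

Section Substitution.
Variable R : realType.
Implicit Types n s N : nat.

Lemma ev_dir_deriv n (x u : 'cV[R]_n) p :
  ev x (dir_deriv u p) = \sum_j u j 0 * ev x (mderiv j p).
Proof. by rewrite rmorph_sum; apply: eq_bigr => j _; rewrite /= evZ. Qed.

Definition line n (x u : 'cV[R]_n) : mpoly n R -> {poly R} :=
  mmap (@polyC R) (fun i => (x i 0)%:P + u i 0 *: 'X).

Lemma line_horner n (x u : 'cV[R]_n) p t : (line x u p).[t] = ev (x + t *: u) p.
Proof.
rewrite /line; elim/mpoly_alg_ind: p => [c|i|p q IHp IHq|p q IHp IHq].
- by rewrite mmapC hornerC evC.
- by rewrite mmapX mmap1U evX !mxE !hornerE mulrC.
- by rewrite !rmorphD /= hornerD IHp IHq.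
- by rewrite !rmorphM /= hornerM IHp IHq.
Qed.

Lemma line_deriv n (x u : 'cV[R]_n) p :
  (line x u p)^`() = line x u (dir_deriv u p).
Proof.
rewrite /line (@deriv_mmap _ _ _ _ _ (@deriv R)) //; first last.
- exact: derivC.
- by move=> a b; rewrite derivM.
- by move=> a b; rewrite derivD.
rewrite /dir_deriv rmorph_sum; apply: eq_bigr => j _.
by rewrite /= mmapZ derivD derivC add0r derivZ derivX alg_polyC mulrC.
Qed.

Lemma mderiv_eq0_const n (p : mpoly n R) : (forall j, mderiv j p = 0) ->
  p = mpolyC n (mcoeff mnm0 p).
Proof.
move=> h; apply: msize1_polyC; apply/mszP => m.
rewrite lt0n mdeg_eq0 => m0; have [i mi] : exists i, m i != 0%N.
  apply/existsP; apply: contraNT m0 => /existsPn h0.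
  by apply/eqP/mnmP => i; rewrite mnm0E; have /negPn/eqP := h0 i.
have := congr1 (mcoeff (mnm_sub m (mnm1 i))) (h i).
rewrite mcoeff_mderiv mcoeff0 submK; last first.
  by apply/mnm_lepP => j; rewrite mnm1E; case: eqP => // <-; rewrite lt0n.
by move/eqP; rewrite mulrn_eq0 => /eqP.
Qed.

(** Induction on the degree. Restricting [p] to short segments parallel to the axes shows that its
    partial derivatives vanish on the same open simplex, so [p] is constant, and one interior point
    suffices. *)
Lemma ev_eq0_open n (p : mpoly n R) :
  (forall y : 'cV[R]_n, (forall i, 0 < y i 0) -> \sum_i y i 0 < 1 -> ev y p = 0) ->
  p = 0.
Proof.
move: {2}(msz p) (leqnn (msz p)) => N.
elim: N p => [|N IH] p pN hp; first by apply/eqP; rewrite -(mmeasure_poly_eq0 mdeg) -leqn0.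
have d0 j : mderiv j p = 0.
  apply: IH => [|y y0 y1]; first exact: msz_deriv.
  pose u : 'cV[R]_n := delta_mx j 0.
  have e0 : 0 < 1 - \sum_i y i 0 by rewrite subr_gt0.
  have : line y u p = 0.
    apply: (poly_eq0_itv e0) => t /andP[t0 t1]; rewrite line_horner; apply: hp.
      by move=> i; rewrite !mxE eqxx andbT ltr_wpDr // mulr_ge0 ?ler0n // ltW.
    under eq_bigr do rewrite !mxE eqxx andbT.
    rewrite big_split /= (bigD1 (F := fun i => t * _) j) //= eqxx mulr1.
    rewrite [X in _ + (_ + X)]big1 => [|i /negbTE ->]; last by rewrite mulr0.
    by rewrite addr0 -ltrBrDl.
  move/(congr1 (fun q : {poly R} => q^`().[0])); rewrite line_deriv deriv0 horner0.
  rewrite line_horner scale0r addr0 ev_dir_deriv (bigD1 j) //= big1 => [|i ij].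
    by rewrite mxE !eqxx mul1r addr0.
  by rewrite mxE (negbTE ij) mul0r.
rewrite (mderiv_eq0_const d0); have := hp (const_mx n.+1%:R^-1).
rewrite {1}(mderiv_eq0_const d0) evC => -> //.
- by move=> i; rewrite mxE invr_gt0 ltr0n.
- under eq_bigr do rewrite mxE.
  rewrite sumr_const card_ord -[_ *+ n]mulr_natl ltr_pdivrMr ?ltr0n // mul1r ltr_nat //.
Qed.

Lemma ev_inj n (p q : mpoly n R) : (forall y, ev y p = ev y q) -> p = q.
Proof.
move=> h; apply/eqP; rewrite -subr_eq0; apply/eqP/ev_eq0_open => y _ _.
by rewrite rmorphB /= h subrr.
Qed.

Definition aff n s (a : 'cV[R]_n) (M : 'M[R]_(n, s)) : mpoly n R -> mpoly s R :=
  mmap (@mpolyC s R) (fun i => mpolyC s (a i 0) + \sum_j M i j *: \X_j).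

HB.instance Definition _ n s (a : 'cV[R]_n) (M : 'M[R]_(n, s)) :=
  GRing.RMorphism.copy (aff a M)
   (mmap (@mpolyC s R) (fun i => mpolyC s (a i 0) + \sum_j M i j *: \X_j)).

Lemma ev_aff n s (a : 'cV[R]_n) (M : 'M[R]_(n, s)) y p :
  ev y (aff a M p) = ev (a + M *m y) p.
Proof.
elim/mpoly_alg_ind: p => [c|i|p q IHp IHq|p q IHp IHq].
- by rewrite /aff mmapC !evC.
- rewrite /aff mmapX mmap1U rmorphD rmorph_sum /= evC evX !mxE; congr (_ + _).
  by apply: eq_bigr => j _; rewrite evZ evX.
- by rewrite !rmorphD /= IHp IHq.
- by rewrite !rmorphM /= IHp IHq.
Qed.

Lemma affZ n s (a : 'cV[R]_n) (M : 'M[R]_(n, s)) c p :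
  aff a M (c *: p) = c *: aff a M p.
Proof. by rewrite /aff mmapZ mul_mpolyC. Qed.

Lemma affC n s (a : 'cV[R]_n) (M : 'M[R]_(n, s)) c :
  aff a M (mpolyC n c) = mpolyC s c.
Proof. exact: mmapC. Qed.

Lemma mderiv_aff n s (a : 'cV[R]_n) (M : 'M[R]_(n, s)) i p :
  mderiv i (aff a M p) = \sum_j M j i *: aff a M (mderiv j p).
Proof.
rewrite /aff (@deriv_mmap _ _ _ _ _ (@mderiv s R i)); first last.
- exact: mderivC.
- exact: mderivM.
- exact: mderivD.
apply: eq_bigr => j _; rewrite mderivD mderivC add0r [mderiv i _]raddf_sum (bigD1 i) //=.
rewrite mderivZ mderivXU eqxx big1 ?addr0 => [|k ki].
  by rewrite -scalerAr mulr1.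
by rewrite mderivZ mderivXU (negbTE ki) scaler0.
Qed.

Lemma msz_aff n s (a : 'cV[R]_n) (M : 'M[R]_(n, s)) p N :
  (msz p <= N -> msz (aff a M p) <= N)%N.
Proof.
move=> pN; rewrite [p]mpolyE rmorph_sum big_seq; apply: msz_sum => m mp /=.
rewrite affZ; apply: mszZ; apply: leq_trans pN.
apply: leq_trans (msize_mdeg_lt mp); rewrite /= mdegE.
rewrite /aff mmapX /mmap1.
suff h (r : seq 'I_n) (F : 'I_n -> nat) (G : 'I_n -> mpoly s R) : (forall i, msz (G i) <= 2)%N ->
    (msz (\prod_(i <- r) G i ^+ F i) <= (\sum_(i <- r) F i).+1)%N.
  apply: h => i; apply: mszD; first by apply: mszS; apply: mszC.
  by apply: msz_sum => j _; apply: mszZ; rewrite mszXU.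
move=> G2; elim: r => [|i r IH]; first by rewrite !big_nil mmeasure1.
rewrite !big_cons -addnS; apply: mszM => //.
elim: (F i) => [|k IHk]; first by rewrite expr0 mmeasure1.
by rewrite exprS -[k.+2]add1n; apply: mszM.
Qed.

End Substitution.

(** * The divergence theorem on the reference simplex *)

Section ReferenceSimplex.
Variables (R : realType) (s : nat).
Implicit Types (p q : mpoly s R) (m : multinom s).

Definition sint p : R := simplex_int 1 (fun y => ev y p).

Lemma sint_sum (I : Type) (r : seq I) (a : I -> R) (m : I -> multinom s) p :
  p = \sum_(k <- r) a k *: mpolyX R (m k) ->
  sint p = \sum_(k <- r) a k * dirichlet R (m k).
Proof.
move=> ->; rewrite /sint.
transitivity (simplex_int 1 (fun y : 'cV[R]_s =>
    \sum_(k <- r) a k * \prod_i y i 0 ^+ m k i)).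
  congr simplex_int; apply/funext => y; rewrite rmorph_sum.
  by apply: eq_bigr => k _; rewrite /= evZ /ev mevalX.
by rewrite simplex_int_sum ?ler01 //; apply: eq_bigr => k _; rewrite expr1n mulr1.
Qed.

Lemma sintE p : sint p = \sum_(m <- msupp p) mcoeff m p * dirichlet R m.
Proof. exact/sint_sum/mpolyE. Qed.

(** Since [sint_sum] accepts lists with repeated monomials, the expansions of [p] and [q] can simply
    be concatenated. *)
Lemma sint_is_linear : linear_for *%R sint.
Proof.
move=> c p q; pose F (r : mpoly s R) := [seq (mcoeff m r, m) | m <- msupp r].
have h r : r = \sum_(k <- F r) k.1 *: mpolyX R k.2 by rewrite big_map -mpolyE.
pose G := [seq (c * k.1, k.2) | k <- F p] ++ F q.
rewrite (@sint_sum _ G fst snd).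
  rewrite big_cat big_map /= (sint_sum (h p)) (sint_sum (h q)) mulr_sumr.
  by congr (_ + _); apply: eq_bigr => k _; rewrite -mulrA.
rewrite big_cat /= -h; congr (_ + _); rewrite {1}(h p) scaler_sumr !big_map.
by apply: eq_bigr => k _; rewrite /= scalerA.
Qed.

HB.instance Definition _ :=
  GRing.isLinear.Build R (mpoly s R) R *%R sint sint_is_linear.

Lemma sintB p q : sint (p - q) = sint p - sint q.
Proof. exact: raddfB. Qed.

Lemma sintN p : sint (- p) = - sint p.
Proof. exact: raddfN. Qed.

Lemma sintD p q : sint (p + q) = sint p + sint q.
Proof. exact: raddfD. Qed.

Lemma sint_bigsum (I : Type) (r : seq I) (P : pred I) (F : I -> mpoly s R) :
  sint (\sum_(i <- r | P i) F i) = \sum_(i <- r | P i) sint (F i).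
Proof. exact: raddf_sum. Qed.

Lemma mderiv_sum i (I : Type) (r : seq I) (P : pred I) (F : I -> mpoly s R) :
  mderiv i (\sum_(k <- r | P k) F k) = \sum_(k <- r | P k) mderiv i (F k).
Proof. exact: raddf_sum. Qed.

Lemma sint_ge0_eq0 p :
  (forall y : 'cV[R]_s, (forall i, 0 <= y i 0) -> \sum_i y i 0 <= 1 -> 0 <= ev y p) ->
  sint p = 0 -> p = 0.
Proof.
have evE y : ev y p = \sum_(m <- msupp p) mcoeff m p * \prod_i y i 0 ^+ m i by exact: mevalE.
move=> p0 Ip; apply: ev_eq0_open => y y0 y1; rewrite evE.
apply: (@simplex_int_sum_eq0 _ _ 1) => //; last by move=> i; apply: ltW.
Qed.

Lemma sintX m : sint (mpolyX R m) = dirichlet R m.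
Proof. by rewrite sintE msuppX big_seq1 mcoeffX eqxx mul1r. Qed.

Lemma dirichletU m i : dirichlet R (mnm_add m (mnm1 i)) =
  (m i).+1%:R / (mdeg m + s).+1%:R * dirichlet R m.
Proof.
rewrite /dirichlet -!mdegE mdegD mdeg1 addn1 addSn.
rewrite (bigD1 i) //= [X in _ = _ * (X / _)](bigD1 i) //= mnmDE mnm1E eqxx addn1.
rewrite (eq_bigr (fun j => (m j)`!%:R)) => [|j ji].
  rewrite (factS (m i)) (factS (mdeg m + s)) (natrM _ (m i).+1) (natrM _ (mdeg m + s).+1).
  by rewrite invfM; ring.
by rewrite mnmDE mnm1E eq_sym (negbTE ji) addn0.
Qed.

Lemma sint_derivU m i : sint (mderiv i (mpolyX R (mnm_add m (mnm1 i)))) =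
  (m i).+1%:R * dirichlet R m.
Proof.
rewrite mderivX linearZ /= sintX mnmDE mnm1E eqxx addn1; congr (_ * dirichlet _ _).
by rewrite addmK.
Qed.

Lemma sint_linear_eq0 (f : mpoly s R -> mpoly s R) : linear f ->
  (forall m, sint (f (mpolyX R m)) = 0) -> forall p, sint (f p) = 0.
Proof.
move=> fl h p; elim/mpolyind: p => [|c m p _ _ IH].
  have := fl (-1) 0 0; rewrite scaler0 addr0 scaleN1r addNr => ->.
  by rewrite raddf0.
by rewrite fl sint_is_linear h IH mulr0 addr0.
Qed.

Definition bary0 : mpoly s R := 1 - \sum_j \X_j.

Lemma sint_deriv_bary0 i p : sint (mderiv i (\X_i * bary0 * p)) = 0.
Proof.
apply: (sint_linear_eq0 (f := fun p => mderiv i (\X_i * bary0 * p))) => [c q r|m].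
  by rewrite mulrDr -scalerAr linearP.
have -> : \X_i * bary0 * mpolyX R m = mpolyX R (mnm_add m (mnm1 i)) -
    \sum_j mpolyX R (mnm_add (mnm_add m (mnm1 j)) (mnm1 i)).
  rewrite /bary0 mulrBr mulr1 mulrBl mpolyXD mulrC; congr (_ - _).
  rewrite mulr_sumr mulr_suml; apply: eq_bigr => j _.
  by rewrite !mpolyXD; ring.
rewrite mderivB sintB sint_derivU mderiv_sum sint_bigsum.
under eq_bigr => j _ do rewrite sint_derivU dirichletU mulrA.
rewrite -mulr_suml -mulrBl (_ : _ - _ = 0) ?mul0r //.
under eq_bigr => j _ do rewrite mulrA.
rewrite -mulr_suml; apply/eqP; rewrite subr_eq0 eq_sym; apply/eqP.
apply: (canLR (mulfK _)); first by rewrite pnatr_eq0.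
under eq_bigr => j _ do rewrite -natrM mnmDE mnm1E.
(* What remains, after [dirichletU] and division by the common integral, is the sum over j of (m_j +
   1)(m_i + 1 + [i = j]) being equal to (m_i + 1)(|m| + s + 1). *)
rewrite -natr_sum -natrM; congr (_%:R).
rewrite (bigD1 i) //= eqxx (eq_bigr (fun j => (m i).+1 * (m j).+1)%N) => [|j ji].
  have -> : (mdeg m + s = \sum_j (m j).+1)%N.
    under eq_bigr do rewrite -addn1.
    by rewrite big_split /= sum_nat_const card_ord muln1 mdegE.
  rewrite -big_distrr [in RHS](bigD1 i) //=; nia.
by rewrite (negbTE ji) addn0.
Qed.

(** The field x_a x_b p (e_a - e_b) is tangent to, or zero on, every facet of the reference simplex,
    so its divergence has integral zero. On monomials both sides are the same expression, symmetric
    in a and b. *)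
Lemma sint_deriv_comm a b p :
  sint (mderiv a (\X_a * \X_b * p)) = sint (mderiv b (\X_a * \X_b * p)).
Proof.
have [->//|ab] := eqVneq a b.
apply/eqP; rewrite -subr_eq0 -raddfB /=; apply/eqP.
apply: (sint_linear_eq0 (f := fun p => mderiv a (\X_a * \X_b * p) -
    mderiv b (\X_a * \X_b * p))) => [c q r|m].
  by rewrite mulrDr -scalerAr !mderivD !mderivZ scalerBr opprD addrACA.
rewrite sintB.
have -> : \X_a * \X_b * mpolyX R m = mpolyX R (mnm_add (mnm_add m (mnm1 b)) (mnm1 a)).
  by rewrite !mpolyXD; ring.
rewrite sint_derivU dirichletU.
rewrite -addmA [mnm_add (mnm1 b) _]addmC addmA sint_derivU dirichletU.
rewrite !mnmDE !mnm1E (negbTE ab) eq_sym (negbTE ab) !addn0.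
by rewrite !mulrA [_%:R * _%:R]mulrC subrr.
Qed.

(* The hypothesis says that the field with barycentric components [\X_a * q a] and
   [bary0 * q0] is tangent to the simplex, i.e. its components sum to zero; it is
   then a combination of the fields [\X_a \X_b (e_a - e_b) r] and [\X_a bary0 e_a r],
   for which the claim is checked on monomials. *)
Lemma sint_divergence (q : 'I_s -> mpoly s R) q0 :
  \sum_a \X_a * q a + bary0 * q0 = 0 ->
  sint (\sum_a mderiv a (\X_a * q a)) = 0.
Proof.
move=> q_0.
have qE a : \X_a * q a =
    \sum_b \X_a * \X_b * (q a - q b) + \X_a * bary0 * (q a - q0).
  transitivity (\X_a * q a * (\sum_b \X_b + bary0)
    - \X_a * (\sum_a \X_a * q a + bary0 * q0)).
    by rewrite q_0 /bary0 (addrC (\sum_i _)) subrK mulr1 mulr0 subr0.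
  rewrite (mulrDr _ _ bary0) (mulrDr _ _ (bary0 * q0)) !mulr_sumr opprD addrACA -sumrB.
  by congr (_ + _); [apply: eq_bigr => b _|]; ring.
under eq_bigr => a _ do rewrite qE.
rewrite sint_bigsum.
under eq_bigr => a _.
  rewrite mderivD sintD sint_deriv_bary0 addr0 mderiv_sum sint_bigsum; over.
set T := LHS.
have : T = - T.
  rewrite {1}/T exchange_big /= /T -sumrN; apply: eq_bigr => a _.
  rewrite -sumrN; apply: eq_bigr => b _.
  rewrite sint_deriv_comm -sintN -mderivN.
  by congr (sint (mderiv _ _)); ring.
by move/eqP; rewrite -addr_eq0 -mulr2n mulrn_eq0 => /eqP.
Qed.

End ReferenceSimplex.

(** * Barycentric coordinates and faces *)

Section Dot.
Variables (R : realType) (d : nat).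
Implicit Types u w : 'cV[R]_d.

Lemma dotE u w : dot u w = \sum_a u a 0 * w a 0.
Proof. by rewrite /dot mxE; apply: eq_bigr => a _; rewrite mxE. Qed.

Lemma dotC u w : dot u w = dot w u.
Proof. by rewrite !dotE; apply: eq_bigr => a _; rewrite mulrC. Qed.

Lemma dotDr u w w' : dot u (w + w') = dot u w + dot u w'.
Proof. by rewrite /dot mulmxDr mxE. Qed.

Lemma dotBr u w w' : dot u (w - w') = dot u w - dot u w'.
Proof. by rewrite /dot mulmxBr !mxE. Qed.

Lemma dotZr u c w : dot u (c *: w) = c * dot u w.
Proof. by rewrite /dot -scalemxAr mxE. Qed.

Lemma dot0r u : dot u 0 = 0.
Proof. by rewrite /dot mulmx0 mxE. Qed.

Lemma dot_sumr u (I : Type) (r : seq I) (P : pred I) (f : I -> 'cV[R]_d) :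
  dot u (\sum_(i <- r | P i) f i) = \sum_(i <- r | P i) dot u (f i).
Proof. by rewrite /dot mulmx_sumr summxE. Qed.

Lemma dotZl c u w : dot (c *: u) w = c * dot u w.
Proof. by rewrite dotC dotZr (dotC w). Qed.

Lemma dot_suml w (I : Type) (r : seq I) (P : pred I) (f : I -> 'cV[R]_d) :
  dot (\sum_(i <- r | P i) f i) w = \sum_(i <- r | P i) dot (f i) w.
Proof. by rewrite dotC dot_sumr; apply: eq_bigr => i _; rewrite dotC. Qed.
End Dot.

(* [g i] is the gradient of the [i]-th barycentric coordinate. *)
Record bary_gradients (R : realType) d (v g : 'I_d.+1 -> 'cV[R]_d) : Prop := {
  bary_gradients_sum : \sum_i g i = 0;
  bary_gradients_edge : forall i j k,
    dot (g i) (v j - v k) = (i == j)%:R - (i == k)%:R;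
  bary_gradients_expand : forall w, \sum_i dot (g i) w *: v i = w }.

(** The columns of the inverse edge matrix are the dual basis of the edges at v_0, i.e. the
    gradients with index other than 0; the remaining one is forced by the sum being zero. *)
Lemma bary_gradients_exist (R : realType) d (v : 'I_d.+1 -> 'cV[R]_d) :
  nondegenerate_simplex v -> exists g, bary_gradients v g.
Proof.
rewrite /nondegenerate_simplex; set A := \matrix_(i < d) _.
rewrite row_free_unit => uA.
pose h (i : 'I_d) : 'cV[R]_d := col i (invmx A).
pose g i := if unlift ord0 i is Some j then h j else - \sum_j h j.
have g0 : g ord0 = - \sum_j h j by rewrite /g unlift_none.
have gS i : g (lift ord0 i) = h i by rewrite /g liftK.
have hv i j : dot (h i) (v (lift ord0 j) - v ord0) = (i == j)%:R.
  have := congr1 (fun B : 'M[R]_d => B j i) (mulmxV uA); rewrite !mxE eq_sym => <-.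
  by rewrite dotE; apply: eq_bigr => a _; rewrite !mxE mulrC.
have gv i j : dot (g i) (v j - v ord0) = (i == j)%:R - (i == ord0)%:R.
  case: (unliftP ord0 j) => [k ->|->]; last by rewrite !subrr dot0r.
  case: (unliftP ord0 i) => [l ->|->].
    by rewrite gS hv (inj_eq lift_inj) (_ : (_ == ord0) = false) ?subr0 // eq_sym (negbTE (neq_lift _ _)).
  rewrite g0 -scaleN1r dotZl dot_suml (bigD1 k) //= hv eqxx big1 => [|l lk].
    by rewrite addr0 sub0r mulN1r.
  by rewrite hv (negbTE lk).
have sg : \sum_i g i = 0.
  by rewrite big_ord_recl g0 (eq_bigr _ (fun i _ => gS i)) addNr.
exists g; split => // [i j k|w].
  by rewrite -(subrKA (v ord0)) -[v ord0 - v k]opprB dotBr !gv; ring.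
rewrite big_ord_recl g0; under [X in _ + X]eq_bigr do rewrite gS.
rewrite -scaleN1r dotZl dot_suml mulN1r scaleNr scaler_suml addrC -sumrB.
under eq_bigr do rewrite -scalerBr.
apply: trmx_inj; rewrite -[RHS]mulmx1 -(mulVmx uA) mulmxA.
apply/rowP => a; rewrite [RHS]mxE mxE summxE; apply: eq_bigr => i _.
by rewrite !mxE dotC /dot; congr (_ * _); rewrite !mxE; apply: eq_bigr => b _; rewrite !mxE.
Qed.

Section Faces.
Variables (R : realType) (d : nat) (v g : 'I_d.+1 -> 'cV[R]_d).
Hypothesis hg : bary_gradients v g.
Implicit Types (i k : 'I_d.+1) (F G : {set 'I_d.+1}) (p q : mpoly d R).

Definition lam i : mpoly d R :=
  mpolyC d (1 - dot (g i) (v i)) + \sum_a g i a 0 *: \X_a.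

Lemma ev_lam i j x : ev x (lam i) = dot (g i) (x - v j) + (i == j)%:R.
Proof.
rewrite evD ev_sum evC; under eq_bigr do rewrite evZ evX.
rewrite -dotE dotBr -addrA [- _ + _]addrC.
have := bary_gradients_edge hg i i j; rewrite eqxx dotBr => h.
by move: h; rewrite /= mulr1n; lra.
Qed.

Lemma ev_lam_vertex i j : ev (v j) (lam i) = (i == j)%:R.
Proof. by rewrite (ev_lam _ j) subrr dot0r add0r. Qed.

Lemma sum_ev_lam x : \sum_i ev x (lam i) = 1.
Proof.
under eq_bigr do rewrite (ev_lam _ ord0).
rewrite big_split /= -dot_suml (bary_gradients_sum hg) dotC dot0r add0r.
by rewrite (bigD1 ord0) //= big1 ?addr0 // => i /negbTE ->.
Qed.

Lemma lam_expand x : \sum_i ev x (lam i) *: v i = x.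
Proof.
under eq_bigr do rewrite (ev_lam _ ord0) scalerDl.
rewrite big_split /= (bary_gradients_expand hg) (bigD1 ord0) //= scale1r.
by rewrite big1 ?addr0 ?subrK // => i /negbTE ->; rewrite scale0r.
Qed.

Lemma msz_lam i : (msz (lam i) <= 2)%N.
Proof.
apply: mszD; first exact/mszS/mszC.
by apply: msz_sum => a _; apply: mszZ; rewrite mszXU.
Qed.

(** The affine hull of the face, not the face itself: no inequalities are carried along, and a
    polynomial vanishes on one exactly when it vanishes on the other. *)
Definition onface F x := forall i, i \notin F -> ev x (lam i) = 0.
Definition vanish F p := forall x, onface F x -> ev x p = 0.

Lemma onface_vertex F i : i \in F -> onface F (v i).
Proof. by move=> iF j; rewrite ev_lam_vertex; case: eqP => // ->; rewrite iF. Qed.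

Lemma onfaceS F G x : F \subset G -> onface F x -> onface G x.
Proof. by move=> /fintype.subsetP FG xF i iG; apply: xF; apply: contra iG; apply: FG. Qed.

Definition idx F (j : nat) : 'I_d.+1 := nth ord0 (enum F) j.
(* Pull-back along the parametrization of [F] used by [face_int]. *)
Definition pb F : mpoly d R -> mpoly #|F|.-1 R := aff (face_vertex v F 0) (face_edges v F).
HB.instance Definition _ F :=
  GRing.RMorphism.copy (pb F) (aff (face_vertex v F 0) (face_edges v F)).

Lemma idx_in F (j : nat) : (j < #|F|)%N -> idx F j \in F.
Proof. by move=> jF; rewrite -(mem_enum F) mem_nth -?cardE. Qed.

Lemma idx_inj F (j l : nat) : (j < #|F|)%N -> (l < #|F|)%N -> (idx F j == idx F l) = (j == l).
Proof. by move=> jF lF; rewrite nth_uniq -?cardE ?enum_uniq. Qed.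

Lemma idxP F i : i \in F -> exists2 j : nat, (j < #|F|)%N & i = idx F j.
Proof.
rewrite -(mem_enum F) => iF; exists (index i (enum F)); last by rewrite /idx nth_index.
by rewrite cardE index_mem.
Qed.

Lemma big_face (V : nmodType) F (f : 'I_d.+1 -> V) : (0 < #|F|)%N ->
  \sum_(i in F) f i = f (idx F 0) + \sum_(j < #|F|.-1) f (idx F j.+1).
Proof.
move=> F0; rewrite -big_enum (big_nth ord0) -cardE -{1}(prednK F0) big_nat_recl //.
by rewrite big_mkord.
Qed.

Lemma face_point F (y : 'cV[R]_(#|F|.-1)) :
  face_vertex v F 0 + face_edges v F *m y =
  v (idx F 0) + \sum_j y j 0 *: (v (idx F j.+1) - v (idx F 0)).
Proof.
congr (_ + _); apply/colP => a; rewrite mxE summxE; apply: eq_bigr => j _.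
by rewrite !mxE mulrC.
Qed.

Lemma ev_pb F y p : ev y (pb F p) = ev (face_vertex v F 0 + face_edges v F *m y) p.
Proof. exact: ev_aff. Qed.

Lemma ev_lam_face F y i :
  ev (face_vertex v F 0 + face_edges v F *m y) (lam i) =
  (i == idx F 0)%:R + \sum_j y j 0 * ((i == idx F j.+1)%:R - (i == idx F 0)%:R).
Proof.
rewrite face_point (ev_lam _ (idx F 0)) addrAC subrr add0r dot_sumr addrC.
congr (_ + _); apply: eq_bigr => j _.
by rewrite dotZr (bary_gradients_edge hg).
Qed.

Section NonemptyFace.
Variable F : {set 'I_d.+1}.
Hypothesis F0 : (0 < #|F|)%N.

Let ltF (j : 'I_(#|F|.-1)) : (j.+1 < #|F|)%N.
Proof. by rewrite -ltn_predRL. Qed.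

Lemma pb_lam0 : pb F (lam (idx F 0)) = bary0 R #|F|.-1.
Proof.
apply: ev_inj => y; rewrite ev_pb ev_lam_face eqxx evB ev_sum ev1.
congr (_ + _); rewrite -sumrN; apply: eq_bigr => j _.
by rewrite evX idx_inj ?(ltF j) // sub0r mulrN1.
Qed.

Lemma pb_lamS (j : 'I_(#|F|.-1)) : pb F (lam (idx F j.+1)) = \X_j.
Proof.
apply: ev_inj => y; rewrite ev_pb ev_lam_face evX idx_inj ?(ltF j) // add0r.
rewrite (bigD1 j) //= eqxx subr0 mulr1 big1 ?addr0 // => k kj.
by rewrite idx_inj ?ltF // subr0 eqSS val_eqE eq_sym (negbTE kj) mulr0.
Qed.

Lemma pb_lamN i : i \notin F -> pb F (lam i) = 0.
Proof.
move=> iF; apply: ev_inj => y; rewrite ev_pb ev_lam_face ev0.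
have h (j : nat) : (j < #|F|)%N -> (i == idx F j) = false.
  by move=> jF; apply: contraNF iF => /eqP ->; apply: idx_in.
by rewrite h // add0r big1 // => j _; rewrite !h ?ltF // subr0 mulr0.
Qed.

(** The parametrization reaches the whole affine hull, the barycentric coordinates giving back the
    parameters. Vanishing on a face becomes an equation in a polynomial ring, which is an integral
    domain; [vanishM] exploits this. *)
Lemma vanishE p : vanish F p <-> pb F p = 0.
Proof.
split=> [hp|hp x xF].
  apply: ev_inj => y; rewrite ev0 ev_pb; apply: hp => i iF.
  by rewrite -ev_pb pb_lamN // ev0.
pose y : 'cV[R]_(#|F|.-1) := \col_j ev x (lam (idx F j.+1)).
suff -> : x = face_vertex v F 0 + face_edges v F *m y by rewrite -ev_pb hp ev0.
rewrite face_point -[LHS]lam_expand (bigID (mem F)) /= [X in _ + X]big1 ?addr0; last first.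
  by move=> i /xF ->; rewrite scale0r.
rewrite big_face //; have := sum_ev_lam x; rewrite (bigID (mem F)) /= [X in _ + X]big1 ?addr0 //.
rewrite big_face // => /(canRL (addrK _)) ->.
rewrite scalerBl scale1r -addrA; congr (_ + _).
rewrite scaler_suml addrC -sumrB; apply: eq_bigr => j _.
by rewrite mxE scalerBr.
Qed.

Lemma vanish0P : ~ vanish F 1.
Proof. by move/vanishE/eqP; rewrite rmorph1 oner_eq0. Qed.

Lemma vanishM p q : vanish F (p * q) -> vanish F p \/ vanish F q.
Proof.
move/vanishE/eqP; rewrite rmorphM /= mulf_eq0.
by case/orP => /eqP/vanishE; [left|right].
Qed.

(** The condition on [u] places it in the span of the edges of [F], and differentiating along an
    edge is a partial derivative of the pull-back. *)
Lemma vanish_deriv u p : (forall i, i \notin F -> dot (g i) u = 0) ->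
  vanish F p -> vanish F (dir_deriv u p).
Proof.
move=> uF /vanishE hp; apply/vanishE.
have uE : u = \sum_(j < #|F|.-1) dot (g (idx F j.+1)) u *: (v (idx F j.+1) - v (idx F 0)).
  rewrite -{1}(bary_gradients_expand hg u) (bigID (mem F)) /= [X in _ + X]big1 ?addr0; last first.
    by move=> i /uF ->; rewrite scale0r.
  rewrite big_face //.
  have := bary_gradients_sum hg => /(congr1 (fun w => dot w u)).
  rewrite dot_suml dotC dot0r (bigID (mem F)) /= [X in _ + X]big1 ?addr0 //.
  rewrite big_face // => /eqP; rewrite addr_eq0 => /eqP ->.
  rewrite scaleNr scaler_suml addrC -sumrB; apply: eq_bigr => j _.
  by rewrite scalerBr.
rewrite /dir_deriv rmorph_sum.
transitivity (\sum_(j < #|F|.-1) dot (g (idx F j.+1)) u *: mderiv j (pb F p)).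
  under [RHS]eq_bigr do rewrite /pb mderiv_aff scaler_sumr.
  rewrite exchange_big; apply: eq_bigr => a _ /=.
  rewrite /pb affZ [in LHS]uE summxE scaler_suml; apply: eq_bigr => j _.
  by rewrite !mxE scalerA.
by rewrite hp big1 // => j _; rewrite mderiv0 scaler0.
Qed.

(* The integral over [F] up to the Jacobian, which is positive by [gram_det_gt0]. *)
Definition fint p : R := sint (pb F p).

Lemma fint_vanish p : vanish F p -> fint p = 0.
Proof. by move=> /vanishE h; rewrite /fint h raddf0. Qed.

Lemma fintB p q : fint (p - q) = fint p - fint q.
Proof. by rewrite /fint rmorphB sintB. Qed.

Lemma eq_fint p q : (forall x, onface F x -> ev x p = ev x q) -> fint p = fint q.
Proof.
move=> h; apply/eqP; rewrite -subr_eq0 -fintB fint_vanish // => x xF.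
by rewrite evB h // subrr.
Qed.

(** Divergence theorem on [F] for the field with components lambda_i q_i along the v_i: the
    hypothesis makes it tangential, and the factors lambda_i remove the flux through the boundary.
    The base vertex is the one used by the parametrization. *)
Lemma fint_divergence (q : 'I_d.+1 -> mpoly d R) :
  vanish F (\sum_(i in F) lam i * q i) ->
  fint (\sum_(i in F) dir_deriv (v i - v (idx F 0)) (lam i * q i)) = 0.
Proof.
move=> /vanishE h; rewrite /fint.
rewrite -[RHS](@sint_divergence _ _ (fun j => pb F (q (idx F j.+1))) (pb F (q (idx F 0)))).
  congr sint; rewrite big_face // subrr.
  have -> r : dir_deriv (0 : 'cV[R]_d) r = 0.
    by rewrite /dir_deriv big1 // => a _; rewrite mxE scale0r.
  rewrite add0r rmorph_sum; apply: eq_bigr => j _ /=.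
  rewrite -pb_lamS -rmorphM /= /pb mderiv_aff /dir_deriv rmorph_sum.
  by apply: eq_bigr => a _; rewrite /= affZ !mxE.
rewrite -[RHS]h big_face // rmorphD rmorph_sum rmorphM /= pb_lam0 addrC; congr (_ + _).
by apply: eq_bigr => j _; rewrite rmorphM /= pb_lamS.
Qed.

(** The common end of all testing arguments: with the cofactor as test function, the integrand is a
    square times distinct barycentric coordinates, which are nonnegative on the simplex. [S] is
    empty, one index, two indices or all of [F], according to the family of degrees of freedom. *)
Lemma fint_prod_sqr_eq0 (S : {set 'I_d.+1}) p : S \subset F ->
  fint ((\prod_(i in S) lam i) * p ^+ 2) = 0 -> vanish F p.
Proof.
move=> /fintype.subsetP SF I0.
have lam_ge0 i (y : 'cV[R]_(#|F|.-1)) : i \in F -> (forall j, 0 <= y j 0) -> \sum_j y j 0 <= 1 ->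
    0 <= ev y (pb F (lam i)).
  case/idxP => -[|j] jF -> y0 y1.
    rewrite pb_lam0 evB ev1 ev_sum.
    by under eq_bigr do rewrite evX; rewrite subr_ge0.
  have jF' : (j < #|F|.-1)%N by rewrite ltn_predRL.
  by rewrite (pb_lamS (Ordinal jF')) evX.
have : pb F ((\prod_(i in S) lam i) * p ^+ 2) = 0.
  apply: sint_ge0_eq0 I0 => y y0 y1.
  rewrite rmorphM rmorph_prod rmorphXn /= evM ev_prod expr2 evM -expr2.
  by rewrite mulr_ge0 ?sqr_ge0 // prodr_ge0 // => i /SF iF; apply: lam_ge0.
move/eqP; rewrite rmorphM rmorph_prod rmorphXn mulf_eq0 expf_eq0 /=.
case/orP => [/prodf_eq0[i /SF iF /eqP/vanishE]|/eqP/vanishE//].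
by move/(_ _ (onface_vertex iF))/eqP; rewrite ev_lam_vertex eqxx oner_eq0.
Qed.

End NonemptyFace.

End Faces.

(** * Division by barycentric coordinates *)

Section Division.
Variables (R : realType) (d : nat).

(** Here [h] is the substitution x |-> x - l(x) u, which is the identity modulo [l]. Hence [l]
    divides p - h p, and following the quotient through monomials shows that it loses one degree. *)
Lemma shear_divide (l : mpoly d R) (u : 'cV[R]_d)
    (h : {rmorphism mpoly d R -> mpoly d R}) :
  (forall c, h (mpolyC d c) = mpolyC d c) ->
  (forall a, h (\X_a) = \X_a - u a 0 *: l) ->
  (forall p N, msz p <= N -> msz (h p) <= N)%N ->
  forall p N, (msz p <= N)%N ->
    exists2 q, (msz q <= N.-1)%N & p - h p = l * q.
Proof.
move=> hC hX hN.
have mono N (m : multinom d) : (mdeg m <= N)%N ->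
    exists2 q, (msz q <= N)%N & mpolyX R m - h (mpolyX R m) = l * q.
  elim: N m => [|N IH] m mN.
    move: mN; rewrite leqn0 mdeg_eq0 => /eqP ->.
    exists 0; first by rewrite mmeasure0.
    by rewrite mpolyX0 rmorph1 subrr mulr0.
  have [m0|m0] := eqVneq m mnm0.
    exists 0; first by rewrite mmeasure0.
    by rewrite m0 mpolyX0 rmorph1 subrr mulr0.
  have [a ma] : exists a, m a != 0%N.
    apply/existsP; apply: contraNT m0 => /existsPn h0.
    by apply/eqP/mnmP => i; rewrite mnm0E; have /negPn/eqP := h0 i.
  pose m' := mnm_sub m (mnm1 a).
  have mE : m = mnm_add m' (mnm1 a).
    by rewrite submK //; apply/mnm_lepP => j; rewrite mnm1E; case: eqP => // <-; rewrite lt0n.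
  have m'N : (mdeg m' <= N)%N by move: mN; rewrite mE mdegD mdeg1 addn1.
  have [q qN qE] := IH m' m'N.
  (* From X_a m' - h(X_a) h(m') = X_a (m' - h(m')) + u_a l h(m'). *)
  exists (\X_a * q + u a 0 *: h (mpolyX R m')).
    apply: mszD; first by rewrite -add1n; apply: mszM; rewrite ?mszXU.
    by apply/mszZ/hN; rewrite msizeX.
  rewrite (mulrDr l) mulrCA -qE mE mpolyXD rmorphM /= hX -!mul_mpolyC.
  by ring.
move=> p N pN; rewrite [p]mpolyE.
have : forall m, m \in msupp p -> (mdeg m <= N.-1)%N.
  by move=> m /msize_mdeg_lt/leq_trans/(_ pN); case: (N).
elim: (msupp p) => [_|m r IH hr].
  exists 0; first by rewrite mmeasure0.
  by rewrite big_nil rmorph0 subrr mulr0.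
have [q qN qE] := IH (fun m' mr => hr m' (mem_behead (s := m :: r) mr)).
have [q' q'N q'E] := mono _ m (hr m (mem_head m r)).
exists (mcoeff m p *: q' + q); first by apply: mszD => //; apply: mszZ.
rewrite big_cons rmorphD mulrDr -qE opprD addrACA; congr (_ + _).
by rewrite -!mul_mpolyC rmorphM /= hC -mulrBr q'E; ring.
Qed.
End Division.

Section FaceDivision.
Variables (R : realType) (d : nat) (v g : 'I_d.+1 -> 'cV[R]_d).
Hypothesis hg : bary_gradients v g.
Implicit Types (i k : 'I_d.+1) (F : {set 'I_d.+1}) (p q : mpoly d R).
Local Notation lam := (lam v g).
Local Notation vanish := (vanish v g).

(* With [u = v i - v j], the projection x |-> x - lam_i(x) u maps the affine hull of
   [F] onto that of [F :\ i], where [p] vanishes. *)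
Lemma vanish_divide F i p N : i \in F -> (1 < #|F|)%N ->
  vanish (F :\ i)%SET p -> (msz p <= N)%N ->
  exists2 q, (msz q <= N.-1)%N & vanish F (p - lam i * q).
Proof.
move=> iF F1 hp pN.
have [j] : exists j, j \in (F :\ i)%SET.
  by apply/card_gt0P; move: F1; rewrite (cardsD1 i F) iF add1n ltnS.
rewrite !inE => /andP[ji jF].
pose u := v i - v j.
pose c := 1 - dot (g i) (v i).
have lamE x : ev x (lam i) = c + dot (g i) x.
  by rewrite evD ev_sum evC [dot (g i) x]dotE; congr (_ + _); apply: eq_bigr => a _; rewrite evZ evX.
pose h := aff (- (c *: u)) (1%:M - u *m (g i)^T).
have hE x q : ev x (h q) = ev (x - ev x (lam i) *: u) q.
  rewrite /h ev_aff; congr (ev _ q).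
  rewrite mulmxBl mul1mx -mulmxA (_ : (g i)^T *m x = (dot (g i) x)%:M); last first.
    by rewrite [LHS]mx11_scalar.
  by rewrite mul_mx_scalar lamE (scalerDl u c) opprD addrCA.
have [q qN qE] : exists2 q, (msz q <= N.-1)%N & p - h p = lam i * q.
  apply: (@shear_divide _ _ (lam i) u h) => //.
  - by move=> c'; rewrite /= /h affC.
  - by move=> a; apply: ev_inj => x; rewrite /= hE evB !evX evZ !mxE mulrC.
  - by move=> p' N' /=; apply: msz_aff.
exists q => // x xF; rewrite -qE opprB addrC subrK hE; apply: hp => k.
rewrite !inE negb_and negbK => kF.
rewrite (ev_lam hg _ i) addrAC dotBr dotZr addrAC.
have -> : dot (g k) u = (k == i)%:R - (k == j)%:R by rewrite (bary_gradients_edge hg).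
rewrite -(ev_lam hg k i); case/orP: kF => [/eqP ->|kF].
  by rewrite eqxx eq_sym (negbTE ji) subr0 mulr1 subrr.
rewrite (xF k kF).
have -> : (k == i) = false by apply: contraNF kF => /eqP ->.
have -> : (k == j) = false by apply: contraNF kF => /eqP ->.
by rewrite subrr mulr0 subrr.
Qed.

(** Divide by one coordinate at a time. On [F :\ i] the product of the other coordinates is not
    zero, so the quotient reached so far must itself vanish there and can be divided by lambda_i;
    every division costs one degree. *)
Lemma vanish_divide_prod F (S : {set 'I_d.+1}) p N : S \subset F -> (1 < #|F|)%N ->
  (forall i, i \in S -> vanish (F :\ i)%SET p) -> (msz p <= N)%N ->
  exists2 q, (msz q <= N - #|S|)%N & vanish F (p - (\prod_(i in S) lam i) * q).
Proof.
move=> /fintype.subsetP SF F1 hp pN.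
have [n Sn] := ubnP #|S|; elim: n S Sn SF hp => // n IH S Sn SF hp.
have [->|/set0Pn[i iS]] := eqVneq S finset.set0.
  exists p; first by rewrite cards0 subn0.
  by rewrite big_set0 mul1r subrr => x _; rewrite ev0.
have [q qN hq] : exists2 q, (msz q <= N - #|(S :\ i)%SET|)%N &
    vanish F (p - (\prod_(k in (S :\ i)%SET) lam k) * q).
  apply: IH => [||k].
  - by move: Sn; rewrite (cardsD1 i) iS add1n.
  - by move=> k; rewrite !inE => /andP[_ /SF].
  - by rewrite !inE => /andP[_ /hp].
have iF := SF i iS.
have Fi0 : (0 < #|(F :\ i)%SET|)%N by move: F1; rewrite (cardsD1 i F) iF add1n.
have hq' : vanish (F :\ i)%SET q.
  have : vanish (F :\ i)%SET ((\prod_(k in (S :\ i)%SET) lam k) * q).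
    move=> x xFi; have xF : onface v g F x by apply: onfaceS xFi; exact: subsetDl.
    have := hq x xF; rewrite evB (hp i iS x xFi) sub0r => /eqP.
    by rewrite oppr_eq0 => /eqP.
  (* If the product vanished on [F :\ i], one factor lambda_k would, although it equals 1 at the
     vertex v_k of that face. *)
  case/(vanishM hg Fi0) => // h; exfalso.
  have : forall k, k \in (S :\ i)%SET -> k \in (F :\ i)%SET.
    by move=> k; rewrite !inE => /andP[-> /SF].
  have [m Sm] : exists m, (#|(S :\ i)%SET| <= m)%N by exists #|(S :\ i)%SET|.
  move: (S :\ i)%SET h Sm; elim: m => [|m IHm] T hT Tm TF.
    move: Tm; rewrite leqn0 cards_eq0 => /eqP T0; move: hT; rewrite T0 big_set0.
    exact: (vanish0P hg Fi0).
  have [T0|/set0Pn[k kT]] := eqVneq T finset.set0.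
    by move: hT; rewrite T0 big_set0; exact: (vanish0P hg Fi0).
  move: hT; rewrite (big_setD1 k) //= => /(vanishM hg Fi0)[hk|hT].
    have := hk (v k) (onface_vertex hg (TF k kT)).
    by rewrite (ev_lam_vertex hg) eqxx => /eqP; rewrite oner_eq0.
  apply: (IHm _ hT) => [|l]; first by move: Tm; rewrite (cardsD1 k) kT add1n ltnS.
  by rewrite !inE => /andP[_ /TF]; rewrite !inE.
have [r rN hr] := vanish_divide iF F1 hq' qN.
exists r; first by move: rN; rewrite -subnS (cardsD1 i S) iS add1n.
move=> x xF; have := hq x xF; have := hr x xF.
rewrite !evB (big_setD1 i iS) !evM => /eqP; rewrite subr_eq0 => /eqP -> /eqP.
by rewrite subr_eq0 => /eqP ->; ring.
Qed.
End FaceDivision.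

(** * Face integrals and face frames *)

(** The characteristic polynomial of -E^T E is monic, and has no root x >= 0 because E^T E is
    positive definite. By the intermediate value theorem its value at 0, the Gram determinant, is
    positive. *)
Lemma gram_det_gt0 (R : realType) n s (E : 'M[R]_(n, s)) :
  (forall y : 'cV_s, E *m y = 0 -> y = 0) -> 0 < \det (E^T *m E).
Proof.
move=> Einj; pose P := char_poly (- (E^T *m E)).
have P0 : P.[0] = \det (E^T *m E).
  rewrite horner_coef0 char_poly_det -[X in \det X]scaleN1r detZ mulrA -exprD addnn.
  by rewrite -signr_odd odd_double mul1r.
have Proot x : 0 <= x -> ~~ root P x.
  move=> x0; rewrite -eigenvalue_root_char; apply/eigenvalueP => -[u uE].
  apply/negP; rewrite negbK -trmx_eq0; apply/eqP/Einj.
  have dot0 m (w : 'rV[R]_m) : 0 <= (w *m w^T) 0 0 ?= iff (w == 0).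
    have -> : (w *m w^T) 0 0 = \sum_i w 0 i ^+ 2.
      by rewrite mxE; apply: eq_bigr => i _; rewrite mxE expr2.
    split; first by apply: sumr_ge0 => i _; apply: sqr_ge0.
    rewrite eq_sym psumr_eq0; last by move=> i _; apply: sqr_ge0.
    apply/idP/eqP => [/allP h|->]; last by apply/allP => i _; rewrite mxE expr0n eqxx.
    apply/rowP => i; have := h i (mem_index_enum i); rewrite sqrf_eq0 mxE.
    by move/eqP.
  have [uu0 _] := dot0 _ u; have [h heq] := dot0 _ (u *m E^T).
  apply: trmx_inj; rewrite trmx_mul trmxK trmx0; apply/eqP; rewrite -heq eq_sym.
  rewrite eq_le h andbT.
  have := congr1 (fun w : 'rV[R]_s => (w *m u^T) 0 0) uE.
  rewrite -scalemxAl mulmxN mulNmx trmx_mul trmxK !mulmxA [in LHS]mxE [in RHS]mxE.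
  by move/(canRL (@opprK _)) => ->; rewrite oppr_le0 mulr_ge0.
have lP : lead_coef P = 1 by apply/eqP/char_poly_monic.
have [|M HM] := @polyrcf.poly_pinfty_gt_lc _ P; first by rewrite lP ltr01.
rewrite ltNge -P0; apply/negP => P0le.
have [||x /andP[x0 _]] := @poly_ivt _ P 0 (Num.max 0 M); first by rewrite le_max lexx.
- by rewrite P0le (le_trans ler01) // -lP HM // le_max lexx orbT.
- by apply/negP/Proot.
Qed.

Section FaceFrames.
Variables (R : realType) (d : nat) (v g : 'I_d.+1 -> 'cV[R]_d).
Hypothesis hg : bary_gradients v g.
Implicit Types (i k : 'I_d.+1) (p q : mpoly d R).
Variable F : {set 'I_d.+1}.
Hypothesis F0 : (0 < #|F|)%N.
Local Notation lam := (lam v g).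
Local Notation onface := (onface v g F).

(** The passage from the degrees of freedom to [fint]: the integrand has to agree with a polynomial
    only on the affine hull, and the Jacobian can be cancelled because barycentric coordinates
    invert the parametrization. *)
Lemma face_int_eq0 (f : 'cV[R]_d -> R) p :
  (forall x, onface x -> f x = ev x p) -> face_int v F f = 0 -> fint v F p = 0.
Proof.
move=> fp /eqP; rewrite /face_int mulf_eq0 sqrtr_eq0 leNgt gram_det_gt0 /=.
  move=> /eqP <-; rewrite /fint /sint; congr simplex_int; apply/funext => y.
  rewrite ev_pb fp // => i iF.
  by rewrite -ev_pb (pb_lamN hg F0 iF) ev0.
move=> y Ey; have ltF (j : 'I_(#|F|.-1)) : (j.+1 < #|F|)%N by rewrite -ltn_predRL.
apply/colP => j; rewrite mxE.
have lamy z : ev (face_vertex v F 0 + face_edges v F *m z) (lam (idx F j.+1)) = z j 0.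
  by rewrite -ev_pb (pb_lamS hg F0) evX.
by have := lamy 0; rewrite mulmx0 -Ey lamy mxE.
Qed.

Lemma onface_dot x y : onface y -> onface x <-> forall i, i \notin F -> dot (g i) (x - y) = 0.
Proof.
move=> yF; have [j jF] : exists j, j \in F by apply/card_gt0P.
have E i : dot (g i) (x - y) = ev x (lam i) - ev y (lam i).
  by rewrite !(ev_lam hg i j) dotBr !dotBr; ring.
split=> h i iF; first by rewrite E h // yF // subrr.
by have := h i iF; rewrite E yF // subr0.
Qed.

(** Equations for a space that is defined by generators; this links the orthonormal frames to the
    oblique gradients. *)
Lemma tangentP (u : 'cV[R]_d) :
  (u^T <= tangent v F)%MS <-> (forall i, i \notin F -> dot (g i) u = 0).
Proof.
split=> [uF k kF|uF].
  suff tk : (tangent v F <= kermx (g k))%MS.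
    have /sub_kermxP := submx_trans uF tk.
    by rewrite dotC /dot => ->; rewrite mxE.
  apply/sumsmx_subP => i iF; apply/sumsmx_subP => j jF; rewrite genmxE.
  apply/sub_kermxP/matrixP => a b; rewrite !ord1 [RHS]mxE.
  rewrite -[LHS]/(dot _ _) dotC (bary_gradients_edge hg).
  have -> : (k == i) = false by apply: contraNF kF => /eqP ->.
  have -> : (k == j) = false by apply: contraNF kF => /eqP ->.
  by rewrite subrr.
have [j jF] : exists j, j \in F by apply/card_gt0P.
have -> : u = \sum_(i in F) dot (g i) u *: (v i - v j).
  under eq_bigr do rewrite scalerBr.
  rewrite sumrB -scaler_suml -{1}(bary_gradients_expand hg u) (bigID (mem F)) /=.
  rewrite [X in _ + X]big1 => [|i /uF ->]; last by rewrite scale0r.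
  suff -> : \sum_(i in F) dot (g i) u = 0 by rewrite scale0r subr0 addr0.
  have := bary_gradients_sum hg => /(congr1 (fun w => dot w u)).
  by rewrite dot_suml dotC dot0r (bigID (mem F)) /= [X in _ + X]big1 ?addr0.
rewrite linear_sum; apply: summx_sub => i iF /=.
rewrite linearZ; apply: scalemx_sub; rewrite /tangent.
apply: submx_trans (sumsmx_sup i _ (submx_refl _)) => //.
by apply: submx_trans (sumsmx_sup j _ (submx_refl _)) => //; rewrite genmxE.
Qed.

Definition normal_to (a : 'cV[R]_d) := forall i k, i \in F -> k \in F -> dot a (v i - v k) = 0.

Lemma normal_grad k : k \notin F -> normal_to (g k).
Proof.
move=> kF i j iF jF; rewrite (bary_gradients_edge hg).
have -> : (k == i) = false by apply: contraNF kF => /eqP ->.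
have -> : (k == j) = false by apply: contraNF kF => /eqP ->.
by rewrite subrr.
Qed.

Section Frame.
Variables (r : nat) (o : 'cV[R]_d) (t : 'M[R]_(d, d - r)) (n : 'M[R]_(d, r)).
Hypothesis hf : face_frame v F o t n.

Lemma frame_project x : onface x -> t *m (t^T *m (x - o)) = x - o.
Proof.
move=> xF; have [j jF] : exists j, j \in F by apply/card_gt0P.
have : ((x - o)^T <= t^T)%MS.
  rewrite (eqmxP (frame_tangent_span hf)).
  rewrite -(subrKA (v j)) linearD addmx_sub //=.
    by apply/tangentP/onface_dot => //; apply: onface_vertex.
  by rewrite -opprB linearN eqmx_opp; apply: (frame_origin hf).
case/submxP => D /(congr1 trmx); rewrite trmx_mul !trmxK => ->.
by rewrite mulmxA mulmxA -(mulmxA t) (frame_tangent_orthonormal hf) mulmx1.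
Qed.

(** Any ambient polynomial, rewritten in the Cartesian coordinates of the face without increasing
    its degree, thereby becomes available as a test function. *)
Lemma ev_face_coord x p : onface x -> ev (face_coord o t x) (aff o t p) = ev x p.
Proof. by move=> xF; rewrite ev_aff /face_coord frame_project // addrC subrK. Qed.

Lemma frame_tangent_col a k : k \notin F -> dot (g k) (col a t) = 0.
Proof.
move=> kF; move: k kF; apply/tangentP; rewrite tr_col -(eqmxP (frame_tangent_span hf)).
exact: row_sub.
Qed.

Lemma frame_normal_to a : normal_to (col a n).
Proof.
move=> i j iF jF; have : ((col a n)^T <= kermx (tangent v F)^T)%MS.
  by rewrite -(eqmxP (frame_normal_span hf)) tr_col row_sub.
move/sub_kermxP => h; have : ((v i - v j)^T <= tangent v F)%MS.
  apply/tangentP => k kF; exact: normal_grad.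
case/submxP => D /(congr1 trmx); rewrite trmxK trmx_mul => ->.
by rewrite /dot mulmxA h mul0mx mxE.
Qed.

Lemma normal_span a : normal_to a -> exists c : 'cV[R]_r, a = n *m c.
Proof.
move=> ha; have : (a^T <= n^T)%MS.
  rewrite (eqmxP (frame_normal_span hf)); apply/sub_kermxP.
  rewrite -trmx_mul; apply: trmx_inj; rewrite trmxK trmx0; apply/sub_kermxP.
  apply/sumsmx_subP => i iF; apply/sumsmx_subP => j jF; rewrite genmxE.
  apply/sub_kermxP/matrixP => b c; rewrite !ord1 [RHS]mxE -[LHS]/(dot _ _) dotC.
  exact: ha.
case/submxP => D /(congr1 trmx); rewrite trmxK trmx_mul trmxK => ->.
by exists D^T.
Qed.

Lemma frame_tangent_normal : t^T *m n = 0.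
Proof.
apply/matrixP => a b; have : ((col b n)^T <= kermx (tangent v F)^T)%MS.
  by rewrite -(eqmxP (frame_normal_span hf)) tr_col row_sub.
move/sub_kermxP => h; have : (row a t^T <= tangent v F)%MS.
  by rewrite -(eqmxP (frame_tangent_span hf)) row_sub.
case/submxP => D hD; rewrite [RHS]mxE.
have := congr1 trmx h; rewrite trmx_mul !trmxK trmx0 => h'.
have : row a t^T *m col b n = 0 by rewrite hD -mulmxA h' mulmx0.
move/matrixP/(_ 0 0); rewrite [RHS]mxE => <-; rewrite !mxE.
by apply: eq_bigr => c _; rewrite !mxE.
Qed.
End Frame.

End FaceFrames.

(** * Homogeneous decompositions *)

Section Euler.
Variables (R : realType) (n : nat).
Implicit Types (p : mpoly n R) (q w : 'cV[mpoly n R]_n) (A W : 'M[mpoly n R]_n).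

Definition euler p := \sum_j \X_j * mderiv j p.
Definition hpart a p := pihomog mdeg a p.
Definition xdot q := \sum_j \X_j * q j 0.
Definition pgrad p : 'cV[mpoly n R]_n := \col_j mderiv j p.

Lemma HHP a p : HH n a p <-> (forall m, mdeg m != a -> mcoeff m p = 0).
Proof.
split=> [/dhomogP h m ma|h].
  by apply/memN_msupp_eq0; apply: contra ma => /h /eqP.
apply/dhomogP => m; rewrite mcoeff_msupp => mp; apply/eqP.
by apply: contraNT mp => /h ->.
Qed.

Lemma mcoeff_hpart a p m : mcoeff m (hpart a p) = if mdeg m == a then mcoeff m p else 0.
Proof.
elim/mpolyind: p => [|c m' p _ _ IH].
  by rewrite /hpart linear0 !mcoeff0; case: ifP.
rewrite /hpart linearP /= !mcoeffD IH !mcoeffZ pihomogX mcoeffX.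
case: (eqVneq m' m) => [->|mm].
  by case: ifP; rewrite ?mcoeff0 ?mulr0 ?addr0 // mcoeffX eqxx.
have -> : mcoeff m (if mdeg m' == a then mpolyX R m' else 0) = 0.
  by case: ifP; rewrite ?mcoeff0 // mcoeffX (negbTE mm).
by rewrite mulr0 !add0r.
Qed.

Lemma HH_hpart a p : HH n a (hpart a p).
Proof. exact: pihomogP. Qed.

Lemma hpart_id a p : HH n a p -> hpart a p = p.
Proof. exact: pihomog_dE. Qed.

Lemma hpart_msz a p : (msz p <= a)%N -> hpart a p = 0.
Proof.
move=> /mszP h; apply/mpolyP => m; rewrite mcoeff_hpart mcoeff0.
by case: eqP => // ma; rewrite h // ma.
Qed.

Lemma msz_HH a p : HH n a p -> (msz p <= a.+1)%N.
Proof. by move=> /HHP h; apply/mszP => m am; apply: h; rewrite gtn_eqF. Qed.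

Lemma msz_sub_hpart a p : (msz p <= a.+1)%N -> (msz (p - hpart a p) <= a)%N.
Proof.
move=> /mszP h; apply/mszP => m am; rewrite mcoeffB mcoeff_hpart.
case: eqP => [|ma]; rewrite ?subrr // subr0 h // ltn_neqAle am andbT eq_sym; exact/eqP.
Qed.

Lemma HH_lin a (c : R) p p' : HH n a p -> HH n a p' -> HH n a (c *: p + p').
Proof.
move=> /HHP h /HHP h'; apply/HHP => m ma.
by rewrite mcoeffD mcoeffZ h // h' // mulr0 addr0.
Qed.

Lemma HH0 a : HH n a (0 : mpoly n R).
Proof. by apply/HHP => m _; rewrite mcoeff0. Qed.

Lemma HHZ a (c : R) p : HH n a p -> HH n a (c *: p).
Proof. by move=> h; rewrite -[_ *: _]addr0; apply: HH_lin => //; exact: HH0. Qed.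

Lemma HHD a p p' : HH n a p -> HH n a p' -> HH n a (p + p').
Proof. by move=> h h'; rewrite -[p]scale1r; apply: HH_lin. Qed.

Lemma HHN a p : HH n a p -> HH n a (- p).
Proof. by move=> h; rewrite -scaleN1r; apply: HHZ. Qed.

Lemma HH_sum a (I : Type) (r : seq I) (P : pred I) (F : I -> mpoly n R) :
  (forall i, P i -> HH n a (F i)) -> HH n a (\sum_(i <- r | P i) F i).
Proof.
move=> h; elim/big_rec: _ => [|i p Pi hp]; first exact: HH0.
by apply: HHD => //; apply: h.
Qed.

Lemma HH_deriv a j p : HH n a.+1 p -> HH n a (mderiv j p).
Proof.
move=> /HHP h; apply/HHP => m ma; rewrite mcoeff_mderiv h ?mul0rn //.
by rewrite mdegD mdeg1 addn1 eqSS.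
Qed.

Lemma HHX j : HH n 1 (\X_j : mpoly n R).
Proof. by rewrite /HH /= dhomogX; apply/eqP; exact: mdeg1. Qed.

Lemma HHM a b p p' : HH n a p -> HH n b p' -> HH n (a + b) (p * p').
Proof. exact: dhomogM. Qed.

Lemma HH_deriv0 j p : HH n 0 p -> mderiv j p = 0.
Proof.
move=> /HHP h; apply/mpolyP => m; rewrite mcoeff_mderiv h ?mul0rn ?mcoeff0 //.
by rewrite mdegD mdeg1 addn1.
Qed.

Lemma hpartD a p p' : hpart a (p + p') = hpart a p + hpart a p'.
Proof. exact: pihomogD. Qed.

Lemma hpartB a p p' : hpart a (p - p') = hpart a p - hpart a p'.
Proof. exact: pihomogB. Qed.

Lemma hpartZ a (c : R) p : hpart a (c *: p) = c *: hpart a p.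
Proof. exact: linearZ. Qed.

Lemma hpart_sum a (I : Type) (r : seq I) (P : pred I) (F : I -> mpoly n R) :
  hpart a (\sum_(i <- r | P i) F i) = \sum_(i <- r | P i) hpart a (F i).
Proof. exact: raddf_sum. Qed.

Lemma hpart_partition N p : (msz p <= N)%N -> p = \sum_(a < N) hpart a p.
Proof. exact: pihomog_partitionE. Qed.

Lemma mnm_subUK j (m : multinom n) : m j != 0%N -> mnm_add (mnm1 j) (mnm_sub m (mnm1 j)) = m.
Proof.
move=> mj; rewrite addmC submK //.
by apply/mnm_lepP => l; rewrite mnm1E; case: eqP => // <-; rewrite lt0n.
Qed.

Lemma mcoeff_mulX j p m : mcoeff m (\X_j * p) =
  if m j == 0%N then 0 else mcoeff (mnm_sub m (mnm1 j)) p.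
Proof.
rewrite mulrC; case: eqP => [mj|/eqP mj].
  apply: memN_msupp_eq0; rewrite (perm_mem (msuppMX p (mnm1 j))).
  by apply/mapP => -[m' _ mE]; move: mj; rewrite mE mnmDE mnm1E eqxx.
by rewrite -{1}(mnm_subUK mj) mcoeffMX.
Qed.

Lemma hpart_mulX a j p : hpart a.+1 (\X_j * p) = \X_j * hpart a p.
Proof.
apply/mpolyP => m; rewrite mcoeff_hpart !mcoeff_mulX.
have [mj|mj] := eqVneq (m j) 0%N; first by case: ifP.
rewrite mcoeff_hpart.
have -> : (mdeg m == a.+1) = (mdeg (mnm_sub m (mnm1 j)) == a).
  by rewrite -{1}(mnm_subUK mj) mdegD mdeg1 add1n eqSS.
by [].
Qed.

Lemma mcoeff_euler p m : mcoeff m (euler p) = (mdeg m)%:R * mcoeff m p.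
Proof.
rewrite /euler raddf_sum mdegE natr_sum mulr_suml; apply: eq_bigr => j _ /=.
rewrite mcoeff_mulX; case: eqP => [->|/eqP mj]; first by rewrite mul0r.
rewrite mcoeff_mderiv addmC (mnm_subUK mj).
by rewrite mnmBE mnm1E eqxx subn1 prednK ?lt0n // mulr_natl.
Qed.

Lemma euler_HH a p : HH n a p -> euler p = a%:R *: p.
Proof.
move=> /HHP h; apply/mpolyP => m; rewrite mcoeff_euler mcoeffZ.
by have [->//|ma] := eqVneq (mdeg m) a; rewrite h // !mulr0.
Qed.

Lemma eulerM p p' : euler (p * p') = euler p * p' + p * euler p'.
Proof.
rewrite /euler mulr_suml mulr_sumr -big_split; apply: eq_bigr => j _ /=.
by rewrite mderivM; ring.
Qed.

Lemma eulerX j : euler (\X_j) = \X_j.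
Proof. by rewrite (euler_HH (HHX j)) scale1r. Qed.

Lemma euler_deriv j p : mderiv j (euler p) = mderiv j p + euler (mderiv j p).
Proof.
apply/mpolyP => m; rewrite mcoeffD mcoeff_mderiv !mcoeff_euler mcoeff_mderiv.
by rewrite mdegD mdeg1 addn1 -natr1 mulrDl mul1r mulrnDl addrC mulrnAr.
Qed.

Lemma euler_eq0 p : euler p = 0 -> HH n 0 p.
Proof.
move=> h; apply/HHP => m m0; have := mcoeff_euler p m; rewrite h mcoeff0.
by move/esym/eqP; rewrite mulf_eq0 pnatr_eq0 (negbTE m0) => /eqP.
Qed.

Lemma euler_id p : euler p = p -> HH n 1 p.
Proof.
move=> h; apply/HHP => m m1; have /eqP := mcoeff_euler p m; rewrite h.
rewrite -subr_eq0 -{1}[mcoeff m p]mul1r -mulrBl mulf_eq0 subr_eq0.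
by rewrite (eqr_nat R 1) eq_sym (negbTE m1) => /eqP.
Qed.

Lemma xdot_grad p : xdot (pgrad p) = euler p.
Proof. by apply: eq_bigr => j _; rewrite mxE. Qed.

Lemma xdotD q w : xdot (q + w) = xdot q + xdot w.
Proof. by rewrite -big_split; apply: eq_bigr => j _; rewrite mxE mulrDr. Qed.

Lemma xdotB q w : xdot (q - w) = xdot q - xdot w.
Proof. by rewrite -sumrB; apply: eq_bigr => j _; rewrite !mxE mulrBr. Qed.

Lemma half_double p : (2^-1 : R) *: (p + p) = p.
Proof.
by rewrite -mulr2n -scalerMnr scalerMnl -[_ *+ 2]mulr_natr mulVf ?scale1r ?pnatr_eq0.
Qed.

Lemma xdot_skew W : W^T = - W -> xdot (W *m xvec n) = 0.
Proof.
move=> WT; pose s := xdot (W *m xvec n).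
have sE : s = \sum_i \sum_j W i j * (\X_i * \X_j).
  apply: eq_bigr => i _; rewrite mxE mulr_sumr; apply: eq_bigr => j _.
  by rewrite !mxE; ring.
have : s = - s.
  rewrite {1}sE exchange_big sE -sumrN; apply: eq_bigr => i _.
  rewrite -sumrN; apply: eq_bigr => j _.
  have /matrixP/(_ i j) := WT; rewrite !mxE => ->; ring.
by move/eqP; rewrite -addr_eq0 -mulr2n -scaler_nat scaler_eq0 pnatr_eq0 => /eqP.
Qed.

Lemma mulmx_xvecE A i : (A *m xvec n) i 0 = \sum_j A i j * \X_j.
Proof. by rewrite mxE; apply: eq_bigr => j _; rewrite mxE. Qed.

(** Expresses (def q) x through the Euler operator, a scalar on homogeneous fields, and the single
    function x.q. Surjectivity and injectivity of def q |-> (def q) x both rest on it. *)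
Lemma sym_grad_x q i :
  (sym_grad q *m xvec n) i 0 = 2^-1 *: (euler (q i 0) + mderiv i (xdot q) - q i 0).
Proof.
rewrite mulmx_xvecE /xdot mderiv_sum.
under [in RHS]eq_bigr do rewrite mderivM mderivXU.
rewrite big_split /= [X in _ + (X + _)](bigD1 i) //= eqxx mul1r.
rewrite [X in _ + (_ + X + _)]big1 => [|j /negbTE ->]; last by rewrite mul0r.
rewrite addr0 addrCA addrAC subrr add0r /euler -big_split scaler_sumr.
apply: eq_bigr => j _; rewrite mxE -scalerAl; congr (_ *: _).
by rewrite /=; ring.
Qed.

(* For homogeneous [w] of degree m+1 with x.w = 0, differentiating x.w = 0 and Euler's
   identity give (Dw - (Dw)^T) x = (m+2) w. *)
Lemma ND_spec m q : ND n m q <-> Pmx n m.+1 n 1 q /\ hpart m.+2 (xdot q) = 0.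
Proof.
split=> [[p [W [hp [hW WT] ->]]]|[hq h0]].
  split=> [i j|].
    rewrite mxE; apply: mszD; first exact/mszS/hp.
    rewrite ord1 mulmx_xvecE; apply: msz_sum => l _.
    rewrite -addn2; apply: mszM; last by rewrite mszXU.
    exact/msz_HH.
  rewrite xdotD (xdot_skew WT) addr0; apply: hpart_msz.
  apply: msz_sum => j _; rewrite -[m.+2]add1n; apply: mszM; rewrite ?mszXU //.
  exact: hp.
pose w : 'cV[mpoly n R]_n := \col_i hpart m.+1 (q i 0).
have xw : xdot w = 0.
  rewrite -[RHS]h0 /xdot hpart_sum; apply: eq_bigr => j _.
  by rewrite mxE hpart_mulX.
pose W : 'M[mpoly n R]_n :=
  \matrix_(i, j) (m.+2%:R^-1 *: (mderiv j (w i 0) - mderiv i (w j 0))).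
exists (q - w), W; split.
- by move=> i j; rewrite ord1 !mxE; apply: msz_sub_hpart; apply: hq.
- split=> [i j|].
    rewrite !mxE; apply: HHZ; apply: HHD; last apply: HHN;
      by apply: HH_deriv; exact: HH_hpart.
  by apply/matrixP => i j; rewrite !mxE -scalerN opprB.
apply/colP => i.
suff Wx : (W *m xvec n) i 0 = w i 0 by rewrite mxE Wx !mxE subrK.
rewrite mulmx_xvecE.
have := congr1 (mderiv i) xw; rewrite mderiv0 /xdot mderiv_sum.
under eq_bigr do rewrite mderivM mderivXU.
rewrite big_split /= [X in X + _](bigD1 i) //= eqxx mul1r.
rewrite [X in _ + X + _]big1 => [|j /negbTE ->]; last by rewrite mul0r.
rewrite addr0 addrC => /eqP; rewrite addr_eq0 => /eqP h1.
have wi : euler (w i 0) = m.+1%:R *: w i 0.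
  by apply: euler_HH; rewrite mxE; exact: HH_hpart.
transitivity (m.+2%:R^-1 *: (euler (w i 0) - \sum_j \X_j * mderiv i (w j 0))).
  rewrite /euler -sumrB scaler_sumr; apply: eq_bigr => j _.
  by rewrite mxE -scalerAl mulrBl !(mulrC (\X_j)).
rewrite h1 opprK wi -{2}[w i 0]scale1r -scalerDl natr1 scalerA mulVf ?scale1r //.
Qed.

Lemma grad_ND_decomposition m q : Pmx n m.+1 n 1 q ->
  exists p w, ND n m w /\ q = pgrad p + w.
Proof.
move=> hq; pose p := m.+2%:R^-1 *: hpart m.+2 (xdot q).
have hp : HH n m.+2 p by apply: HHZ; exact: HH_hpart.
exists p, (q - pgrad p); split; last by rewrite addrC subrK.
apply/ND_spec; split=> [i j|].
  rewrite !mxE; apply: mszB; first exact: hq.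
  by apply/msz_deriv/msz_HH.
rewrite xdotB xdot_grad hpartB (euler_HH hp) hpartZ (hpart_id hp) scalerA mulfV ?pnatr_eq0 //.
by rewrite scale1r subrr.
Qed.

Lemma sym_gradD q w : sym_grad (q + w) = sym_grad q + sym_grad w.
Proof.
by apply/matrixP => i j; rewrite !mxE !mderivD -scalerDr addrACA.
Qed.

Lemma sym_grad_sum (I : Type) (r : seq I) (F : I -> 'cV[mpoly n R]_n) :
  sym_grad (\sum_(i <- r) F i) = \sum_(i <- r) sym_grad (F i).
Proof.
apply: (big_morph _ sym_gradD); apply/matrixP => i j.
by rewrite !mxE !mderiv0 addr0 scaler0.
Qed.

Lemma sym_grad_sym q : (sym_grad q)^T = sym_grad q.
Proof. by apply/matrixP => i j; rewrite !mxE addrC. Qed.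

Lemma sym_grad_PS m q : Pmx n m.+1 n 1 q -> PS n m (sym_grad q).
Proof.
move=> hq; split; last exact: sym_grad_sym.
by move=> i j; rewrite mxE; apply/mszZ/mszD; apply/msz_deriv/hq.
Qed.

Lemma sym_grad_x_surj a w : (forall i, HH n a.+2 (w i 0)) ->
  exists2 q : 'cV_n, (forall i, HH n a.+2 (q i 0)) & sym_grad q *m xvec n = w.
Proof.
move=> hw; pose s := xdot w.
have hs : HH n a.+3 s.
  by apply: HH_sum => j _; rewrite -[a.+3]add1n; apply: HHM => //; exact: HHX.
(* For q homogeneous of degree a+2 the equation reads (a+1) q + grad(x.q) = 2 w. Pairing it with x
   gives (a+2) x.q = s, and then q is determined. Division by a+1 is the reason for starting at
   degree 2. *)
pose q : 'cV[mpoly n R]_n :=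
  \col_i (a.+1%:R^-1 *: (2 *: w i 0 - a.+2%:R^-1 *: mderiv i s)).
have hq i : HH n a.+2 (q i 0).
  rewrite mxE; apply/HHZ/HHD; first exact/HHZ/hw.
  exact/HHN/HHZ/HH_deriv.
have nz b : (b.+1%:R : R) != 0 by rewrite pnatr_eq0.
have xq : xdot q = a.+2%:R^-1 *: s.
  transitivity (a.+1%:R^-1 *: (2 *: s - a.+2%:R^-1 *: euler s)).
    rewrite /s /xdot /euler !scaler_sumr -sumrB scaler_sumr; apply: eq_bigr => j _.
    by rewrite mxE -scalerAr mulrBr -!scalerAr.
  rewrite (euler_HH hs) scalerA -scalerBl scalerA; congr (_ *: _).
  have := nz a; have := nz a.+1; rewrite -(natr1 a.+2) -(natr1 a.+1) -(natr1 a).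
  by move: (a%:R + 1) => x x1 x0; field; rewrite x0 x1.
exists q => //; apply/colP => i; rewrite sym_grad_x (euler_HH (hq i)) xq mderivZ.
rewrite addrAC -{2}[q i 0]scale1r -scalerBl -(natr1 a.+1) addrK {1}mxE scalerA mulfV // scale1r.
by rewrite natr1 subrK scalerA mulVf ?pnatr_eq0 // scale1r.
Qed.

Lemma sym_grad_x_homog a A : (forall i j, HH n a (A i j)) -> A^T = A ->
  exists2 q : 'cV_n, (forall i, HH n a.+1 (q i 0)) & sym_grad q *m xvec n = A *m xvec n.
Proof.
move=> hA AT; pose w := A *m xvec n.
have hw i : HH n a.+1 (w i 0).
  by rewrite mulmx_xvecE; apply: HH_sum => j _; rewrite -addn1; apply: HHM (HHX j).
case: a => [|a] in hA hw *; last exact: sym_grad_x_surj.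
(* Degree 0 is separate: for a constant symmetric A the symmetric gradient of A x is A. *)
exists w => //; congr (_ *m _); apply/matrixP => i j; rewrite mxE !mulmx_xvecE !mderiv_sum.
have e k l : \sum_b mderiv l (A k b * \X_b) = A k l.
  rewrite (bigD1 l) //= mderivM mderivXU eqxx (HH_deriv0 _ (hA _ _)) mul0r add0r.
  rewrite mulr1 big1 ?addr0 // => b /negbTE bl.
  by rewrite mderivM mderivXU bl mulr0 addr0 (HH_deriv0 _ (hA _ _)) mul0r.
rewrite !e; have /matrixP/(_ i j) := AT; rewrite mxE => ->.
exact: half_double.
Qed.

Lemma sym_grad_x_eq A m : PS n m A ->
  exists2 q : 'cV_n, Pmx n m.+1 n 1 q & sym_grad q *m xvec n = A *m xvec n.
Proof.
move=> [hA AT]; pose Ah a := map_mx (hpart a) A.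
have hq a : exists q : 'cV_n, (forall i, HH n a.+1 (q i 0)) /\
    sym_grad q *m xvec n = Ah a *m xvec n.
  have [||q h1 h2] := @sym_grad_x_homog a (Ah a); last by exists q.
    by move=> i j; rewrite mxE; exact: HH_hpart.
  by rewrite /Ah map_trmx AT.
pose Q a := projT1 (cid (hq a)); have QP a := projT2 (cid (hq a)).
exists (\sum_(a < m.+1) Q a).
  move=> i j; rewrite summxE; apply: msz_sum => a _; rewrite ord1.
  by apply: leq_trans (msz_HH ((QP a).1 i)) _; rewrite !ltnS -ltnS.
rewrite sym_grad_sum mulmx_suml.
rewrite (eq_bigr (fun a : 'I_m.+1 => Ah a *m xvec n)) => [|a _]; last exact: (QP a).2.
rewrite -mulmx_suml; congr (_ *m _); apply/matrixP => i j.
rewrite summxE [RHS](hpart_partition (hA i j)).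
by apply: eq_bigr => a _; rewrite mxE.
Qed.

Lemma PS_decomposition A m : PS n m A ->
  exists q W, [/\ Pmx n m.+1 n 1 q, ker_x n W, PS n m W & A = sym_grad q + W].
Proof.
move=> hA; have [q hq qx] := sym_grad_x_eq hA.
have [hs sT] := sym_grad_PS hq; case: hA => hA AT.
exists q, (A - sym_grad q); split => //; last by rewrite addrC subrK.
  by rewrite /ker_x /= mulmxBl qx subrr.
split=> [i j|]; last by rewrite linearB /= AT sT.
by rewrite !mxE; apply: mszB; [exact: hA|have := hs i j; rewrite !mxE].
Qed.

(** Write s = x.q and E for the Euler operator. Pairing the equation with x gives E s = s, so s is
    linear and its second derivatives vanish. Differentiating the equation then gives E(d_j q_i) =
    0: def q is constant, and a constant matrix that kills x is zero. *)
Lemma sym_grad_x_inj q : sym_grad q *m xvec n = 0 -> sym_grad q = 0.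
Proof.
move=> h; pose s := xdot q.
have e i : euler (q i 0) + mderiv i s - q i 0 = 0.
  have := congr1 (fun B : 'cV_n => B i 0) h; rewrite sym_grad_x [RHS]mxE => /eqP.
  by rewrite scaler_eq0 invr_eq0 pnatr_eq0 => /eqP.
have es : euler s = s.
  have h1 : \sum_i \X_i * euler (q i 0) = euler s - s.
    rewrite /s /xdot [euler _](_ : _ = \sum_i euler (\X_i * q i 0)); last first.
      rewrite /euler exchange_big; apply: eq_bigr => j _.
      by rewrite mderiv_sum mulr_sumr.
    by rewrite -sumrB; apply: eq_bigr => i _; rewrite eulerM eulerX addrAC subrr add0r.
  have : \sum_i \X_i * (euler (q i 0) + mderiv i s - q i 0) = 0.
    by rewrite big1 // => i _; rewrite e mulr0.
  under eq_bigr do rewrite mulrBr mulrDr.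
  rewrite sumrB big_split /= h1 -/(euler s) -/(xdot q) -/s.
  rewrite -addrA => /(congr1 (fun z => (2^-1 : R) *: z)).
  by rewrite half_double scaler0 => /eqP; rewrite subr_eq0 => /eqP.
have hs2 i j : mderiv j (mderiv i s) = 0.
  by apply: HH_deriv0; apply: HH_deriv; apply: euler_id.
have c i j : HH n 0 (mderiv j (q i 0)).
  apply: euler_eq0; have := congr1 (mderiv j) (e i).
  rewrite mderivB mderivD hs2 addr0 mderiv0 euler_deriv => /eqP.
  by rewrite addrAC subrr add0r => /eqP.
apply/matrixP => i j; rewrite [RHS]mxE.
have := congr1 (fun B : 'cV_n => mderiv j (B i 0)) h.
rewrite [in RHS]mxE mderiv0 mulmx_xvecE mderiv_sum (bigD1 j) //= mderivM mderivXU eqxx.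
have c' k l : mderiv l (sym_grad q i k) = 0.
  by rewrite mxE mderivZ mderivD !(HH_deriv0 _ (c _ _)) addr0 scaler0.
rewrite c' mul0r add0r mulr1 big1 ?addr0 // => k /negbTE kj.
by rewrite mderivM c' mul0r mderivXU kj mulr0 addr0.
Qed.
End Euler.

(** * Unisolvence *)

Section NormalComponents.
Variables (R : realType) (d : nat) (v g : 'I_d.+1 -> 'cV[R]_d).
Hypothesis hg : bary_gradients v g.
Implicit Types (F : {set 'I_d.+1}) (a b : 'cV[R]_d) (tau sigma : 'M[mpoly d R]_d).
Local Notation vanish := (vanish v g).
Local Notation onface := (onface v g).

Lemma fint_lin F (c : R) p q : fint v F (c *: p + q) = c * fint v F p + fint v F q.
Proof. by rewrite /fint rmorphD /= /pb affZ sint_is_linear. Qed.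

Lemma fint0 F : fint v F 0 = 0.
Proof. by rewrite /fint rmorph0 raddf0. Qed.

Lemma fintD F p q : fint v F (p + q) = fint v F p + fint v F q.
Proof. by rewrite -[p in LHS]scale1r fint_lin mul1r. Qed.

Lemma fintZ F (c : R) p : fint v F (c *: p) = c * fint v F p.
Proof. by rewrite -[_ *: _]addr0 fint_lin fint0 addr0. Qed.

Lemma fint_sum F (I : Type) (r : seq I) (P : pred I) (f : I -> mpoly d R) :
  fint v F (\sum_(i <- r | P i) f i) = \sum_(i <- r | P i) fint v F (f i).
Proof. by apply: big_morph; [exact: fintD|exact: fint0]. Qed.

Definition pdot a (w : 'cV[mpoly d R]_d) : mpoly d R := \sum_i a i 0 *: w i 0.
Definition bil a tau b : mpoly d R := pdot a (tau *m cst_mx d b).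

Lemma ev_pdot x a w : ev x (pdot a w) = dot a (ev_mx x w).
Proof.
by rewrite ev_sum dotE; apply: eq_bigr => i _; rewrite evZ mxE.
Qed.

Lemma ev_mxM m1 m2 m3 x (A : 'M[mpoly d R]_(m1, m2)) (B : 'M[mpoly d R]_(m2, m3)) :
  ev_mx x (A *m B) = ev_mx x A *m ev_mx x B.
Proof.
apply/matrixP => i j; rewrite !mxE ev_sum; apply: eq_bigr => l _.
by rewrite evM !mxE.
Qed.

Lemma ev_cst_mx m1 m2 x (A : 'M[R]_(m1, m2)) : ev_mx x (cst_mx d A) = A.
Proof. by apply/matrixP => i j; rewrite !mxE evC. Qed.

Lemma ev_bil x a tau b : ev x (bil a tau b) = dot a (ev_mx x tau *m b).
Proof. by rewrite ev_pdot ev_mxM ev_cst_mx. Qed.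

Lemma ev_mxD m1 m2 x (A B : 'M[mpoly d R]_(m1, m2)) :
  ev_mx x (A + B) = ev_mx x A + ev_mx x B.
Proof. by apply/matrixP => i j; rewrite !mxE evD. Qed.

Lemma ev_rank1 x (q : mpoly d R) :
  ev_mx x (q *: (xvec d *m (xvec d)^T)) = ev x q *: (x *m x^T).
Proof.
apply/matrixP => i j; rewrite !mxE evM !big_ord_recl !big_ord0 !mxE evD evM !evX ev0.
by rewrite !addr0.
Qed.

Lemma msz_pdot a (w : 'cV[mpoly d R]_d) N : (forall i, msz (w i 0%R) <= N)%N -> (msz (pdot a w) <= N)%N.
Proof. by move=> h; apply: msz_sum => i _; apply/mszZ/h. Qed.

Lemma msz_bil a sigma b N : (forall i j, msz (sigma i j) <= N)%N ->
  (msz (bil a sigma b) <= N)%N.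
Proof.
move=> h; apply: msz_pdot => i; rewrite mxE; apply: msz_sum => j _.
rewrite -[N]addn0 mxE mulrC addnC -[(0 + N)%N]/N -[N]add0n.
by apply: mszM; [exact: mszC|exact: h].
Qed.

Lemma msz_xdot a : (msz (pdot a (xvec d)) <= 2)%N.
Proof. by apply: msz_pdot => i; rewrite mxE mszXU. Qed.

Variables (k : nat) (tau sigma : 'M[mpoly d R]_d) (q : mpoly d R).
Hypotheses (hsigma : PS d k sigma) (hq : HH d (k - 1) q) (k0 : (0 < k)%N).
Hypothesis tauE : tau = sigma + q *: (xvec d *m (xvec d)^T).

Lemma msz_q : (msz q <= k)%N.
Proof. by have := msz_HH hq; rewrite subn1 prednK. Qed.

(* On a face, a normal direction has a constant inner product with x, so the
   enrichment x x^T q has no more than degree k in that direction. *)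
Lemma ev_bil_normal F a b x i : normal_to v F b -> i \in F -> onface F x ->
  ev x (bil a tau b) =
  ev x (bil a sigma b + dot b (v i) *: (pdot a (xvec d) * q)).
Proof.
move=> hb iF xF; have F0 : (0 < #|F|)%N by apply/card_gt0P; exists i.
rewrite evD evZ evM !ev_bil tauE ev_mxD ev_rank1 mulmxDl dotDr; congr (_ + _).
have -> : ev x (pdot a (xvec d)) = dot a x.
  by rewrite ev_pdot; congr dot; apply/colP => l; rewrite !mxE evX.
have <- : dot b x = dot b (v i).
  apply/eqP; rewrite -subr_eq0 -dotBr; apply/eqP.
  have : ((x - v i)^T <= tangent v F)%MS.
    by apply/(tangentP hg F0)/(onface_dot hg F0) => //; apply: onface_vertex.
  case/submxP => D /(congr1 trmx); rewrite trmxK trmx_mul => ->.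
  have hT : tangent v F *m b = 0.
    apply/sub_kermxP; apply/sumsmx_subP => j jF; apply/sumsmx_subP => l lF.
    rewrite genmxE; apply/sub_kermxP/matrixP => e c; rewrite !ord1 [RHS]mxE.
    by rewrite -[LHS]/(dot _ _) dotC hb.
  by rewrite /dot mulmxA -trmx_mul hT trmx0 mul0mx mxE.
rewrite -scalemxAl dotZr -mulmxA (_ : x^T *m b = (dot x b)%:M); last first.
  by rewrite [LHS]mx11_scalar.
by rewrite mul_mx_scalar dotZr (dotC x); ring.
Qed.

Variables (o : nat -> {set 'I_d.+1} -> 'cV[R]_d)
  (t : forall r : nat, {set 'I_d.+1} -> 'M[R]_(d, d - r))
  (n : forall r : nat, {set 'I_d.+1} -> 'M[R]_(d, r)).
Hypotheses (hd : (2 <= d)%N) (hk : (d <= k)%N).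
Hypothesis hframe : forall r F, (1 <= r <= d - 1)%N -> F \in faces d r ->
       face_frame v F (o r F) (t r F) (n r F).
Hypothesis vertex_dofs : forall delta : 'I_d.+1, ev_mx (v delta) tau = 0.
Hypothesis normal_dofs : forall r F, (1 <= r <= d - 1)%N -> F \in faces d r ->
        forall (i j : 'I_r) q, PP (d - r) (k + r - d.+1) q ->
        face_int v F (fun x =>
          dot (col i (n r F)) (ev_mx x tau *m col j (n r F))
          * ev (face_coord (o r F) (t r F) x) q) = 0.

Lemma bil_lin (I J : finType) tau' (ca : I -> R) (cb : J -> R) (A : I -> 'cV[R]_d) (B : J -> 'cV[R]_d) :
  bil (\sum_i ca i *: A i) tau' (\sum_j cb j *: B j) =
  \sum_i \sum_j (ca i * cb j) *: bil (A i) tau' (B j).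
Proof.
apply: ev_inj => x; rewrite ev_bil dot_suml ev_sum; apply: eq_bigr => i _.
rewrite dotZl mulmx_sumr dot_sumr mulr_sumr ev_sum; apply: eq_bigr => j _.
by rewrite -scalemxAr dotZr evZ ev_bil mulrA.
Qed.

Lemma mul_col_sum m1 m2 (M : 'M[R]_(m1, m2)) (c : 'cV[R]_m2) :
  M *m c = \sum_j c j 0 *: col j M.
Proof.
by apply/colP => i; rewrite mxE summxE; apply: eq_bigr => j _; rewrite !mxE mulrC.
Qed.

(** Stated for arbitrary normals instead of frame columns: a normal to [F] is still normal to the
    subfaces of [F], so the induction hypothesis applies to the same pair a, b, whatever the frames
    of the subfaces are. *)
Lemma normal_normal_vanish F a b : (0 < #|F| <= d)%N ->
  normal_to v F a -> normal_to v F b -> vanish F (bil a tau b).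
Proof.
have [N FN] := ubnP #|F|; elim: N F FN => // N IH F FN /andP[F0 Fd] ha hb.
have [i iF] : exists i, i \in F by apply/card_gt0P.
have [F1|F1] := leqP #|F| 1.
  move=> x xF; suff -> : x = v i.
    by rewrite ev_bil vertex_dofs mul0mx dot0r.
  have Fi : F = [set i]%SET.
    by apply/eqP; rewrite eq_sym eqEcard finset.sub1set iF cards1.
  have xj j : j != i -> ev x (lam v g j) = 0.
    by move=> ji; apply: xF; rewrite Fi inE.
  rewrite -[LHS](lam_expand hg) (bigD1 i) //= [X in _ + X]big1 => [|j ji].
    have := sum_ev_lam hg x; rewrite (bigD1 i) //= [X in _ + X]big1 => [|j /xj //].
    by rewrite !addr0 => ->; rewrite scale1r.
  by rewrite xj // scale0r.
pose r := (d.+1 - #|F|)%N.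
have rr : (1 <= r <= d - 1)%N by rewrite /r; lia.
have Fr : F \in faces d r by rewrite inE /r subnKC // ltnW.
have hf := hframe rr Fr.
pose f := bil a sigma b + dot b (v i) *: (pdot a (xvec d) * q).
have ff x : onface F x -> ev x (bil a tau b) = ev x f by apply: ev_bil_normal.
have fN : (msz f <= k.+1)%N.
  apply: mszD; first by apply: msz_bil => l j; apply: hsigma.1.
  by apply: mszZ; rewrite -add1n; apply: mszM; [exact: msz_xdot|exact: msz_q].
have fsub j : j \in F -> vanish (F :\ j)%SET f.
  move=> jF x xFj; rewrite -ff; last by apply: onfaceS xFj; exact: subsetDl.
  apply: (IH (F :\ j)%SET) xFj.
  - by move: FN; rewrite (cardsD1 j F) jF.
  - by move: F1 Fd; rewrite (cardsD1 j F) jF; lia.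
  - by move=> l m; rewrite !inE => /andP[_ lF] /andP[_ mF]; apply: ha.
  - by move=> l m; rewrite !inE => /andP[_ lF] /andP[_ mF]; apply: hb.
have [p pN hp] := vanish_divide_prod hg (fintype.subxx F) F1 fsub fN.
suff p0 : vanish F p.
  by move=> x xF; rewrite ff //; have /eqP := hp x xF; rewrite evB evM p0 // mulr0 subr0 => /eqP.
apply: (fint_prod_sqr_eq0 hg F0 (fintype.subxx F)).
have -> : fint v F ((\prod_(j in F) lam v g j) * p ^+ 2) = fint v F (bil a tau b * p).
  apply: (eq_fint hg F0) => x xF; rewrite evM rmorphXn /= evM ff //.
  by have /eqP := hp x xF; rewrite evB evM subr_eq0 => /eqP ->; rewrite expr2 mulrA.
have [ca ->] := normal_span hf ha; have [cb ->] := normal_span hf hb.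
rewrite !mul_col_sum bil_lin mulr_suml fint_sum big1 // => l _.
rewrite mulr_suml fint_sum big1 // => m _.
rewrite -scalerAl fintZ (_ : fint _ _ _ = 0) ?mulr0 //.
apply: (face_int_eq0 hg F0 _ (normal_dofs rr Fr l m (q := aff (o r F) (t r F) p) _)).
  by move=> x xF; rewrite (ev_face_coord hg F0 hf) // evM ev_bil.
(* Each of the d+1-r vertices of [F] costs one degree, from k down to k+r-d-1; as k >= d and r >= 1
   the subtraction is not truncated. *)
rewrite /PP /=; apply: msz_aff; apply: leq_trans pN _.
by rewrite /r; lia.
Qed.
End NormalComponents.

(** * The full trace tau n on facets *)

Section FacetTraces.
Variables (R : realType) (d : nat) (v g : 'I_d.+1 -> 'cV[R]_d).
Hypothesis hg : bary_gradients v g.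
Local Notation vanish := (vanish v g).
Local Notation onface := (onface v g).
Local Notation lam := (lam v g).

Lemma dir_derivM (u : 'cV[R]_d) p q :
  dir_deriv u (p * q) = dir_deriv u p * q + p * dir_deriv u q.
Proof.
rewrite /dir_deriv mulr_suml mulr_sumr -big_split; apply: eq_bigr => j _ /=.
by rewrite mderivM scalerDr -scalerAl -scalerAr.
Qed.

Lemma msz_dir_deriv (u : 'cV[R]_d) p N : (msz p <= N.+1 -> msz (dir_deriv u p) <= N)%N.
Proof. by move=> h; apply: msz_sum => j _; apply/mszZ/msz_deriv. Qed.

Variables (F : {set 'I_d.+1}) (o : 'cV[R]_d) (t : 'M[R]_(d, d - 1)) (n : 'cV[R]_d).
Hypotheses (hd : (2 <= d)%N) (Fd : #|F| = d) (hf : face_frame v F o t n).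

Let F0 : (0 < #|F|)%N. Proof. by rewrite Fd ltnW. Qed.

Lemma facet_normal : normal_to v F n.
Proof. by have := frame_normal_to hg F0 hf 0; rewrite col_id. Qed.

Lemma onface_sub x y : onface F x -> onface F y -> dot n (x - y) = 0.
Proof.
move=> xF yF; have : ((x - y)^T <= tangent v F)%MS.
  by apply/(tangentP hg F0)/(onface_dot hg F0).
rewrite -(eqmxP (frame_tangent_span hf)) => /submxP[D /(congr1 trmx)].
rewrite trmxK trmx_mul trmxK => ->.
by rewrite dotC /dot trmx_mul -mulmxA (frame_tangent_normal hf) mulmx0 mxE.
Qed.

(** Extension of a polynomial in face coordinates that is constant along the normal, so that test
    functions can be multiplied and differentiated together with ambient polynomials. *)
Definition pull (p : mpoly (d - 1) R) : mpoly d R := aff (- (t^T *m o)) t^T p.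

Lemma ev_pull x p : ev x (pull p) = ev (face_coord o t x) p.
Proof. by rewrite ev_aff /face_coord mulmxBr addrC. Qed.

Lemma dir_deriv_pull u p :
  dir_deriv u (pull p) = \sum_a dot u (col a t) *: pull (mderiv a p).
Proof.
rewrite /dir_deriv /pull; under eq_bigr do rewrite mderiv_aff scaler_sumr.
rewrite exchange_big; apply: eq_bigr => a _ /=.
rewrite dotE scaler_suml; apply: eq_bigr => j _.
by rewrite scalerA !mxE.
Qed.

Variables (k : nat) (tau sigma : 'M[mpoly d R]_d) (q : mpoly d R).
Hypotheses (hsigma : PS d k sigma) (hq : HH d (k - 1) q) (hk : (2 <= k)%N).
Hypothesis tauE : tau = sigma + q *: (xvec d *m (xvec d)^T).
Hypothesis hnn : forall (G : {set 'I_d.+1}) a b, (0 < #|G| <= d)%N ->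
  normal_to v G a -> normal_to v G b -> vanish G (bil a tau b).
Hypothesis tangential_dofs : forall q, ND (d - 1) (k - 2) q ->
        face_int v F (fun x =>
          dot ((1%:M - n *m n^T) *m (ev_mx x tau *m n))
              (t *m ev_mx (face_coord o t x) q)) = 0.

Let k0 : (0 < k)%N. Proof. exact: ltnW. Qed.

(** Both n and g_i are normal to the subface [F :\ i], so the normal-normal result of codimension 2
    applies there. *)
Lemma facet_trace_divide i : i \in F ->
  exists2 p, (msz p <= k)%N & vanish F (bil (g i) tau n - lam i * p).
Proof.
move=> iF; have [j jF] : exists j, j \in F by apply/card_gt0P.
pose f := bil (g i) sigma n + dot n (v j) *: (pdot (g i) (xvec d) * q).
have ff x : onface F x -> ev x (bil (g i) tau n) = ev x f.
  by move=> xF; apply: (ev_bil_normal hg tauE _ _ jF xF); exact: facet_normal.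
have F1 : (1 < #|F|)%N by rewrite Fd.
have fN : (msz f <= k.+1)%N.
  apply: mszD; first by apply: msz_bil => l m; apply: hsigma.1.
  by apply: mszZ; rewrite -add1n; apply: mszM; [exact: msz_xdot|exact: msz_q hq k0].
have fi : vanish (F :\ i)%SET f.
  have sub : (F :\ i)%SET \subset F by exact: subsetDl.
  move=> x xFi; rewrite -ff; last exact: onfaceS xFi.
  apply: (hnn _ _ _) xFi.
  - by have := cardsD1 i F; rewrite iF; lia.
  - by apply: normal_grad => //; rewrite !inE eqxx.
  - by move=> l m /(fintype.subsetP sub) lF /(fintype.subsetP sub) mF; apply: facet_normal.
have [p pN hp] := vanish_divide hg iF F1 fi fN.
by exists p => // x xF; rewrite -(hp x xF) !evB ff.
Qed.

Lemma facet_trace_vanish x : onface F x -> ev_mx x tau *m n = 0.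
Proof.
have /choice[p hp] : forall i, exists y, i \in F ->
    (msz y <= k)%N /\ vanish F (bil (g i) tau n - lam i * y).
  move=> i; have [iF|iF] := boolP (i \in F); last by exists 0.
  by have [y h1 h2] := facet_trace_divide iF; exists y.
have gW i y : i \in F -> onface F y -> dot (g i) (ev_mx y tau *m n) = ev y (lam i * p i).
  move=> iF yF; have [_ h] := hp i iF; have /eqP := h y yF.
  by rewrite evB subr_eq0 ev_bil => /eqP.
have gN i y : i \notin F -> onface F y -> dot (g i) (ev_mx y tau *m n) = 0.
  move=> iF yF; rewrite -ev_bil; apply: (hnn _ _ _ yF); first by rewrite Fd ltnW /=.
    exact: normal_grad.
  exact: facet_normal.
have sum0 y : onface F y -> \sum_(i in F) ev y (lam i * p i) = 0.
  move=> yF; rewrite -(eq_bigr _ (fun i iF => gW i y iF yF)).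
  have := bary_gradients_sum hg => /(congr1 (fun w => dot w (ev_mx y tau *m n))).
  rewrite dot_suml dotC dot0r (bigID (mem F)) /= [X in _ + X]big1 ?addr0 // => i iF.
  exact: gN.
pose v0 := v (idx F 0).
have WE y : onface F y ->
    ev_mx y tau *m n = \sum_(i in F) ev y (lam i * p i) *: (v i - v0).
  move=> yF; under eq_bigr do rewrite scalerBr.
  rewrite sumrB -scaler_suml sum0 // scale0r subr0 -[LHS](bary_gradients_expand hg).
  rewrite (bigID (mem F)) /= [X in _ + X]big1 ?addr0 => [|i iF].
    by apply: eq_bigr => i iF; rewrite gW.
  by rewrite gN ?scale0r.
(* On [F] this is the pairing of tau n with the tangential field Q. Writing it through the cofactors
   p_i makes it a polynomial of the form that [fint_divergence] handles. *)
pose T (Q : 'cV[mpoly (d - 1) R]_(d - 1)) := \sum_(i in F) (lam i * p i) *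
  \sum_a dot (v i - v0) (col a t) *: pull (Q a 0).
have evT Q y : onface F y ->
    ev y (T Q) = dot (ev_mx y tau *m n) (t *m ev_mx (face_coord o t y) Q).
  move=> yF; rewrite WE // ev_sum dot_suml; apply: eq_bigr => i iF.
  rewrite evM dotZl; congr (_ * _); rewrite ev_sum mul_col_sum dot_sumr.
  by apply: eq_bigr => a _; rewrite evZ ev_pull dotZr mxE mulrC.
have TD Q Q' : T (Q + Q') = T Q + T Q'.
  rewrite /T -big_split; apply: eq_bigr => i _ /=; rewrite -mulrDr -big_split /=.
  by congr (_ * _); apply: eq_bigr => a _; rewrite /= mxE /pull rmorphD scalerDr.
have TND Q : ND (d - 1) (k - 2) Q -> fint v F (T Q) = 0.
  move=> hQ; apply: (face_int_eq0 hg F0 _ (tangential_dofs hQ)) => y yF.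
  rewrite evT // [RHS]/dot [LHS]/dot; congr (_ _ 0).
  move: (ev_mx y tau *m n) (ev_mx _ Q) => W Y.
  have nt : n^T *m t = 0.
    by apply: trmx_inj; rewrite trmx_mul trmxK trmx0 (frame_tangent_normal hf).
  rewrite trmx_mul linearB /= trmx1 trmx_mul trmxK mulmxBr mulmx1 mulmxBl.
  by rewrite -!mulmxA (mulmxA n^T t) nt mul0mx !mulmx0 subr0.
have Tgrad P : T (pgrad P) = \sum_(i in F) lam i * p i * dir_deriv (v i - v0) (pull P).
  apply: eq_bigr => i _; rewrite dir_deriv_pull; congr (_ * _).
  by apply: eq_bigr => a _; rewrite mxE.
pose D := \sum_(i in F) dir_deriv (v i - v0) (lam i * p i).
have Tdiv P : fint v F (T (pgrad P)) = - fint v F (D * pull P).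
  apply/eqP; rewrite -addr_eq0 -fintD Tgrad /D mulr_suml -big_split /=; apply/eqP.
  rewrite -[RHS](fint_divergence hg F0 (q := fun i => p i * pull P)).
    congr fint; apply: eq_bigr => i _; rewrite [in RHS]mulrA [RHS]dir_derivM.
    by rewrite addrC.
  move=> y yF; under eq_bigr do rewrite mulrA.
  by rewrite -mulr_suml evM ev_sum sum0 ?mul0r.
(* [D] is the surface divergence of tau n. It has degree at most k-1, so its surface gradient lies
   in P_{k-2}, hence in ND_{k-2}, and can serve as test field. *)
have D0 : vanish F D.
  apply: (fint_prod_sqr_eq0 hg F0 (finset.sub0set F)); rewrite big_set0 mul1r.
  have DN : (msz D <= k)%N.
    apply: msz_sum => i iF; apply: msz_dir_deriv; rewrite -add1n.
    by apply: mszM; [exact: msz_lam|case: (hp i iF)].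
  pose P := aff o t D.
  have : fint v F (T (pgrad P)) = 0.
    apply: TND; exists (pgrad P), 0; split.
    - move=> a b; rewrite mxE; apply: msz_deriv; apply: msz_aff.
      by have -> : ((k - 2).+2 = k)%N by lia.
    - by split=> [a b|]; rewrite ?mxE ?trmx0 ?oppr0 //; exact: HH0.
    - by rewrite mul0mx addr0.
  rewrite Tdiv => /eqP; rewrite oppr_eq0 => /eqP <-; apply: (eq_fint hg F0) => y yF.
  by rewrite expr2 !evM ev_pull (ev_face_coord hg F0 hf).
have Tgrad0 P : fint v F (T (pgrad P)) = 0.
  by rewrite Tdiv (fint_vanish hg F0) ?oppr0 // => y yF; rewrite evM D0 // mul0r.
have p0 i : i \in F -> vanish F (p i).
  move=> iF; have [pN _] := hp i iF.
  apply: (fint_prod_sqr_eq0 hg F0 (S := [set i]%SET)); first by rewrite finset.sub1set.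
  rewrite big_set1.
  (* The tangential part of p_i g_i, of degree k-1. It exceeds ND_{k-2} only by a gradient, which no
     longer contributes because [D] vanishes; the pairing with tau n is lambda_i p_i^2. *)
  pose Z : 'cV[mpoly (d - 1) R]_(d - 1) := \col_a (dot (g i) (col a t) *: aff o t (p i)).
  have [|P [Q [hQ ZE]]] := @grad_ND_decomposition _ (d - 1) (k - 2) Z.
    move=> a b; rewrite mxE; apply: mszZ; apply: msz_aff.
    by have -> : ((k - 2).+2 = k)%N by lia.
  have : fint v F (T Z) = 0 by rewrite ZE TD fintD Tgrad0 TND // addr0.
  move=> <-; apply: (eq_fint hg F0) => y yF; rewrite evT //.
  have -> : ev_mx (face_coord o t y) Z = ev y (p i) *: (t^T *m g i).
    apply/colP => a; rewrite !mxE evZ (ev_face_coord hg F0 hf) // mulrC; congr (_ * _).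
    by rewrite dotC dotE; apply: eq_bigr => j _; rewrite !mxE.
  rewrite -scalemxAr dotZr mulmxA.
  have -> : dot (ev_mx y tau *m n) (t *m t^T *m g i) = dot (g i) (ev_mx y tau *m n).
    have : ((ev_mx y tau *m n)^T <= tangent v F)%MS.
      by apply/(tangentP hg F0) => j jF; apply: gN.
    rewrite -(eqmxP (frame_tangent_span hf)) => /submxP[E hE].
    rewrite [RHS]dotC /dot hE !mulmxA -(mulmxA E).
    by rewrite (frame_tangent_orthonormal hf) mulmx1.
  by rewrite gW // expr2 !evM; ring.
move=> xF; rewrite WE // big1 // => i iF.
by rewrite evM p0 // mulr0 scale0r.
Qed.
End FacetTraces.

(** * The divergence of the enrichment and the normal component of div tau *)

Section Divergence.
Variables (R : realType) (d : nat).

Lemma div_mxD (A B : 'M[mpoly d R]_d) : div_mx (A + B) = div_mx A + div_mx B.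
Proof.
apply/colP => i; rewrite !mxE -big_split; apply: eq_bigr => j _.
by rewrite mxE mderivD.
Qed.

(** Differentiating q contributes k-1 by Euler's identity, and differentiating x x^T contributes
    d+1. The result is a multiple of q x, whose normal component on a facet is again of degree
    k-1. *)
Lemma div_rank1 k (q : mpoly d R) : HH d (k - 1) q -> (0 < k)%N ->
  div_mx (q *: (xvec d *m (xvec d)^T)) = \col_i ((k + d)%:R *: (q * \X_i)).
Proof.
move=> hq k0; apply/colP => i; rewrite !mxE.
have E j : mderiv j ((q *: (xvec d *m (xvec d)^T)) i j) =
    \X_i * (\X_j * mderiv j q) + (i == j)%:R * q * \X_j + q * \X_i.
  rewrite !mxE big_ord_recl big_ord0 !mxE addr0 !mderivM !mderivXU eqxx /= mulr1n; ring.
under eq_bigr do rewrite E.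
rewrite !big_split /= -mulr_sumr -/(euler q) (euler_HH hq).
rewrite (bigD1 i) //= eqxx mul1r big1 => [|j ji]; last first.
  by rewrite eq_sym (negbTE ji) !mul0r.
rewrite addr0 sumr_const card_ord -scalerAr (mulrC (\X_i)).
rewrite -[_ *+ d]scaler_nat -{2}[q * _]scale1r -!scalerDl; congr (_ *: _).
by rewrite -{2}(subnK k0) natrD natrD; ring.
Qed.

Lemma msz_div (tau : 'M[mpoly d R]_d) N : (forall i j, msz (tau i j) <= N.+1)%N ->
  (forall i, msz (div_mx tau i 0%R) <= N)%N.
Proof. by move=> h i; rewrite mxE; apply: msz_sum => j _; apply: msz_deriv. Qed.
End Divergence.

Section FacetDivergence.
Variables (R : realType) (d : nat) (v g : 'I_d.+1 -> 'cV[R]_d).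
Hypothesis hg : bary_gradients v g.
Local Notation vanish := (vanish v g).
Local Notation onface := (onface v g).
Variables (F : {set 'I_d.+1}) (o : 'cV[R]_d) (t : 'M[R]_(d, d - 1)) (n : 'cV[R]_d).
Hypotheses (hd : (2 <= d)%N) (Fd : #|F| = d) (hf : face_frame v F o t n).
Variables (k : nat) (tau sigma : 'M[mpoly d R]_d) (q : mpoly d R).
Hypotheses (hsigma : PS d k sigma) (hq : HH d (k - 1) q) (hk : (2 <= k)%N).
Hypothesis tauE : tau = sigma + q *: (xvec d *m (xvec d)^T).
Hypothesis trace0 : forall x, onface F x -> ev_mx x tau *m n = 0.
Hypothesis div_dofs : forall p, PP (d - 1) (k - 1) p ->
        face_int v F (fun x =>
          (dot n (ev_mx x (div_mx tau))
           + ev x (div_surf t (tau *m cst_mx d n)))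
          * ev (face_coord o t x) p) = 0.

(** Since tau n vanishes on [F], so do its tangential derivatives, and the surface divergence drops
    out of the degree of freedom. The polynomial [h] has degree k-1, agrees with n.div tau on [F],
    and is tested against itself. *)
Lemma facet_div_vanish : vanish F (pdot n (div_mx tau)).
Proof.
have F0 : (0 < #|F|)%N by rewrite Fd ltnW.
have [j jF] : exists j, j \in F by apply/card_gt0P.
have k0 : (0 < k)%N by exact: ltnW.
pose h := pdot n (div_mx sigma) + ((k + d)%:R * dot n (v j)) *: q.
have hE x : onface F x -> ev x (pdot n (div_mx tau)) = ev x h.
  move=> xF; rewrite tauE div_mxD (div_rank1 hq k0) evD evZ !ev_pdot ev_mxD dotDr.
  congr (_ + _); rewrite -[dot n (v j)]addr0.
  rewrite -(onface_sub hg hd Fd hf xF (onface_vertex hg jF)) dotBr addrC subrK.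
  rewrite !dotE mulr_sumr mulr_suml; apply: eq_bigr => i _.
  by rewrite !mxE evZ evM evX; ring.
have hN : (msz h <= k)%N.
  apply: mszD; last by apply/mszZ/(msz_q hq k0).
  by apply/msz_pdot/msz_div => i l; apply: hsigma.1.
have surf0 x : onface F x -> ev x (div_surf t (tau *m cst_mx d n)) = 0.
  move=> xF; rewrite /div_surf ev_sum big1 // => i _; rewrite ev_sum big1 // => a _.
  rewrite evZ (_ : ev x _ = 0) ?mulr0 //; apply: (vanish_deriv hg F0 _ _ xF).
    by move=> l lF; apply: (frame_tangent_col hg F0 hf).
  move=> y yF; have := trace0 yF => /(congr1 (fun B : 'cV_d => B a 0)).
  by rewrite [RHS]mxE -{1}(ev_cst_mx y n) -ev_mxM mxE.
suff h0 : vanish F h by move=> x xF; rewrite hE // h0.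
apply: (fint_prod_sqr_eq0 hg F0 (finset.sub0set F)); rewrite big_set0 mul1r.
apply: (face_int_eq0 hg F0 _ (div_dofs (p := aff o t h) _)) => [x xF|].
  by rewrite surf0 // addr0 -ev_pdot hE // (ev_face_coord hg F0 hf) // expr2 evM.
have e : ((k - 1).+1 = k)%N by lia.
by rewrite /PP /= e; apply: msz_aff.
Qed.
End FacetDivergence.

(** * Vanishing in the interior of K *)

Section Interior.
Variables (R : realType) (d : nat) (v g : 'I_d.+1 -> 'cV[R]_d).
Hypothesis hg : bary_gradients v g.
Local Notation vanish := (vanish v g).
Local Notation onface := (onface v g).
Local Notation lam := (lam v g).
Local Notation K := [set: 'I_d.+1]%SET.
Local Notation facet i := (K :\ i)%SET.

Lemma cardK : #|K| = d.+1. Proof. by rewrite cardsT card_ord. Qed.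

Lemma onfaceK x : onface K x. Proof. by move=> i; rewrite inE. Qed.

Let K0 : (0 < #|K|)%N. Proof. by rewrite cardK. Qed.

Lemma vanishK p : vanish K p -> p = 0.
Proof. by move=> h; apply: ev_inj => x; rewrite h ?ev0 //; exact: onfaceK. Qed.

Lemma grad_vertex_tensor a b : \sum_i g i a 0 * v i b 0 = (a == b)%:R.
Proof.
have := bary_gradients_expand hg (delta_mx a 0) => /(congr1 (fun w : 'cV_d => w b 0)).
rewrite [RHS]mxE andbT eq_sym => <-; rewrite summxE; apply: eq_bigr => i _.
rewrite mxE dotE (bigD1 a) //= mxE !eqxx mulr1 big1 ?addr0 // => c ca.
by rewrite mxE (negbTE ca) mulr0.
Qed.

Lemma grad_eq0 (w : 'cV[R]_d) : (forall i, dot (g i) w = 0) -> w = 0.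
Proof.
by move=> h; rewrite -(bary_gradients_expand hg w) big1 // => i _; rewrite h scale0r.
Qed.

Hypothesis hd : (0 < d)%N.

Lemma facet_divide i p : vanish (facet i) p ->
  exists2 r, (msz r <= (msz p).-1)%N & p = lam i * r.
Proof.
move=> hp; have K1 : (1 < #|K|)%N by rewrite cardK ltnS.
have [r rN hr] := vanish_divide hg (finset.in_setT i) K1 hp (leqnn _).
by exists r => //; apply/eqP; rewrite -subr_eq0; apply/eqP/vanishK.
Qed.

(** Divergence theorem on K for fields without normal component on the boundary: each g_i.w is then
    divisible by lambda_i, and w is the combination of the v_i with these coefficients. *)
Lemma fint_div (w : 'cV[mpoly d R]_d) : (forall i, vanish (facet i) (pdot (g i) w)) ->
  fint v K (\sum_a mderiv a (w a 0)) = 0.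
Proof.
move=> hw; have /choice[p hp] : forall i, exists r, pdot (g i) w = lam i * r.
  by move=> i; have [r _ ->] := facet_divide (hw i); exists r.
have sg b : \sum_i g i b 0 = 0.
  by rewrite -summxE (bary_gradients_sum hg) mxE.
rewrite -[RHS](fint_divergence hg K0 (q := p)); last first.
  move=> x _; rewrite ev_sum.
  under eq_bigr do rewrite -hp ev_pdot.
  rewrite big_mkcond /=; under eq_bigr do rewrite finset.in_setT.
  by rewrite -dot_suml (bary_gradients_sum hg) dotC dot0r.
congr fint; rewrite [RHS]big_mkcond /=.
set v0 := v _.
(* The sum over i of g_i (v_i - v_0)^T is the identity matrix, since the g_i sum to zero; only the
   terms a = b survive. *)
transitivity (\sum_i \sum_b \sum_a ((v i - v0) b 0 * g i a 0) *: mderiv b (w a 0)); last first.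
  apply: eq_bigr => i _; rewrite finset.in_setT -hp; apply: eq_bigr => b _.
  by rewrite /pdot mderiv_sum scaler_sumr; apply: eq_bigr => a _; rewrite mderivZ scalerA.
rewrite exchange_big; apply: eq_bigr => b _ /=; rewrite exchange_big /=.
rewrite [RHS](bigD1 b) //= [X in _ = _ + X]big1 ?addr0 => [|a ab]; rewrite -scaler_suml.
  under eq_bigr do rewrite !mxE mulrBl.
  rewrite sumrB -mulr_sumr sg mulr0 subr0.
  under eq_bigr do rewrite mulrC.
  by rewrite grad_vertex_tensor eqxx scale1r.
under eq_bigr do rewrite !mxE mulrBl.
rewrite sumrB -mulr_sumr sg mulr0 subr0.
under eq_bigr do rewrite mulrC.
by rewrite grad_vertex_tensor (negbTE ab) scale0r.
Qed.

Variables (k : nat) (tau sigma : 'M[mpoly d R]_d) (q : mpoly d R).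
Hypotheses (hsigma : PS d k sigma) (hq : HH d (k - 1) q) (hk : (3 <= k)%N).
Hypothesis tauE : tau = sigma + q *: (xvec d *m (xvec d)^T).
Hypothesis trace0 : forall i x, onface (facet i) x -> ev_mx x tau *m g i = 0.
Hypothesis div_trace0 : forall i, vanish (facet i) (pdot (g i) (div_mx tau)).
Hypothesis def_dofs : forall q, Pmx d (k - 2) d 1 q ->
        face_int v [set: 'I_d.+1]%SET (fun x =>
          mxdot (ev_mx x tau) (ev_mx x (sym_grad q))) = 0.
Hypothesis ker_dofs : forall q, (ker_x d `&` PS d (k - 2)) q ->
        face_int v [set: 'I_d.+1]%SET (fun x =>
          mxdot (ev_mx x tau) (ev_mx x q)) = 0.

Definition pmxdot (A B : 'M[mpoly d R]_d) := \sum_i \sum_j A i j * B i j.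

Lemma ev_pmxdot x A B : ev x (pmxdot A B) = mxdot (ev_mx x A) (ev_mx x B).
Proof.
rewrite ev_sum; apply: eq_bigr => i _; rewrite ev_sum; apply: eq_bigr => j _.
by rewrite evM !mxE.
Qed.

Lemma tau_sym : tau^T = tau.
Proof.
by rewrite tauE linearD /= linearZ /= trmx_mul trmxK hsigma.2.
Qed.

Lemma ev_tau_sym x : (ev_mx x tau)^T = ev_mx x tau.
Proof.
apply/matrixP => i j; rewrite !mxE.
by have /matrixP/(_ i j) := tau_sym; rewrite mxE => ->.
Qed.

(** The divergence theorem applied to tau w, whose normal component vanishes on the boundary because
    tau is symmetric with zero trace tau n. *)
Lemma fint_def (w : 'cV[mpoly d R]_d) :
  fint v K (pmxdot tau (sym_grad w)) = - fint v K (\sum_i div_mx tau i 0 * w i 0).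
Proof.
apply/eqP; rewrite -addr_eq0 -fintD; apply/eqP.
rewrite -[RHS](fint_div (w := tau *m w)); last first.
  move=> i x xi; rewrite ev_pdot ev_mxM /dot mulmxA.
  have := congr1 trmx (trace0 xi); rewrite trmx_mul trmx0 => e.
  by rewrite -ev_tau_sym e mul0mx mxE.
congr fint.
have -> : pmxdot tau (sym_grad w) = \sum_a \sum_b tau a b * mderiv a (w b 0).
  pose S := \sum_a \sum_b tau a b * mderiv a (w b 0).
  have S2 : S = \sum_a \sum_b tau a b * mderiv b (w a 0).
    rewrite /S exchange_big; apply: eq_bigr => a _; apply: eq_bigr => b _.
    by have /matrixP/(_ a b) := tau_sym; rewrite mxE => ->.
  rewrite -/S -[RHS]half_double {2}S2 -big_split scaler_sumr; apply: eq_bigr => a _.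
  rewrite -big_split scaler_sumr; apply: eq_bigr => b _ /=.
  by rewrite mxE -mulrDr -scalerAr addrC.
under [RHS]eq_bigr => a _ do rewrite mxE mderiv_sum.
have E a : \sum_i mderiv a (tau a i * w i 0) =
    \sum_i tau a i * mderiv a (w i 0) + \sum_i mderiv a (tau a i) * w i 0.
  by rewrite -big_split; apply: eq_bigr => i _; rewrite /= mderivM addrC.
under [RHS]eq_bigr do rewrite E.
rewrite [RHS]big_split /=; congr (_ + _); rewrite [RHS]exchange_big; apply: eq_bigr => i _.
rewrite mxE mulr_suml; apply: eq_bigr => j _ /=.
by have /matrixP/(_ i j) := tau_sym; rewrite mxE => ->.
Qed.

Lemma div_orthogonal (w : 'cV[mpoly d R]_d) : Pmx d (k - 2) d 1 w ->
  fint v K (\sum_i div_mx tau i 0 * w i 0) = 0.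
Proof.
move=> hw; apply: oppr_inj; rewrite -fint_def oppr0.
apply: (face_int_eq0 hg K0 _ (def_dofs hw)) => x _.
by rewrite ev_pmxdot.
Qed.

(** The field p div tau, with p = div div tau, has no normal component on the boundary, so p^2 has
    the same integral as -div tau.grad p. Even with the enrichment p has degree at most k-1, and
    grad p is an admissible test field. *)
Lemma div_div_eq0 : \sum_a mderiv a (div_mx tau a 0) = 0.
Proof.
set p := \sum_a _.
have pN : (msz p <= k)%N.
  apply: msz_sum => a _; apply: msz_deriv; apply: msz_div => i j.
  rewrite tauE mxE; apply: mszD; first exact/mszS/hsigma.1.
  rewrite mxE mxE big_ord_recl big_ord0 addr0 !mxE -addn2 -[(k + 2)%N]addnC.
  rewrite mulrC; apply: mszM; last exact: msz_q hq (leq_trans _ hk).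
  by rewrite -[3%N]/(1 + 2)%N; apply: mszM; rewrite mszXU.
have K2 := fint_div (w := \col_a (div_mx tau a 0 * p)).
have := @div_orthogonal (pgrad p); rewrite /pgrad => h.
apply/vanishK/(fint_prod_sqr_eq0 hg K0 (finset.sub0set K)).
rewrite big_set0 mul1r expr2.
have : fint v K (p * p + \sum_i div_mx tau i 0 * mderiv i p) = 0.
  rewrite -[RHS]K2 => [|i x xi]; last first.
    have := div_trace0 xi; rewrite !ev_pdot !dotE => e.
    rewrite (eq_bigr (fun a => g i a 0 * ev_mx x (div_mx tau) a 0 * ev x p)).
      by rewrite -mulr_suml e mul0r.
    by move=> a _; rewrite [in LHS]mxE [in LHS]mxE evM [in RHS]mxE mulrA.
  congr fint; rewrite /p mulr_suml -big_split; apply: eq_bigr => a _ /=.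
  by rewrite [in RHS]mxE mderivM.
rewrite fintD (_ : fint v K (\sum_i _) = 0) ?addr0 //.
rewrite -[RHS]h.
  by congr fint; apply: eq_bigr => i _; congr (_ * _); rewrite mxE.
move=> i j; rewrite mxE; apply: msz_deriv.
by have -> : ((k - 2).+2 = k)%N by lia.
Qed.

(** div div(q x x^T) = (k+d)(k-1+d) q is homogeneous of degree k-1, a degree that div div sigma does
    not reach. *)
Lemma enrichment_eq0 : q = 0.
Proof.
have k0 : (0 < k)%N by exact: leq_trans hk.
have := div_div_eq0; rewrite tauE div_mxD (div_rank1 hq k0).
under eq_bigr do rewrite mxE mderivD.
rewrite big_split /= => /(congr1 (hpart (k - 1))).
rewrite hpartD (hpart_msz (p := \sum_a mderiv a (div_mx sigma a 0))) => [|]; last first.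
  apply: msz_sum => a _; apply: msz_deriv; apply: msz_div => i j.
  have -> : ((k - 1).+2 = k.+1)%N by lia.
  exact: hsigma.1.
rewrite add0r.
have -> : \sum_(a < d) mderiv a ((\col_i ((k + d)%:R *: (q * \X_i))) a 0) =
    ((k + d)%:R * (k - 1 + d)%:R) *: q.
  transitivity ((k + d)%:R *: (euler q + q *+ d)).
    have -> : q *+ d = \sum_(a < d) q by rewrite sumr_const card_ord.
    rewrite /euler -big_split scaler_sumr; apply: eq_bigr => a _ /=.
    by rewrite mxE mderivZ mderivM mderivXU eqxx mulr1 mulrC.
  by rewrite (euler_HH hq) -[q *+ d]scaler_nat -scalerDl -natrD scalerA.
rewrite hpartZ (hpart_id hq) (hpart_msz (p := 0)) ?mmeasure0 // => /eqP.
rewrite scaler_eq0 mulf_eq0 !pnatr_eq0 !addn_eq0 !eqn0Ngt k0 /= (_ : (0 < k - 1)%N) => [/eqP//|].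
by lia.
Qed.

(** Possible only once q = 0: now div tau has degree k-1, so the cofactor of lambda_i has degree
    k-2, as the test space requires. *)
Lemma div_eq0 : div_mx tau = 0.
Proof.
have q0 := enrichment_eq0.
have tN i j : (msz (tau i j) <= k.+1)%N.
  by rewrite tauE q0 scale0r addr0; apply: hsigma.1.
suff h i : pdot (g i) (div_mx tau) = 0.
  apply/colP => a; rewrite [RHS]mxE; apply: ev_inj => x; rewrite ev0.
  have : ev_mx x (div_mx tau) = 0.
    by apply: grad_eq0 => i; rewrite -ev_pdot h ev0.
  by move/(congr1 (fun w : 'cV_d => w a 0)); rewrite [LHS]mxE [RHS]mxE.
have [b bN bE] := facet_divide (@div_trace0 i).
suff b0 : b = 0 by rewrite bE b0 mulr0.
have hN : (msz (pdot (g i) (div_mx tau)) <= k)%N by apply/msz_pdot/msz_div.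
apply/vanishK/(fint_prod_sqr_eq0 hg K0 (S := [set i]%SET)); first exact: finset.subsetT.
rewrite big_set1 -[RHS](@div_orthogonal (\col_a (g i a 0 *: b))).
  congr fint; rewrite expr2 mulrA -bE mulr_suml; apply: eq_bigr => a _.
  rewrite -scalerAl scalerAr; congr (_ * _); by rewrite mxE.
move=> a c; rewrite mxE; apply/mszZ/(leq_trans bN).
by move: hN hk; lia.
Qed.

Lemma orthogonal_PS (A : 'M[mpoly d R]_d) : PS d (k - 2) A ->
  fint v K (pmxdot tau A) = 0.
Proof.
case/PS_decomposition => w [B [hw hB1 hB2 ->]].
have -> : pmxdot tau (sym_grad w + B) = pmxdot tau (sym_grad w) + pmxdot tau B.
  rewrite /pmxdot -big_split; apply: eq_bigr => i _ /=; rewrite -big_split.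
  by apply: eq_bigr => j _; rewrite mxE mulrDr.
rewrite fintD fint_def div_eq0 [X in - fint _ _ X]big1 => [|i _]; last by rewrite mxE mul0r.
rewrite fint0 oppr0 add0r.
by apply: (face_int_eq0 hg K0 _ (ker_dofs (conj hB1 hB2))) => x _; rewrite ev_pmxdot.
Qed.

Lemma interior_vanish : tau = 0.
Proof.
have q0 := enrichment_eq0.
have tN i j : (msz (tau i j) <= k.+1)%N.
  by rewrite tauE q0 scale0r addr0; apply: hsigma.1.
have d1 : (1 < #|K|)%N by rewrite cardK ltnS.
have off i j : i != j -> bil (g i) tau (g j) = 0.
  move=> ij; pose S := [set i; j]%SET.
  have hS l : l \in S -> vanish (facet l) (bil (g i) tau (g j)).
    rewrite !inE => /orP[]/eqP -> x xl; rewrite ev_bil; last by rewrite trace0 ?dot0r.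
    by rewrite /dot mulmxA -ev_tau_sym -trmx_mul trace0 // trmx0 mul0mx mxE.
  have [p pN hp] := vanish_divide_prod hg (finset.subsetT S) d1 hS (msz_bil (g i) (g j) tN).
  have bE : bil (g i) tau (g j) = (\prod_(l in S) lam l) * p.
    by apply/eqP; rewrite -subr_eq0; apply/eqP/vanishK.
  suff p0 : p = 0 by rewrite bE p0 mulr0.
  apply/vanishK/(fint_prod_sqr_eq0 hg K0 (finset.subsetT S)).
  rewrite expr2 mulrA -bE.
  (* Symmetrized in order to lie in the test space; as tau is symmetric, the pairing is the same as
     with p g_i g_j^T. *)
  pose A : 'M[mpoly d R]_d :=
    \matrix_(a, b) ((2^-1 * (g i a 0 * g j b 0 + g i b 0 * g j a 0)) *: p).
  rewrite -[RHS](@orthogonal_PS A); last first.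
    split=> [a b|]; last by apply/matrixP => a b; rewrite !mxE addrC.
    rewrite mxE; apply/mszZ/(leq_trans pN).
    by rewrite cards2 ij; lia.
  congr fint.
  pose B (a b : 'I_d) := (g i a 0 * g j b 0) *: (tau a b * p).
  have BE : bil (g i) tau (g j) * p = \sum_a \sum_b B a b.
    rewrite /bil /pdot mulr_suml; apply: eq_bigr => a _.
    rewrite mxE scaler_sumr mulr_suml; apply: eq_bigr => b _.
    by rewrite mxE (mulrC (tau a b)) mul_mpolyC /B -!scalerAl scalerA.
  have BE2 : bil (g i) tau (g j) * p = \sum_a \sum_b B b a by rewrite BE exchange_big.
  rewrite -[LHS]half_double {1}BE BE2 -big_split scaler_sumr.
  apply: eq_bigr => a _; rewrite -big_split scaler_sumr; apply: eq_bigr => b _ /=.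
  rewrite mxE /B; have /matrixP/(_ a b) := tau_sym; rewrite mxE => ->.
  by rewrite -scalerDl scalerA -scalerAr.
(* The diagonal is not reached by division, since only one coordinate is available there; but g_j is
   minus the sum of the other gradients, so diagonal entries are sums of off-diagonal ones. *)
have all0 i j : bil (g i) tau (g j) = 0.
  have [->|ij] := eqVneq i j; last exact: off.
  apply: ev_inj => x; rewrite ev0 ev_bil.
  have := bary_gradients_sum hg; rewrite (bigD1 j) //= => /eqP; rewrite addr_eq0 => /eqP gj.
  rewrite {1}gj -scaleN1r dotZl dot_suml big1 ?mulr0 // => l lj.
  by rewrite -ev_bil off ?ev0.
apply/matrixP => a b; rewrite [RHS]mxE; apply: ev_inj => x; rewrite ev0.
have tg j : ev_mx x tau *m g j = 0.
  by apply: grad_eq0 => i; rewrite -ev_bil all0 ev0.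
have : (ev_mx x tau)^T *m delta_mx a 0 = 0 :> 'cV_d.
  by apply: grad_eq0 => j; rewrite /dot mulmxA -trmx_mul tg trmx0 mul0mx mxE.
move/(congr1 (fun w : 'cV_d => w b 0)); rewrite [RHS]mxE => <-.
rewrite mxE (bigD1 a) //= !mxE !eqxx mulr1 big1 ?addr0 // => c ca.
by rewrite !mxE (negbTE ca) mulr0.
Qed.
End Interior.

Section Unisolvence.
Variables (R : realType) (d k : nat) (v : 'I_d.+1 -> 'cV[R]_d)
    (o : nat -> {set 'I_d.+1} -> 'cV[R]_d)
    (t : forall r : nat, {set 'I_d.+1} -> 'M[R]_(d, d - r))
    (n : forall r : nat, {set 'I_d.+1} -> 'M[R]_(d, r)).
Hypotheses (hd : (2 <= d)%N) (hk : (maxn d 3 <= k)%N) (hK : nondegenerate_simplex v).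
Hypothesis hframe : forall r F, (1 <= r <= d - 1)%N -> F \in faces d r ->
       face_frame v F (o r F) (t r F) (n r F).

Lemma dofs_determine (tau : 'M[mpoly d R]_d) : Vminus d k tau ->
     (forall delta : 'I_d.+1, ev_mx (v delta) tau = 0) ->
     (forall r F, (1 <= r <= d - 1)%N -> F \in faces d r ->
        forall (i j : 'I_r) q, PP (d - r) (k + r - d.+1) q ->
        face_int v F (fun x =>
          dot (col i (n r F)) (ev_mx x tau *m col j (n r F))
          * ev (face_coord (o r F) (t r F) x) q) = 0) ->
     (forall F, F \in faces d 1 ->
        forall q, ND (d - 1) (k - 2) q ->
        face_int v F (fun x =>
          dot ((1%:M - n 1%N F *m (n 1%N F)^T) *m (ev_mx x tau *m n 1%N F))
              (t 1%N F *m ev_mx (face_coord (o 1%N F) (t 1%N F) x) q)) = 0) ->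
     (forall F, F \in faces d 1 ->
        forall p, PP (d - 1) (k - 1) p ->
        face_int v F (fun x =>
          (dot (n 1%N F) (ev_mx x (div_mx tau))
           + ev x (div_surf (t 1%N F) (tau *m cst_mx d (n 1%N F))))
          * ev (face_coord (o 1%N F) (t 1%N F) x) p) = 0) ->
     (forall q, Pmx d (k - 2) d 1 q ->
        face_int v [set: 'I_d.+1]%SET (fun x =>
          mxdot (ev_mx x tau) (ev_mx x (sym_grad q))) = 0) ->
     (forall q, (ker_x d `&` PS d (k - 2)) q ->
        face_int v [set: 'I_d.+1]%SET (fun x =>
          mxdot (ev_mx x tau) (ev_mx x q)) = 0) ->
     tau = 0.
Proof.
move=> [sigma [q [hsigma hq tauE]]] hvert hnorm htan hdiv hdef hker.
have [g hg] := bary_gradients_exist hK.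
have [dk k3] : (d <= k)%N /\ (3 <= k)%N by apply/andP; rewrite -geq_max.
have k2 : (2 <= k)%N by exact: ltnW.
have k0 : (0 < k)%N by exact: ltnW.
have hnn (G : {set 'I_d.+1}) a b : (0 < #|G| <= d)%N ->
    normal_to v G a -> normal_to v G b -> vanish v g G (bil a tau b).
  exact: (normal_normal_vanish hg hsigma hq k0 tauE hd dk hframe hvert hnorm).
pose F i := ([set: 'I_d.+1] :\ i)%SET.
have Fd i : #|F i| = d by have := cardsD1 i [set: 'I_d.+1]%SET; rewrite cardK finset.in_setT add1n => -[].
have F1 i : F i \in faces d 1 by rewrite inE Fd addn1.
have hf i : face_frame v (F i) (o 1 (F i)) (t 1 (F i)) (n 1 (F i)).
  have d1 : (1 <= d - 1)%N by lia.
  exact: (hframe (r := 1) d1 (F1 i)).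
have tr i x : onface v g (F i) x -> ev_mx x tau *m n 1 (F i) = 0.
  exact: (facet_trace_vanish hg hd (Fd i) (hf i) hsigma hq k2 tauE hnn (htan _ (F1 i))).
have dv i : vanish v g (F i) (pdot (n 1 (F i)) (div_mx tau)).
  exact: (facet_div_vanish hg hd (Fd i) (hf i) hsigma hq k2 tauE (tr i) (hdiv _ (F1 i))).
(* The gradient g_i is a multiple of the unit normal of the opposite facet, which carries the facet
   results over to the form needed inside K. *)
have gn i : exists c : 'cV[R]_1, g i = n 1 (F i) *m c.
  by apply: (normal_span (hf i)); apply: normal_grad => //; rewrite !inE eqxx.
apply: (interior_vanish hg (ltnW hd) hsigma hq k3 tauE _ _ hdef hker) => [i x xi|i x xi].
  by have [c ->] := gn i; rewrite mulmxA tr // mul0mx.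
have [c ->] := gn i; rewrite ev_pdot /dot trmx_mul -mulmxA.
have := dv i x xi; rewrite ev_pdot /dot => e.
by rewrite [_ *m ev_mx _ _]mx11_scalar e mul_mx_scalar scale0r mxE.
Qed.
End Unisolvence.

(** * Dimensions *)

Section Dimension.
Variable R : realType.
Implicit Types (L : lmodType R).

Definition lc L m (e : 'I_m -> L) (c : 'rV[R]_m) : L := \sum_i c 0 i *: e i.

Definition has_dim L (W : set L) m := is_dim (@GRing.scale R L) W m.

Lemma lin0 L L' (f : L -> L') : linear f -> f 0 = 0.
Proof. by move=> h; have := h (-1) 0 0; rewrite scaler0 addr0 scaleN1r addNr. Qed.

Lemma linZ L L' (f : L -> L') c x : linear f -> f (c *: x) = c *: f x.
Proof. by move=> h; rewrite -[c *: x in LHS]addr0 h (lin0 h) addr0. Qed.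

Lemma linD L L' (f : L -> L') x y : linear f -> f (x + y) = f x + f y.
Proof. by move=> h; rewrite -{1}[x]scale1r h scale1r. Qed.

Lemma lin_lc L L' (f : L -> L') m (e : 'I_m -> L) c : linear f ->
  f (lc e c) = lc (f \o e) c.
Proof.
move=> h; rewrite /lc (big_morph f (id1 := 0) (op1 := +%R)).
- by apply: eq_bigr => i _; rewrite linZ.
- by move=> x y; rewrite linD.
- exact: lin0.
Qed.

Lemma lc_lin L m (e : 'I_m -> L) a c c' : lc e (a *: c + c') = a *: lc e c + lc e c'.
Proof.
rewrite /lc scaler_sumr -big_split; apply: eq_bigr => i _ /=.
by rewrite !mxE scalerDl scalerA.
Qed.

Lemma lc0 L m (e : 'I_m -> L) : lc e 0 = 0.
Proof. by rewrite /lc big1 // => i _; rewrite mxE scale0r. Qed.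

Lemma lc_mul L m m' (e : 'I_m -> L) (c : 'rV[R]_m') (A : 'M[R]_(m', m)) :
  lc e (c *m A) = lc (fun i => lc e (row i A)) c.
Proof.
rewrite /lc; under [RHS]eq_bigr do rewrite scaler_sumr.
rewrite exchange_big; apply: eq_bigr => j _ /=.
by rewrite mxE scaler_suml; apply: eq_bigr => i _; rewrite mxE scalerA.
Qed.

Lemma lc_delta L m (e : 'I_m -> L) i : lc e (delta_mx 0 i) = e i.
Proof.
rewrite /lc (bigD1 i) //= mxE !eqxx scale1r big1 ?addr0 // => j ji.
by rewrite mxE (negbTE ji) andbF scale0r.
Qed.

Lemma has_dimP L (W : set L) m : has_dim W m <->
  exists e : 'I_m -> L, (forall c, lc e c = 0 -> c = 0) /\
    (forall x, W x <-> exists c, x = lc e c).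
Proof.
split=> [[e [fe ->]]|[e [fe We]]].
  exists e; split=> [c ce|x].
    by apply/rowP => i; rewrite mxE; apply: (fe (fun i => c 0 i)).
  split=> [[c ->]|[c ->]]; last by exists (fun i => c 0 i).
  by exists (\row_i c i); apply: eq_bigr => i _; rewrite mxE.
exists e; split=> [c ce i|].
  have /rowP/(_ i) : \row_i c i = 0.
    by apply: fe; rewrite -[RHS]ce; apply: eq_bigr => j _; rewrite mxE.
  by rewrite !mxE.
apply/seteqP; split=> x /=.
  by move/We => [c ->]; exists (fun i => c 0 i).
move=> [c ->]; apply/We; exists (\row_i c i).
by apply: eq_bigr => i _; rewrite mxE.
Qed.

(** The matrices expressing each basis through the other satisfy A B = 1. *)
Lemma has_dim_le L (W : set L) m m' : has_dim W m -> has_dim W m' -> (m <= m')%N.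
Proof.
move=> /has_dimP[e [fe We]] /has_dimP[e' [fe' We']].
have h i : exists c, e i = lc e' c.
  by apply/We'/We; exists (delta_mx 0 i); rewrite lc_delta.
have h' j : exists c, e' j = lc e c.
  by apply/We/We'; exists (delta_mx 0 j); rewrite lc_delta.
have [a ha] := choice h; have [b hb] := choice h'.
pose A := \matrix_i a i; pose B := \matrix_j b j.
apply: (@mulmx1_min _ _ _ A B); apply/row_matrixP => i; apply/eqP.
rewrite -subr_eq0; apply/eqP/fe; rewrite -scaleN1r addrC lc_lin.
rewrite row1 lc_delta row_mul lc_mul rowK.
have -> : (fun j => lc e (row j B)) = e'.
  by apply/funext => j; rewrite rowK hb.
by rewrite -ha scaleN1r addNr.
Qed.

Lemma has_dim_unique L (W : set L) m m' : has_dim W m -> has_dim W m' -> m = m'.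
Proof. by move=> h h'; apply/eqP; rewrite eqn_leq !(@has_dim_le _ W). Qed.

Lemma fdimE L (W : set L) m : has_dim W m -> fdim (@GRing.scale R L) W = m.
Proof.
move=> h; apply: (@has_dim_unique _ W) => //.
exact: (@xgetPex _ 0%N [set m | is_dim (@GRing.scale R L) W m] (ex_intro _ m h)).
Qed.

Lemma has_dim_fin L (J : finType) (e : J -> L) (W : set L) :
  (forall c : J -> R, \sum_j c j *: e j = 0 -> forall j, c j = 0) ->
  (forall x, W x <-> exists c : J -> R, x = \sum_j c j *: e j) -> has_dim W #|J|.
Proof.
move=> fe We; apply/has_dimP; exists (e \o enum_val).
have lcE (c : 'rV[R]_#|J|) : lc (e \o enum_val) c = \sum_j c 0 (enum_rank j) *: e j.
  rewrite /lc (reindex (@enum_rank J)) /=; last first.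
    by apply: onW_bij; exists enum_val; [exact: enum_rankK|exact: enum_valK].
  by apply: eq_bigr => j _; rewrite enum_rankK.
split=> [c|x].
  rewrite lcE => /fe h; apply/rowP => i; rewrite mxE.
  by rewrite -[i]enum_valK h.
split=> [/We[c ->]|[c ->]].
  exists (\row_i c (enum_val i)); rewrite lcE; apply: eq_bigr => j _.
  by rewrite mxE enum_rankK.
by apply/We; exists (fun j => c 0 (enum_rank j)); rewrite lcE.
Qed.

Lemma has_dim_lc L (W : set L) m : has_dim W m ->
  (W 0) /\ (forall c x y, W x -> W y -> W (c *: x + y)).
Proof.
move=> /has_dimP[e [fe We]]; split.
  by apply/We; exists 0; rewrite lc0.
move=> c x y /We[a ->] /We[b ->]; apply/We; exists (c *: a + b).
by rewrite lc_lin.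
Qed.

Lemma has_dim_inj L L' (f : L -> L') (W : set L) m : linear f ->
  (forall x, W x -> f x = 0 -> x = 0) -> has_dim W m -> has_dim (f @` W) m.
Proof.
move=> lf fi /has_dimP[e [fe We]]; apply/has_dimP; exists (f \o e).
split=> [c|x].
  rewrite -lin_lc // => /fi h; apply/fe/h; apply/We; by exists c.
split=> [[y /We[c ->] <-]|[c ->]].
  by exists c; rewrite lin_lc.
by exists (lc e c); [apply/We; exists c|rewrite lin_lc].
Qed.

(** Finite functions are the common model of the matrix spaces: indexed by all pairs, or by ordered
    pairs in the symmetric case. *)
Lemma has_dim_ffun L (W : set L) m (I : finType) : has_dim W m ->
  has_dim [set g : {ffun I -> L} | forall i, W (g i)] (#|I| * m)%N.
Proof.
move=> hW; have [W0 WD] := has_dim_lc hW.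
have /has_dimP[e [fe We]] := hW.
rewrite -[m in (_ * m)%N](card_ord m) -card_prod.
pose E (ik : I * 'I_m) : {ffun I -> L} := [ffun i => if i == ik.1 then e ik.2 else 0].
have EE c i : (\sum_j c j *: E j) i = \sum_k c (i, k) *: e k.
  rewrite sum_ffunE.
  transitivity (\sum_p (if i == p.1 then c (p.1, p.2) *: e p.2 else 0)).
    apply: eq_bigr => -[i' k] _; rewrite !ffunE /=.
    by case: eqP => // _; rewrite scaler0.
  rewrite -(pair_bigA _ (fun i' k => if i == i' then c (i', k) *: e k else 0)) /=.
  rewrite (bigD1 i) //= eqxx [X in _ + X]big1 ?addr0 // => i' i'i.
  by rewrite big1 // => k _; rewrite eq_sym (negbTE i'i).
apply: (has_dim_fin (e := E)) => [c c0 [i k]|g].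
  have : \sum_k c (i, k) *: e k = 0 by rewrite -EE c0 ffunE.
  move=> h; have /rowP/(_ k) : \row_k c (i, k) = 0.
    by apply: fe; rewrite -[RHS]h; apply: eq_bigr => l _; rewrite mxE.
  by rewrite !mxE.
split=> [/= hg|[c ->] i].
  have /choice[c hc] : forall i, exists c, g i = lc e c by move=> i; apply/We.
  exists (fun ik => c ik.1 0 ik.2); apply/ffunP => i.
  by rewrite EE hc.
apply/We; exists (\row_k c (i, k)); rewrite EE.
by apply: eq_bigr => k _; rewrite mxE.
Qed.

(** The rank is left unspecified: for the interior families it suffices that a dimension exists. *)
Lemma rank_nullity L L' (f : L -> L') (W : set L) (W' : set L') m m' : linear f ->
  has_dim W m -> has_dim W' m' -> (forall x, W x -> W' (f x)) ->
  exists r, [/\ (r <= m)%N, has_dim (f @` W) r & has_dim [set x | W x /\ f x = 0] (m - r)%N].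
Proof.
move=> lf /has_dimP[e [fe We]] /has_dimP[e' [fe' We']] fW.
have /choice[a ha] : forall i, exists c, f (e i) = lc e' c.
  by move=> i; apply/We'/fW/We; exists (delta_mx 0 i); rewrite lc_delta.
pose A := \matrix_i a i.
have fA c : f (lc e c) = lc e' (c *m A).
  rewrite lin_lc // lc_mul; congr lc; apply/funext => i.
  by rewrite rowK -ha.
exists (\rank A); split; first exact: rank_leq_row.
  apply/has_dimP; exists (fun l => lc e' (row l (row_base A))).
  split=> [c|y].
    rewrite -lc_mul => /fe' h; apply: (row_free_inj (row_base_free A)).
    by rewrite h mul0mx.
  split=> [[x /We[c ->] <-]|[c ->]].
    rewrite fA; have : (c *m A <= row_base A)%MS.
      by rewrite (eq_row_base A) submxMl.
    by case/submxP => D ->; exists D; rewrite lc_mul.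
  have : (c *m row_base A <= A)%MS by rewrite -(eq_row_base A) submxMl.
  case/submxP => D hD; exists (lc e D); first by apply/We; exists D.
  by rewrite fA -hD lc_mul.
rewrite -mxrank_ker; apply/has_dimP.
exists (fun l => lc e (row l (row_base (kermx A)))); split=> [c|x].
  rewrite -lc_mul => /fe h; apply: (row_free_inj (row_base_free (kermx A))).
  by rewrite h mul0mx.
split=> [[/We[c ->]]|[c ->]].
  rewrite fA => /fe' cA; have : (c <= row_base (kermx A))%MS.
    by rewrite (eq_row_base _); apply/sub_kermxP.
  by case/submxP => D ->; exists D; rewrite lc_mul.
rewrite -lc_mul; split; first by apply/We; exists (c *m row_base (kermx A)).
rewrite fA (_ : _ *m A = 0) ?lc0 //.
apply/sub_kermxP; apply: submx_trans (submxMl _ _) _.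
by rewrite (eq_row_base _).
Qed.

Lemma has_dim_kernel L L' (f : L -> L') (W : set L) (W' : set L') m m' : linear f ->
  has_dim W m -> has_dim W' m' -> (forall x, W x -> W' (f x)) ->
  (forall y, W' y -> exists2 x, W x & f x = y) ->
  (m' <= m)%N /\ has_dim [set x | W x /\ f x = 0] (m - m')%N.
Proof.
move=> lf hW hW' fW fS; have [r [rm hr hk]] := rank_nullity lf hW hW' fW.
suff -> : m' = r by [].
apply: (has_dim_unique hW'); suff -> : W' = f @` W by [].
by apply/seteqP; split=> [y /fS[x Wx <-]|_ [x Wx <-]]; [exists x|apply: fW].
Qed.

Lemma has_dim_add L (W W' : set L) m m' : has_dim W m -> has_dim W' m' ->
  (forall x, W x -> W' x -> x = 0) ->
  has_dim [set x | exists y z, [/\ W y, W' z & x = y + z]] (m + m')%N.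
Proof.
move=> hW hW' dis; have [_ WD] := has_dim_lc hW; have [W'0 WD'] := has_dim_lc hW'.
have /has_dimP[e [fe We]] := hW; have /has_dimP[e' [fe' We']] := hW'.
apply/has_dimP; exists (fun i => match fintype.split i with inl j => e j | inr j => e' j end).
have lcE c : lc (fun i => match fintype.split i with inl j => e j | inr j => e' j end) c =
    lc e (lsubmx c) + lc e' (rsubmx c).
  rewrite /lc big_split_ord /=; congr (_ + _); apply: eq_bigr => i _.
    by rewrite -{2}[lshift m' i]/(unsplit (inl i)) unsplitK mxE.
  by rewrite -{2}[rshift m i]/(unsplit (inr i)) unsplitK mxE.
split=> [c|x].
  rewrite lcE => /eqP; rewrite addr_eq0 => /eqP h.
  have h0 : lc e (lsubmx c) = 0.
    apply: dis; first by apply/We; exists (lsubmx c).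
    rewrite h -scaleN1r -[_ *: _]addr0; apply: WD' => //.
    by apply/We'; exists (rsubmx c).
  rewrite -[c]hsubmxK (fe _ h0); move: h; rewrite h0 => /eqP.
  by rewrite eq_sym oppr_eq0 => /eqP/fe' ->; rewrite row_mx0.
split=> [[y [z [/We[a ->] /We'[b ->] ->]]]|[c ->]].
  by exists (row_mx a b); rewrite lcE row_mxKl row_mxKr.
rewrite lcE; exists (lc e (lsubmx c)), (lc e' (rsubmx c)); split => //.
  by apply/We; exists (lsubmx c).
by apply/We'; exists (rsubmx c).
Qed.
End Dimension.

(* A copy of the polynomial matrices on which [*:] is the scaling by reals. *)
Definition mxR (R : realType) n a b := 'M[mpoly n R]_(a, b).
HB.instance Definition _ (R : realType) n a b :=
  GRing.Zmodule.copy (mxR R n a b) 'M[mpoly n R]_(a, b).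

Section PolynomialMatrixModule.
Variables (R : realType) (n a b : nat).
Implicit Types (A B : mxR R n a b) (c : R).

Lemma scale_mxE c A i j : scale_mx c A i j = c *: A i j.
Proof. by rewrite mxE mul_mpolyC. Qed.

Lemma scale_mxA c c' A : scale_mx c (scale_mx c' A) = scale_mx (c * c') A.
Proof. by apply/matrixP => i j; rewrite !scale_mxE scalerA. Qed.

Lemma scale_mx1 : left_id 1 (@scale_mx R n a b).
Proof. by move=> A; apply/matrixP => i j; rewrite scale_mxE scale1r. Qed.

Lemma scale_mxDr : right_distributive (@scale_mx R n a b) +%R.
Proof. by move=> c A B; apply/matrixP => i j; rewrite scale_mxE !mxE scalerDr !mul_mpolyC. Qed.

Lemma scale_mxDl A : {morph (@scale_mx R n a b)^~ A : c c' / c + c'}.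
Proof. by move=> c c'; apply/matrixP => i j; rewrite [RHS]mxE !scale_mxE scalerDl. Qed.

HB.instance Definition _ := GRing.Zmodule_isLmodule.Build R (mxR R n a b)
  scale_mxA scale_mx1 scale_mxDr scale_mxDl.
End PolynomialMatrixModule.

(** * Dimensions of the polynomial spaces *)

Section PolynomialDimensions.
Variable R : realType.
Implicit Types n m a : nat.

Lemma has_dim_eq (L : lmodType R) (W W' : set L) m m' :
  (forall x, W x <-> W' x) -> m = m' -> has_dim W m -> has_dim W' m'.
Proof. by move=> h -> ; rewrite (_ : W = W') //; apply/seteqP; split=> x /h. Qed.

Lemma dim_HH n a : (0 < n)%N -> has_dim (@HH R n a) 'C(a + n.-1, a).
Proof.
case: n => // n _; have [f lf [h fK hK]] := @dhomog_vecaxiom n R a.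
apply/has_dimP; exists (fun i => val (h (delta_mx 0 i))).
have lh : linear h.
  move=> c x y; rewrite -[RHS]fK lf !hK //.
have lcE c : lc (fun i => val (h (delta_mx 0 i))) c = val (h c).
  rewrite [c in RHS]row_sum_delta.
  rewrite (big_morph h (id1 := 0) (op1 := +%R)) => [|x y|].
  - rewrite (big_morph val (id1 := 0) (op1 := +%R)) //.
    apply: eq_bigr => i _; have := lh (c 0 i) (delta_mx 0 i) 0.
    have h0 : h 0 = 0 by have := lh (-1) 0 0; rewrite scaler0 addr0 scaleN1r addNr.
    by rewrite !addr0 h0 addr0 => ->.
  - by have := lh 1 x y; rewrite !scale1r.
  - by have := lh (-1) 0 0; rewrite scaler0 addr0 scaleN1r addNr.
split=> [c|p].
  rewrite lcE => c0; rewrite -[c]hK (_ : h c = 0); last exact: val_inj.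
  by have := lf (-1) 0 0; rewrite scaler0 addr0 scaleN1r addNr.
split=> [hp|[c ->]]; last by rewrite lcE; exact: dhomog_is_dhomog.
by exists (f (DHomog hp)); rewrite lcE fK.
Qed.

Lemma dim_PP n m : (0 < n)%N -> has_dim (@PP R n m) 'C(m + n, n).
Proof.
move=> n0; elim: m => [|m IH].
  apply: has_dim_eq (dim_HH 0 n0) => [p|]; last by rewrite bin0 add0n binn.
  split=> [|hp]; first exact: msz_HH.
  apply/HHP => k k0; move/mszP: hp; apply; by rewrite lt0n.
apply: has_dim_eq (has_dim_add IH (dim_HH m.+1 n0) _) => [p||p].
- split=> [[q [r [hq hr ->]]]|hp].
    by apply: mszD; [exact: mszS|exact: msz_HH].
  exists (p - hpart m.+1 p), (hpart m.+1 p); split; last by rewrite subrK.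
    exact: msz_sub_hpart.
  exact: HH_hpart.
- case: n n0 {IH} => // n _ /=; rewrite addSnnS addnS -addSn.
  have := bin_sub (leq_addl m.+1 n); rewrite addnK => ->.
  by rewrite addnS binS.
by move=> hp hh; rewrite -(hpart_id hh) hpart_msz.
Qed.

Lemma dim_entries n a b (W : set (mpoly n R)) m : has_dim W m ->
  has_dim [set A : mxR R n a b | forall i j, W (A i j)] (a * b * m)%N.
Proof.
move=> hW; pose f (g : {ffun 'I_a * 'I_b -> mpoly n R}) : mxR R n a b :=
  \matrix_(i, j) g (i, j).
have lf : linear f by move=> c x y; apply/matrixP => i j; rewrite [RHS]mxE scale_mxE !mxE !ffunE.
have fi g : f g = 0 -> g = 0.
  move=> /matrixP h; apply/ffunP => -[i j]; have := h i j.
  by rewrite !mxE ffunE.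
apply: has_dim_eq (has_dim_inj lf (fun x _ => @fi x) (has_dim_ffun _ hW)) => [A|].
  split=> [[g hg <-] i j|hA]; first by rewrite mxE.
  exists [ffun ij => A ij.1 ij.2]; first by move=> [i j]; rewrite ffunE; apply: hA.
  by apply/matrixP => i j; rewrite mxE ffunE.
by rewrite card_prod !card_ord.
Qed.

Lemma dim_symmetric n (W : set (mpoly n R)) m : has_dim W m ->
  has_dim [set A : mxR R n n n | (forall i j, W (A i j)) /\ A^T = A]
    (#|[pred ij : 'I_n * 'I_n | (ij.1 <= ij.2)%N]| * m)%N.
Proof.
move=> hW; pose I := {ij : 'I_n * 'I_n | (ij.1 <= ij.2)%N}.
pose st (i j : 'I_n) := if (i <= j)%N then (i, j) else (j, i).
have srt i j : ((st i j).1 <= (st i j).2)%N.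
  by rewrite /st; case: ifPn => //; rewrite -ltnNge => /ltnW.
pose s i j : I := exist (fun ij : 'I_n * 'I_n => (ij.1 <= ij.2)%N) (st i j) (srt i j).
have sC i j : s i j = s j i.
  apply: val_inj; rewrite /= /st; case: (ltngtP i j) => // /val_inj -> //.
pose f (g : {ffun I -> mpoly n R}) : mxR R n n n := \matrix_(i, j) g (s i j).
have lf : linear f by move=> c x y; apply/matrixP => i j; rewrite [RHS]mxE scale_mxE !mxE !ffunE.
have sK (u : I) : s (val u).1 (val u).2 = u.
  by apply: val_inj; rewrite /= /st; case: u => [[i j] /= h]; rewrite h.
have fi g : f g = 0 -> g = 0.
  move=> /matrixP h; apply/ffunP => u; have := h (val u).1 (val u).2.
  by rewrite !mxE ffunE sK.
apply: has_dim_eq (has_dim_inj lf (fun x _ => @fi x) (has_dim_ffun _ hW)) => [A|].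
  split=> [[g hg <-]|[hA AT]].
    by split=> [i j|]; [rewrite mxE|apply/matrixP => i j; rewrite !mxE sC].
  exists [ffun u : I => A (val u).1 (val u).2]; first by move=> u; rewrite ffunE; apply: hA.
  apply/matrixP => i j; rewrite mxE ffunE /= /st; case: ifP => // _.
  by have /matrixP/(_ i j) := AT; rewrite mxE.
by rewrite card_sig.
Qed.

Lemma dim_PS n m : (0 < n)%N -> has_dim (@PS R n m : set (mxR R n n n))
  (#|[pred ij : 'I_n * 'I_n | (ij.1 <= ij.2)%N]| * 'C(m + n, n))%N.
Proof. by move=> n0; apply: dim_symmetric; exact: dim_PP. Qed.

(** The sum is direct by degree: the entries of q x x^T are homogeneous of degree k+1, those of
    sigma have degree at most k. *)
Lemma dim_Vminus n k : (0 < n)%N -> (0 < k)%N -> has_dim (@Vminus R n k : set (mxR R n n n))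
  (#|[pred ij : 'I_n * 'I_n | (ij.1 <= ij.2)%N]| * 'C(k + n, n)
   + 'C(k - 1 + n.-1, k - 1))%N.
Proof.
move=> n0 k0; pose f (q : mpoly n R) : mxR R n n n := q *: (xvec n *m (xvec n)^T).
have fE q i j : f q i j = q * (\X_i * \X_j).
  by rewrite !mxE big_ord_recl big_ord0 addr0 !mxE.
have lf : linear f.
  by move=> c x y; apply/matrixP => i j; rewrite [RHS]mxE scale_mxE !fE mulrDl -scalerAl.
have X0 i : (\X_i : mpoly n R) != 0.
  by rewrite -(mmeasure_poly_eq0 mdeg) mszXU.
have fi q : f q = 0 -> q = 0.
  move=> /matrixP/(_ (Ordinal n0) (Ordinal n0)); rewrite fE mxE => /eqP.
  by rewrite !mulf_eq0 (negbTE (X0 _)) !orbF => /eqP.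
apply: has_dim_eq (has_dim_add (dim_PS k n0)
    (has_dim_inj lf (fun x _ => @fi x) (dim_HH (k - 1) n0)) _) => // [A|A].
  split=> [[B [_ [hB [q hq <-] ->]]]|[B [q [hB hq ->]]]].
    by exists B, q.
  by exists B, (f q); split => //; exists q.
move=> [hA _] [q hq AE]; rewrite -AE; apply/matrixP => i j; rewrite [RHS]mxE.
have h : HH n k.+1 (f q i j).
  rewrite fE (_ : k.+1 = (k - 1 + (1 + 1))%N); last by lia.
  by apply: HHM => //; apply: HHM; exact: HHX.
by rewrite -(hpart_id h) hpart_msz //; have := hA i j; rewrite -AE.
Qed.

Lemma dim_ND n m : (0 < n)%N ->
  ('C(m.+2 + n.-1, m.+2) <= n * 'C(m.+1 + n, n))%N /\
  has_dim (@ND R n m : set (mxR R n n 1))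
    (n * 'C(m.+1 + n, n) - 'C(m.+2 + n.-1, m.+2))%N.
Proof.
move=> n0; pose f (q : mxR R n n 1) : mpoly n R := hpart m.+2 (xdot q).
have lf : linear f.
  move=> c x y; rewrite /f xdotD hpartD -hpartZ; congr (hpart _ _ + _).
  rewrite /xdot scaler_sumr; apply: eq_bigr => j _.
  by rewrite scale_mxE scalerAr.
have := has_dim_kernel lf (dim_entries n 1 (dim_PP m.+1 n0)) (dim_HH m.+2 n0).
rewrite muln1 => -[|p hp|h1 h2]; [by move=> q _; exact: HH_hpart| |].
  (* Surjectivity by Euler's identity: x.grad p = (m+2) p. *)
  exists ((m.+2%:R^-1 : R) *: (pgrad p : mxR R n n 1)).
    by move=> i j; rewrite scale_mxE mxE; apply/mszZ/msz_deriv/msz_HH.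
  rewrite linZ // /f xdot_grad (euler_HH hp) hpartZ (hpart_id hp) scalerA mulVf ?pnatr_eq0 //.
  by rewrite scale1r.
split=> //; apply: has_dim_eq h2 => // q.
by split=> /ND_spec.
Qed.

(** For m = 0 the map tau |-> tau x on constant symmetric matrices misses the linear fields with
    skew matrix, so the surjectivity behind the count needs m > 0. With m = k-2 this is where the
    count uses k >= 3. *)
Lemma dim_def_ker n m : (0 < n)%N -> (0 < m)%N ->
  let ds := #|[pred ij : 'I_n * 'I_n | (ij.1 <= ij.2)%N]| in
  exists a b, [/\ has_dim ([set A | exists2 q, Pmx (R := R) n m n 1 q & A = sym_grad q]
      : set (mxR R n n n)) a,
    has_dim (ker_x n `&` PS (R := R) n m : set (mxR R n n n)) b &
    (a + b + n * 'C(m.+1 + n.-1, m.+1) = ds * 'C(m + n, n))%N].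
Proof.
move=> n0 m0 ds.
pose f (q : mxR R n n 1) : mxR R n n n := sym_grad q.
have lf : linear f.
  move=> c x y; rewrite /f sym_gradD; congr (_ + _); apply/matrixP => i j.
  by rewrite scale_mxE !mxE !mul_mpolyC !mderivZ -scalerDr !scalerA mulrC.
have fW (q : mxR R n n 1) : Pmx n m n 1 q -> PS n m (f q).
  move=> hq; have [h1 h2] := sym_grad_PS (m := m) (q := q) (fun i j => mszS (hq i j)).
  by [].
have [a [_ ha _]] := rank_nullity lf (dim_entries n 1 (dim_PP m n0)) (dim_PS m n0) fW.
pose h (A : mxR R n n n) : mxR R n n 1 := A *m xvec n.
have lh : linear h.
  move=> c x y; apply/matrixP => i j; rewrite ord1 [RHS]mxE scale_mxE !mulmx_xvecE.
  rewrite scaler_sumr -big_split; apply: eq_bigr => l _ /=.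
  by rewrite mxE scale_mxE mulrDl scalerAl.
have hW (A : mxR R n n n) : PS n m A -> forall i j, PP n m.+1 (h A i j).
  move=> [hA _] i j; rewrite ord1 mulmx_xvecE; apply: msz_sum => l _.
  by rewrite mulrC -[m.+2]add1n; apply: mszM; [rewrite mszXU|exact: hA].
have [r [_ _ hb]] := rank_nullity lh (dim_PS m n0) (dim_entries n 1 (dim_PP m.+1 n0)) hW.
exists a, (#|[pred ij : 'I_n * 'I_n | (ij.1 <= ij.2)%N]| * 'C(m + n, n) - r)%N.
have hb' : has_dim (ker_x n `&` PS (R := R) n m : set (mxR R n n n))
    (#|[pred ij : 'I_n * 'I_n | (ij.1 <= ij.2)%N]| * 'C(m + n, n) - r)%N.
  by apply: has_dim_eq hb => // A; split=> -[h1 h2]; split.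
have ha' : has_dim ([set A | exists2 q, Pmx (R := R) n m n 1 q & A = sym_grad q] : set (mxR R n n n)) a.
  by apply: has_dim_eq ha => // A; split=> [[q hq <-]|[q hq ->]]; exists q.
split => //.
pose p (A : mxR R n n n) : mxR R n n 1 := map_mx (hpart m.+1) (h A).
have pE A i j : p A i j = hpart m.+1 (h A i j) by rewrite mxE.
have entry l1 l2 c (x y : mxR R n l1 l2) i j : (c *: x + y) i j = c *: x i j + y i j.
  by rewrite mxE scale_mxE.
have lp : linear p.
  by move=> c x y; apply/matrixP => i j; rewrite pE lh !entry hpartD hpartZ !pE.
have := has_dim_kernel lp (dim_PS m n0) (dim_entries n 1 (dim_HH m.+1 n0)).
rewrite muln1 => -[|w hw|h1 h2]; [by move=> A _ i j; rewrite pE; exact: HH_hpart| |].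
  have [|q hq qw] := @sym_grad_x_surj R n m.-1 w.
    by rewrite prednK // => i; apply: hw.
  rewrite prednK // in hq.
  exists (sym_grad q); first by apply: sym_grad_PS => i j; rewrite ord1; apply: msz_HH.
  apply/matrixP => i j; rewrite pE /h qw hpart_id //; exact: hw.
rewrite -[RHS](subnK h1); congr addn.
apply: has_dim_unique h2; apply: has_dim_eq (has_dim_add ha' hb' _) => // [A|A]; last first.
  by move=> [q _ ->] [/sym_grad_x_inj ->].
split=> [[_ [B [[q hq ->] [hB1 hB2] ->]]]|[[hA AT] pA]].
  have [hs sT] := fW q hq; have [hB BT] := hB2; split.
    by split=> [i j|]; [rewrite mxE; apply: mszD; [exact: hs|exact: hB]|rewrite linearD /= [X in X + _]sT BT].
  apply/matrixP => i j; rewrite pE /h mulmxDl hB1 addr0 [RHS]mxE; apply: hpart_msz.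
  rewrite ord1 mulmx_xvecE; apply: msz_sum => l _.
  rewrite mulrC -[m.+1]add1n; apply: mszM; rewrite ?mszXU // mxE.
  by apply/mszZ/mszD; apply/msz_deriv/hq.
(* Decomposing A directly would give a q of degree m+1, one too many. Its top part T already
   satisfies T x = 0, so T goes to the kernel and only A - T, of degree m-1, is decomposed. *)
pose T : 'M[mpoly n R]_n := map_mx (hpart m) A.
have TE i j : T i j = hpart m (A i j) by rewrite mxE.
have TT : T^T = T.
  by apply/matrixP => i j; rewrite [LHS]mxE !TE; have /matrixP/(_ i j) := AT; rewrite mxE => ->.
have Tx : T *m xvec n = 0.
  apply/matrixP => i j; rewrite ord1 [RHS]mxE mulmx_xvecE.
  have := congr1 (fun B : 'cV_n => B i 0) pA; rewrite pE [RHS]mxE mulmx_xvecE => e.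
  apply: (eq_trans _ e); rewrite hpart_sum; apply: eq_bigr => l _.
  by rewrite TE mulrC -hpart_mulX mulrC.
have [|q [W [hq hW1 [hW2 WT] AE]]] := @PS_decomposition R n (A - T) m.-1.
  split=> [i j|]; last by rewrite linearB /= AT TT.
  by rewrite mxE [X in _ + X]mxE TE /PP /= prednK //; apply: msz_sub_hpart; apply: hA.
rewrite prednK // in hq.
exists (sym_grad q), (W + T); split.
- by exists q.
- split; first by rewrite /ker_x /= mulmxDl hW1 Tx addr0.
  split=> [i j|]; last by rewrite linearD /= WT TT.
  rewrite mxE TE; apply: mszD; last exact/msz_HH/HH_hpart.
  by apply: leq_trans (hW2 i j) _; rewrite prednK // leqnSn.
- by rewrite addrA -AE subrK.
Qed.
End PolynomialDimensions.

(** * Counting the degrees of freedom *)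

Lemma card_faces d r : (r <= d.+1)%N -> #|faces d r| = 'C(d.+1, r).
Proof.
move=> hr; rewrite -(bin_sub hr).
have := card_draws 'I_d.+1 (d.+1 - r)%N; rewrite card_ord => <-.
apply: eq_card => F; rewrite !inE.
by rewrite -[RHS](eqn_add2r r) subnK.
Qed.

Lemma card_ordered_pairs r : #|[pred ij : 'I_r * 'I_r | (ij.1 <= ij.2)%N]| = 'C(r.+1, 2).
Proof.
rewrite -sum1_card -(pair_big_dep xpredT (fun i j : 'I_r => (i <= j)%N) (fun _ _ => 1%N)) /=.
rewrite (exchange_big_dep xpredT) //= -bin2_sum big_nat_recl // add0n big_mkord.
apply: eq_bigr => j _.
by rewrite (big_ord_narrow (op := addn) (ltn_ord j)) sum1_card card_ord.
Qed.

(** With r = s+2, split C(r+1, 2) as C(r, 2) + r and absorb each summand into C(N+1, r);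
    Vandermonde's identity then applies to both terms. *)
Lemma mul_bin_tri N s : ('C(N.+1, s.+2) * 'C(s.+3, 2) =
  'C(N.+1, 2) * 'C(N.-1, s) + N.+1 * 'C(N, s.+1))%N.
Proof.
have h1 := mul_bin_diag N.+1 s.+1; have h2 := mul_bin_diag N s.
have h3 := mul_bin_diag s.+3 1; have h4 := mul_bin_diag N.+1 1.
rewrite !bin1 /= in h1 h3 h4.
have : (2 * ('C(N.+1, s.+2) * 'C(s.+3, 2)) =
    2 * ('C(N.+1, 2) * 'C(N.-1, s) + N.+1 * 'C(N, s.+1)))%N.
  rewrite mulnCA -h3 [RHS]mulnDr [in RHS](mulnA 2) -h4 -(mulnA N.+1 N) h2.
  rewrite (_ : 'C(N.+1, s.+2) * (s.+3 * s.+2) = s.+3 * (s.+2 * 'C(N.+1, s.+2)))%N; last by ring.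
  by rewrite -h1; ring.
by move/eqP; rewrite eqn_pmul2l // => /eqP.
Qed.

(** Here d = D+2 and K = k-1: a face of dimension d-r carries C(k-1, d-r) test functions, with the
    same upper index for every r. The vertex values are the term r = d, where this number is 1. *)
Lemma sum_face_dofs D K :
  (\sum_(1 <= r < D.+3) 'C(D.+3, r) * ('C(r.+1, 2) * 'C(K, D.+2 - r)) =
  'C(D.+3, 2) * 'C(D.+1 + K, D) + D.+3 * 'C(D.+2 + K, D.+1))%N.
Proof.
rewrite big_add1 /= big_mkord big_ord_recl /= bin1 binn mul1n.
rewrite -!binomial.Vandermonde [in X in (_ + D.+3 * X)%N]big_ord_recl /= bin0 mul1n subn0.
under eq_bigr => s _ do rewrite mulnA mul_bin_tri mulnDl subSS subSS -!mulnA.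
rewrite big_split -!big_distrr /= addnCA mulnDr; congr (_ + (_ + _))%N.
Qed.

Lemma num_dofsE (R : realType) d k : (2 <= d)%N -> (maxn d 3 <= k)%N ->
  num_dofs R d k = ('C(d.+1, 2) * 'C(k + d, d) + 'C(k - 1 + d.-1, k - 1))%N.
Proof.
case: d => [|[|D]] // _; rewrite geq_max => /andP[dk k3].
have [K kE] : exists K, k = K.+3 by exists (k - 3)%N; lia.
have n0 : (0 < D.+2 - 1)%N by [].
have cf r : (r <= D.+2)%N -> #|faces D.+2 r| = 'C(D.+3, r).
  by move=> hr; apply: card_faces; exact: leqW.
have [hle /fdimE hND] := dim_ND R (k - 2) n0.
have [a [b [/fdimE ha /fdimE hb hab]]] := @dim_def_ker R D.+2 (k - 2) isT (ltac:(lia)).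
have /fdimE hP := dim_PP R (k - 1) n0.
rewrite /num_dofs /dim_mx hND [fdim _ (ker_x _ `&` _)]hb.
rewrite [fdim _ [set A | exists2 q, _ & _]]ha /dim_poly.
rewrite big_const_ord iter_addn_0 hP !sum_nat_const.
under eq_big_nat => r /andP[r1 rd].
  have rD : (0 < D.+2 - r)%N by lia.
  have /fdimE hr := dim_PP R (k + r - D.+3) rD.
  rewrite (eq_bigr (fun _ => 'C(r.+1, 2) * 'C(k - 1, D.+2 - r))%N); last first.
    move=> F _; rewrite card_ordered_pairs; congr (_ * _)%N.
    by rewrite [LHS]hr; congr 'C(_, _); lia.
  rewrite sum_nat_const cf; last by lia.
  over.
have hS := sum_face_dofs D (k - 1); rewrite big_nat_recr //= subnn bin0 binSn muln1 in hS.
have e2 : (D.+2 * D.+3)./2 = 'C(D.+3, 2) by rewrite bin2 mulnC.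
rewrite card_ordered_pairs in hab.
rewrite e2 !cf // bin1.
move: hS hab hle; rewrite kE !subSS !subn0 /=.
(* N = k+d-2. Pascal's rule brings all binomials down to C(N, d), C(N, d-1) and C(N, d-2), after
   which only algebra is left. *)
set N := (K + D).+3.
have E1 : 'C(K.+2 + D.+1, D.+1) = 'C(N, D.+1) by congr 'C(_, _); lia.
have E2 : 'C(K.+3 + D, K.+3) = 'C(N, D).
  by rewrite -(bin_sub (leq_addr D K.+3)) addKn; congr 'C(_, _); lia.
have E3 : 'C(D.+1 + K.+2, D) = 'C(N, D) by congr 'C(_, _); lia.
have E4 : 'C(D.+2 + K.+2, D.+1) = ('C(N, D.+1) + 'C(N, D))%N.
  by rewrite -binS; congr 'C(_, _); lia.
have E5 : 'C(K.+2 + D.+1, K.+2) = 'C(N, D.+1).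
  by rewrite -(bin_sub (leq_addr D.+1 K.+2)) addKn E1.
have E6 : 'C(K.+1 + D.+2, D.+2) = 'C(N, D.+2) by congr 'C(_, _); lia.
have E7 : 'C(K.+3 + D.+2, D.+2) = ('C(N, D.+2) + 'C(N, D.+1) + ('C(N, D.+1) + 'C(N, D)))%N.
  by rewrite -!binS; congr 'C(_, _); lia.
rewrite E1 E2 E3 E4 E5 E6 E7.
set S := (\sum_(1 <= r < _) _)%N => hS hab hle.
have e3 := mul_bin_diag D.+3 1; rewrite bin1 /= in e3.
move: S hab hS hle e3 => S.
move: 'C(D.+3, 2) 'C(N, D.+2) 'C(N, D.+1) 'C(N, D) => T A B C hab hS hle e3.
(* The dimension of ND_{k-2} on a facet; [hle] says that the subtraction is exact. *)
set x := (D.+1 * B - C)%N; have e1 : (x + C = D.+1 * B)%N := subnK hle.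
have e4 : (D.+3 * x + D.+3 * C = D.+3 * (D.+1 * B))%N by rewrite -mulnDr e1.
have e5 : (D.+3 * D.+2 * B = 2 * T * B)%N by rewrite e3.
nia.
Qed.

Theorem theorem5p11 (R : realType) (d k : nat) (v : 'I_d.+1 -> 'cV[R]_d)
    (o : nat -> {set 'I_d.+1} -> 'cV[R]_d)
    (t : forall r : nat, {set 'I_d.+1} -> 'M[R]_(d, d - r))
    (n : forall r : nat, {set 'I_d.+1} -> 'M[R]_(d, r))
    (hd : (2 <= d)%N) (hk : (maxn d 3 <= k)%N)
    (hK : nondegenerate_simplex v) (h0 : simplex v 0)
    (hframe : forall r F, (1 <= r <= d - 1)%N -> F \in faces d r ->
       face_frame v F (o r F) (t r F) (n r F)) :
  (forall tau : 'M[mpoly d R]_d, Vminus d k tau ->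
     (forall delta : 'I_d.+1, ev_mx (v delta) tau = 0) ->
     (forall r F, (1 <= r <= d - 1)%N -> F \in faces d r ->
        forall (i j : 'I_r) q, PP (d - r) (k + r - d.+1) q ->
        face_int v F (fun x =>
          dot (col i (n r F)) (ev_mx x tau *m col j (n r F))
          * ev (face_coord (o r F) (t r F) x) q) = 0) ->
     (forall F, F \in faces d 1 ->
        forall q, ND (d - 1) (k - 2) q ->
        face_int v F (fun x =>
          dot ((1%:M - n 1%N F *m (n 1%N F)^T) *m (ev_mx x tau *m n 1%N F))
              (t 1%N F *m ev_mx (face_coord (o 1%N F) (t 1%N F) x) q)) = 0) ->
     (forall F, F \in faces d 1 ->
        forall p, PP (d - 1) (k - 1) p ->
        face_int v F (fun x =>
          (dot (n 1%N F) (ev_mx x (div_mx tau))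
           + ev x (div_surf (t 1%N F) (tau *m cst_mx d (n 1%N F))))
          * ev (face_coord (o 1%N F) (t 1%N F) x) p) = 0) ->
     (forall q, Pmx d (k - 2) d 1 q ->
        face_int v [set: 'I_d.+1]%SET (fun x =>
          mxdot (ev_mx x tau) (ev_mx x (sym_grad q))) = 0) ->
     (forall q, (ker_x d `&` PS d (k - 2)) q ->
        face_int v [set: 'I_d.+1]%SET (fun x =>
          mxdot (ev_mx x tau) (ev_mx x q)) = 0) ->
     tau = 0) /\
  is_dim (@scale_mx R d d d) (Vminus d k) (num_dofs R d k).
Proof.
split=> [tau|]; first exact: (dofs_determine hd hk hK hframe).
have [d2 dk] : (0 < d)%N /\ (0 < k)%N by split; lia.
have := dim_Vminus R d2 dk.
by rewrite card_ordered_pairs -(num_dofsE R hd hk).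
Qed.
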